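(* Given a finite set $\Sigma$ of tgds, the problem of testing whether $\Sigma\in\mathsf{CStr}$ is in $\mathsf{\Pi^p_2}$.
   Context: Instances are finite sets of atoms over constants and nulls. A tgd is $\xi=\forall\bar x\forall\bar y\,(\alpha(\bar x,\bar y)\rightarrow\exists\bar z\,\beta(\bar x,\bar z))$; its universal variables are those in $\bar x,\bar y$. For $h$ mapping the universal variables of $\xi$ to $\mathrm{dom}(I)$, $h(\xi)$ replaces each universal variable $x$ by $h(x)$. An oblivious chase step $I\xrightarrow{(\xi_1,h_1)}J$ requires $h_1(\alpha_1)\subseteq I$ and sets $J=I\cup h_1'(\beta_1)$, $h_1'$ extending $h_1$ by fresh nulls on existential variables. $\xi_1\prec\xi_2$ iff there exist an instance $I$ and mappings $h_1,h_2$ from the universal variables of $\xi_1,\xi_2$ to $\mathrm{dom}(I)$ with (i) $I\models h_2(\xi_2)$, (ii) $I\xrightarrow{(\xi_1,h_1)}J$ by an oblivious step, (iii) $J\not\models h_2(\xi_2)$. A position is a pair $(R,i)$, $1\le i\le\mathrm{arity}(R)$. The dependency graph of a tgd set has positions as vertices and an edge $(R,i)\to(S,j)$ whenever some tgd has a variable $x\in\bar x$ at $(R,i)$ in its body and either $x$ occurs at $(S,j)$ in the head (universal edge) or an existential variable occurs at $(S,j)$ in the head (existential edge); the set is weakly acyclic if no cycle passes through an existential edge. The chase graph of $\Sigma$ has vertices $\Sigma$ and edges $\xi_1\to\xi_2$ iff $\xi_1\prec\xi_2$; $\Sigma\in\mathsf{CStr}$ iff the set of tgds on every simple cycle of the chase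 graph is weakly acyclic. *)

(* Defs.v *)
From Stdlib Require Import List Arith Bool Relations.
Import ListNotations.

Inductive value : Type := Const (n : nat) | Null (n : nat).

(* Relation symbols and variables are natural numbers.
   An atom of a tgd: relation symbol + list of variables.
   A fact of an instance: relation symbol + list of values. *)
Definition vatom : Type := (nat * list nat)%type.
Definition fact : Type := (nat * list value)%type.

(* An instance: a finite set of facts (given as a list). *)
Definition instance : Type := list fact.

(* A tgd  forall x forall y (alpha(x,y) -> exists z beta(x,z)) :
   body = alpha, head = beta (conjunctions of atoms, given as lists). *)
Record tgd : Type := mkTgd { body : list vatom ; head : list vatom }.

(* universal variables (x and y) = the variables of the body *)
Definition uvars (xi : tgd) : list nat := flat_map snd (body xi).
Definition hvars (xi : tgd) : list nat := flat_map snd (head xi).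
Definition is_frontier (xi : tgd) (x : nat) : Prop := In x (uvars xi) /\ In x (hvars xi).
Definition is_exist (xi : tgd) (z : nat) : Prop := In z (hvars xi) /\ ~ In z (uvars xi).

Definition dom (I : instance) : list value := flat_map snd I.

Definition inst (h : nat -> value) (a : vatom) : fact := (fst a, map h (snd a)).

Definition sat_inst (I : instance) (xi : tgd) (h : nat -> value) : Prop :=
  incl (map (inst h) (body xi)) I ->
  exists g : nat -> value,
    (forall x, In x (uvars xi) -> g x = h x) /\
    incl (map (inst g) (head xi)) I.

Definition obl_step (I : instance) (xi : tgd) (h : nat -> value) (J : instance) : Prop :=
  incl (map (inst h) (body xi)) I /\
  exists h' : nat -> value,
    (forall x, In x (uvars xi) -> h' x = h x) /\
    (forall z, is_exist xi z -> exists n, h' z = Null n /\ ~ In (Null n) (dom I)) /\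
    (forall z1 z2, is_exist xi z1 -> is_exist xi z2 -> h' z1 = h' z2 -> z1 = z2) /\
    J = I ++ map (inst h') (head xi).

Definition maps_into (xi : tgd) (h : nat -> value) (I : instance) : Prop :=
  forall x, In x (uvars xi) -> In (h x) (dom I).

Definition prec (xi1 xi2 : tgd) : Prop :=
  exists (I J : instance) (h1 h2 : nat -> value),
    maps_into xi1 h1 I /\ maps_into xi2 h2 I /\
    sat_inst I xi2 h2 /\
    obl_step I xi1 h1 J /\
    ~ sat_inst J xi2 h2.

(* position (R, i); i is 0-based here (i < arity R) *)
Definition position : Type := (nat * nat)%type.

Definition occurs_at (l : list vatom) (x : nat) (p : position) : Prop :=
  exists args, In (fst p, args) l /\ nth_error args (snd p) = Some x.

Definition univ_edge (S : list tgd) (p q : position) : Prop :=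
  exists xi, In xi S /\ exists x, is_frontier xi x /\
    occurs_at (body xi) x p /\ occurs_at (head xi) x q.

Definition exist_edge (S : list tgd) (p q : position) : Prop :=
  exists xi, In xi S /\ exists x, is_frontier xi x /\
    occurs_at (body xi) x p /\
    exists z, is_exist xi z /\ occurs_at (head xi) z q.

Definition dep_edge (S : list tgd) (p q : position) : Prop :=
  univ_edge S p q \/ exist_edge S p q.

Definition weakly_acyclic (S : list tgd) : Prop :=
  forall p q, exist_edge S p q -> ~ clos_refl_trans position (dep_edge S) q p.

Definition simple_cycle (Sigma c : list tgd) : Prop :=
  c <> [] /\ NoDup c /\ incl c Sigma /\
  forall i xi xi', nth_error c i = Some xi ->
    nth_error c (S i mod length c) = Some xi' -> prec xi xi'.

Definition CStr (Sigma : list tgd) : Prop :=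
  forall c, simple_cycle Sigma c -> weakly_acyclic c.

(* Well-formedness of a finite set of tgds: every relation symbol is used
   with a single arity (i.e. the tgds are over a schema). *)
Definition well_formed (Sigma : list tgd) : Prop :=
  forall xi1 xi2 a1 a2, In xi1 Sigma -> In xi2 Sigma ->
    In a1 (body xi1 ++ head xi1) -> In a2 (body xi2 ++ head xi2) ->
    fst a1 = fst a2 -> length (snd a1) = length (snd a2).

Fixpoint bin_aux (fuel n : nat) : list bool :=
  match fuel with
  | 0 => []
  | S f => if n =? 0 then [] else Nat.odd n :: bin_aux f (Nat.div2 n)
  end.
Definition bin (n : nat) : list bool := bin_aux n n.

Definition dbl (w : list bool) : list bool := flat_map (fun b => [b; b]) w.
Definition sep : list bool := [false; true].

(* self-delimiting encoding of a natural number *)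
Definition enc_nat (n : nat) : list bool := dbl (bin n) ++ sep.
Definition enc_list {A} (f : A -> list bool) (l : list A) : list bool :=
  enc_nat (length l) ++ flat_map f l.
Definition enc_atom (a : vatom) : list bool := enc_nat (fst a) ++ enc_list enc_nat (snd a).
Definition enc_tgd (xi : tgd) : list bool :=
  enc_list enc_atom (body xi) ++ enc_list enc_atom (head xi).
Definition enc_tgds (Sigma : list tgd) : list bool := enc_list enc_tgd Sigma.

Definition CStr_problem (w : list bool) : Prop :=
  exists Sigma, well_formed Sigma /\ w = enc_tgds Sigma /\ CStr Sigma.

Inductive move : Type := MLeft | MRight | MStay.
Definition symbol : Type := option bool.   (* None = blank *)

(* states are 0 .. nst-1, start state 0 *)
Record TM : Type := {
  nst : nat;
  delta : nat -> symbol -> (nat * symbol * move);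
  qacc : nat;
  qrej : nat;
  delta_ok : forall q s, q < nst -> fst (fst (delta q s)) < nst;
  qacc_ok : qacc < nst;
  qrej_ok : qrej < nst;
  qacc_rej : qacc <> qrej
}.

(* configuration: state, left part of tape (reversed), tape from head on *)
Definition config : Type := (nat * list symbol * list symbol)%type.

Definition tm_step (M : TM) (c : config) : config :=
  let '(q, l, r) := c in
  if (q =? qacc M) || (q =? qrej M) then c else
  let '(q', w, m) := delta M q (hd None r) in
  let r' := w :: tl r in
  match m with
  | MLeft => match l with
             | a :: l' => (q', l', a :: r')
             | [] => (q', [], r')
             end
  | MRight => (q', w :: l, tl r)
  | MStay => (q', l, r')
  end.

Definition tm_run (M : TM) (n : nat) (c : config) : config := Nat.iter n (tm_step M) c.
Definition tm_init (w : list bool) : config := (0, [], map Some w).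
Definition cstate (c : config) : nat := fst (fst c).

Definition poly (c k n : nat) : nat := c * n ^ k + c.

Definition decides_in_time (M : TM) (L : list bool -> Prop) (c k : nat) : Prop :=
  forall w, let q := cstate (tm_run M (poly c k (length w)) (tm_init w)) in
    (q = qacc M \/ q = qrej M) /\ (q = qacc M <-> L w).

Definition in_P (L : list bool -> Prop) : Prop :=
  exists M c k, decides_in_time M L c k.

Definition enc_triple (x y z : list bool) : list bool :=
  dbl x ++ sep ++ dbl y ++ sep ++ dbl z.

Definition in_Pi2P (L : list bool -> Prop) : Prop :=
  exists (V : list bool -> Prop) (c k : nat), in_P V /\
    forall x, L x <->
      (forall y, length y <= poly c k (length x) ->
         exists z, length z <= poly c k (length x) /\ V (enc_triple x y z)).

(* Main.v *)
(**
If a chase step violates [h2(xi2)], then [h2] sends some body atom of [xi2] to a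
fact produced by the step, and shrinking the instance to the images of the two
bodies keeps the violation. Hence [xi1 < xi2] holds iff there are [h1], [h2],
with values bounded by the number of variables, such that some body atom of
[xi2] lies in the image of the head of [xi1] but not in that of its body, and no
extension of [h2] maps the head of [xi2] into the union of the images. So a set
of tgds is outside CStr iff some [y], listing a simple cycle, the maps [h1], [h2]
of its edges and an existential edge [p -> q] of its dependency graph, has the
property that no [z] is a refuting extension of some [h2], or a set of positions
closed under the dependency graph that contains [q] but not [p].

The verifier works with numbers bounded by the length of its input: positions in
the input word, array entries, loop counters. It is an expression built from
capped successor, bit access and bounded recursion. A Turing machine keeps each
number as a mark on the tape, so that every operation takes linear time and the
nesting of recursions bounds the running time by a polynomial.
*)

From Stdlib Require Import List Arith Bool Lia Relations Classical.
Require Import Defs.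
Import ListNotations.

(** * Structured tape programs and their compilation to Turing machines *)

(** Membership in P speaks of every word, also of those that are no triples, so all loops of the
    verifier are bounded and no number exceeds the input length [n]. Arithmetic is therefore
    saturated and compared with true arithmetic only after truncation at [n]; a triple is long
    enough for every number that matters to be exact.

    Names of relations and variables are written in binary and may be exponentially large, so they
    are never read as numbers: a name is identified by the least position of [x] at which its code
    starts. Values are numbers too, even for those present before a chase step and odd for the nulls
    it creates. Since both mappings in [prec] go into the domain of the instance before the step,
    [h2] takes even codes only; this keeps the new nulls out of the matched body atom.

    A path from [q] back to [p] is not part of [y]. Its absence has a short certificate, a closed
    set separating the two positions, so this question is left to [z], just like the absence of
    extensions. *)

Definition upd {A : Type} (f : nat -> A) (i : nat) (a : A) : nat -> A :=
  fun j => if j =? i then a else f j.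

Lemma upd_same {A : Type} (f : nat -> A) i a : upd f i a i = a.
Proof. unfold upd. now rewrite Nat.eqb_refl. Qed.

Lemma upd_other {A : Type} (f : nat -> A) i a j : j <> i -> upd f i a j = f j.
Proof. intros H. unfold upd. apply Nat.eqb_neq in H. now rewrite H. Qed.

Definition tape : Type := nat -> symbol.

Inductive prog : Type :=
| PSkip
| PWrite (s : symbol)
| PLeft
| PRight
| PSeq (a b : prog)
| PIf (p : symbol -> bool) (a b : prog)
| PWhile (p : symbol -> bool) (a : prog).

(* [exec P h T t h' T']: started with the head on cell [h] of tape [T], [P]
   stops with the head on [h'] of [T'], and its machine code takes [t] steps. *)
Inductive exec : prog -> nat -> tape -> nat -> nat -> tape -> Prop :=
| exec_skip h T : exec PSkip h T 0 h T
| exec_write s h T : exec (PWrite s) h T 1 h (upd T h s)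
| exec_left h T : exec PLeft h T 1 (pred h) T
| exec_right h T : exec PRight h T 1 (S h) T
| exec_seq a b h T t1 h1 T1 t2 h2 T2 :
    exec a h T t1 h1 T1 -> exec b h1 T1 t2 h2 T2 ->
    exec (PSeq a b) h T (t1 + t2) h2 T2
| exec_if_true p a b h T t h' T' :
    p (T h) = true -> exec a h T t h' T' -> exec (PIf p a b) h T (1 + (t + 1)) h' T'
| exec_if_false p a b h T t h' T' :
    p (T h) = false -> exec b h T t h' T' -> exec (PIf p a b) h T (1 + t) h' T'
| exec_while_end p a h T :
    p (T h) = false -> exec (PWhile p a) h T 1 h T
| exec_while_step p a h T t1 h1 T1 t2 h2 T2 :
    p (T h) = true -> exec a h T t1 h1 T1 -> exec (PWhile p a) h1 T1 t2 h2 T2 ->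
    exec (PWhile p a) h T (1 + (t1 + (1 + t2))) h2 T2.

Inductive instr : Type :=
| IWrite (s : symbol)
| ILeft
| IRight
| IBranch (p : symbol -> bool) (target : nat)
| IJump (target : nat).

Fixpoint psize (P : prog) : nat :=
  match P with
  | PSkip => 0
  | PWrite _ | PLeft | PRight => 1
  | PSeq a b => psize a + psize b
  | PIf _ a b => 1 + (psize a + (1 + psize b))
  | PWhile _ a => 1 + (psize a + 1)
  end.

(* [IBranch] falls through when its test succeeds and jumps otherwise. *)
Fixpoint asm (base : nat) (P : prog) : list instr :=
  match P with
  | PSkip => []
  | PWrite s => [IWrite s]
  | PLeft => [ILeft]
  | PRight => [IRight]
  | PSeq a b => asm base a ++ asm (base + psize a) b
  | PIf p a b =>
      IBranch p (base + 1 + psize a + 1) :: asm (base + 1) a ++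
      IJump (base + psize (PIf p a b)) :: asm (base + 1 + psize a + 1) b
  | PWhile p a =>
      IBranch p (base + psize (PWhile p a)) :: asm (base + 1) a ++ [IJump base]
  end.

Lemma asm_length P : forall base, length (asm base P) = psize P.
Proof.
  induction P; intros base; cbn; repeat (rewrite length_app; cbn);
    rewrite ?IHP, ?IHP1, ?IHP2; lia.
Qed.

(** Capping jump targets at the code length keeps successor states in range for arbitrary code
    lists, as [delta_ok] demands. Targets produced by [asm] are not affected by the cap. *)
Definition instr_step (len q : nat) (i : instr) (s : symbol) : nat * symbol * move :=
  match i with
  | IWrite s' => (S q, s', MStay)
  | ILeft => (S q, s, MLeft)
  | IRight => (S q, s, MRight)
  | IBranch p t => (if p s then S q else Nat.min t len, s, MStay)
  | IJump t => (Nat.min t len, s, MStay)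
  end.

(** Addresses serve as states. The address just past the code performs the final test [facc] on the
    scanned symbol; the two states after it accept and reject. *)
Definition machine_delta (facc : symbol -> bool) (C : list instr) (q : nat) (s : symbol)
  : nat * symbol * move :=
  match nth_error C q with
  | Some i => instr_step (length C) q i s
  | None => (if facc s then S (length C) else S (S (length C)), s, MStay)
  end.

Lemma machine_delta_ok facc C q s :
  q < 3 + length C -> fst (fst (machine_delta facc C q s)) < 3 + length C.
Proof.
  intros Hq. unfold machine_delta. destruct (nth_error C q) as [i|] eqn:E.
  - assert (q < length C) by (apply nth_error_Some; congruence).
    destruct i; cbn; try (destruct (p s)); cbn; lia.
  - destruct (facc s); cbn; lia.
Qed.

Definition machine (facc : symbol -> bool) (C : list instr) : TM.
Proof.
  refine {| nst := 3 + length C; delta := machine_delta facc C;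
            qacc := S (length C); qrej := S (S (length C)) |}.
  - apply machine_delta_ok.
  - lia.
  - lia.
  - lia.
Defined.

(** A pair of lists stands for a total tape up to trailing blanks, which is why contents are
    compared cell by cell and not as lists. *)
Definition represents (l r : list symbol) (h : nat) (T : tape) : Prop :=
  length l = h /\ forall i, nth i (rev l ++ r) None = T i.

Lemma represents_head l r h T : represents l r h T -> hd None r = T h.
Proof.
  intros [Hl HT]. rewrite <- HT, app_nth2; rewrite length_rev; [|lia].
  replace (h - length l) with 0 by lia. now destruct r.
Qed.

Lemma represents_write l r h T s :
  represents l r h T -> represents l (s :: tl r) h (upd T h s).
Proof.
  intros [Hl HT]. split; [exact Hl|]. intros i. unfold upd.
  destruct (Nat.eqb_spec i h) as [->|Hi].
  - rewrite app_nth2; rewrite length_rev; [|lia]. now replace (h - length l) with 0 by lia.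
  - rewrite <- HT. destruct (lt_dec i h).
    + now rewrite !app_nth1 by (rewrite length_rev; lia).
    + rewrite !app_nth2 by (rewrite length_rev; lia). rewrite length_rev.
      destruct (i - length l) eqn:E; [lia|]. destruct r; cbn; [now destruct n0|reflexivity].
Qed.

Lemma represents_rewrite l r h T :
  represents l r h T -> represents l (hd None r :: tl r) h T.
Proof.
  intros H. pose proof (represents_head _ _ _ _ H) as Hh.
  destruct (represents_write _ _ _ _ (hd None r) H) as [Hl HT]. split; [exact Hl|].
  intros i. rewrite HT. unfold upd. destruct (Nat.eqb_spec i h); congruence.
Qed.

Lemma represents_right l r h T :
  represents l r h T -> represents (hd None r :: l) (tl r) (S h) T.
Proof.
  intros H. destruct (represents_rewrite _ _ _ _ H) as [Hl HT]. split; [cbn; lia|].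
  intros i. rewrite <- HT. cbn. now rewrite <- app_assoc.
Qed.

Lemma represents_left a l r h T :
  represents (a :: l) r h T -> represents l (a :: r) (pred h) T.
Proof.
  intros [Hl HT]. split; [cbn in Hl; lia|].
  intros i. rewrite <- HT. cbn. now rewrite <- app_assoc.
Qed.

Lemma tm_run_add M a b c : tm_run M (a + b) c = tm_run M b (tm_run M a c).
Proof. unfold tm_run. rewrite Nat.add_comm. apply Nat.iter_add. Qed.

Lemma tm_step_machine facc C q l r :
  q <= length C ->
  tm_step (machine facc C) (q, l, r) =
  let '(q', w, m) := machine_delta facc C q (hd None r) in
  match m with
  | MLeft => match l with
             | a :: l' => (q', l', a :: w :: tl r)
             | [] => (q', [], w :: tl r)
             end
  | MRight => (q', w :: l, tl r)
  | MStay => (q', l, w :: tl r)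
  end.
Proof.
  intros Hq. unfold tm_step. cbn [qacc qrej machine delta].
  destruct (Nat.eqb_spec q (S (length C))); [lia|].
  destruct (Nat.eqb_spec q (S (S (length C)))); [lia|]. reflexivity.
Qed.

Definition code_at (C : list instr) (q : nat) (code : list instr) : Prop :=
  forall i a, nth_error code i = Some a -> nth_error C (q + i) = Some a.

Lemma code_at_app C q c1 c2 :
  code_at C q (c1 ++ c2) -> code_at C q c1 /\ code_at C (q + length c1) c2.
Proof.
  intros H. split; intros i a Hi.
  - apply H. rewrite nth_error_app1; [exact Hi|]. apply nth_error_Some. congruence.
  - rewrite <- Nat.add_assoc. apply H. rewrite nth_error_app2 by lia.
    now replace (length c1 + i - length c1) with i by lia.
Qed.

Lemma code_at_cons C q a code :
  code_at C q (a :: code) -> nth_error C q = Some a /\ code_at C (S q) code.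
Proof.
  intros H. split; [rewrite <- (Nat.add_0_r q); now apply H|].
  intros i b Hi. replace (S q + i) with (q + S i) by lia. now apply H.
Qed.

Definition runs (facc : symbol -> bool) (C : list instr) (t q h : nat) (T : tape)
    (q' h' : nat) (T' : tape) : Prop :=
  forall l r, represents l r h T -> exists l' r',
    tm_run (machine facc C) t (q, l, r) = (q', l', r') /\ represents l' r' h' T'.

Lemma runs_trans {facc C t1 t2 q h T q1 h1 T1 q2 h2 T2} :
  runs facc C t1 q h T q1 h1 T1 -> runs facc C t2 q1 h1 T1 q2 h2 T2 ->
  runs facc C (t1 + t2) q h T q2 h2 T2.
Proof.
  intros H1 H2 l r Hr. destruct (H1 l r Hr) as (l1 & r1 & E1 & R1).
  destruct (H2 l1 r1 R1) as (l2 & r2 & E2 & R2). exists l2, r2.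
  rewrite tm_run_add, E1. now split.
Qed.

Lemma runs_instr facc C q h T i :
  nth_error C q = Some i ->
  let '(q', w, m) := instr_step (length C) q i (T h) in
  runs facc C 1 q h T q' (match m with MLeft => pred h | MRight => S h | MStay => h end)
    (upd T h w).
Proof.
  intros Hi. destruct (instr_step _ _ _ _) as [[q' w] m] eqn:E. intros l r H.
  change (tm_run ?M 1 ?c) with (tm_step M c).
  rewrite tm_step_machine by (apply Nat.lt_le_incl, nth_error_Some; congruence).
  unfold machine_delta. rewrite Hi, (represents_head _ _ _ _ H), E.
  pose proof (represents_write _ _ _ _ w H) as Hw.
  destruct m.
  - destruct l as [|a l].
    + eexists _, _. split; [reflexivity|]. destruct Hw as [Hl HT]. cbn in Hl.
      split; [cbn; lia|exact HT].
    + eexists _, _. split; [reflexivity|]. now apply represents_left.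
  - eexists _, _. split; [reflexivity|]. now apply (represents_right _ _ _ _ Hw).
  - eexists _, _. split; [reflexivity|exact Hw].
Qed.

Lemma upd_id (T : tape) h i : upd T h (T h) i = T i.
Proof. unfold upd. destruct (Nat.eqb_spec i h); congruence. Qed.

(** An instruction that only moves or branches still writes back the symbol it read, so the
    resulting tape is the old one pointwise, but not as a term. *)
Lemma runs_keep {facc C t q h T q' h' T' k} :
  runs facc C t q h T q' h' (upd T' k (T' k)) -> runs facc C t q h T q' h' T'.
Proof.
  intros H l r Hr. destruct (H l r Hr) as (l' & r' & E & Hl & HT).
  exists l', r'. split; [exact E|]. split; [exact Hl|]. intros i. now rewrite HT, upd_id.
Qed.

Lemma code_at_end C q code : code_at C q code -> code <> [] -> q + length code <= length C.
Proof.
  intros H Hne. destruct code as [|a code] using rev_ind; [congruence|].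
  rewrite length_app, Nat.add_1_r, Nat.add_succ_r. apply nth_error_Some.
  rewrite (H (length code) a); [discriminate|]. rewrite nth_error_app2, Nat.sub_diag by lia.
  reflexivity.
Qed.

(** Induction on the execution, not on the program, because a loop reruns its own code: the
    remaining iterations are again an execution of the same [PWhile] at the same address. *)
Lemma exec_sound facc C P h T t h' T' :
  exec P h T t h' T' -> forall q, code_at C q (asm q P) ->
  runs facc C t q h T (q + psize P) h' T'.
Proof.
  induction 1; intros q HC; cbn [psize] in *;
    pose proof (fun Hne => code_at_end C q _ HC Hne) as Hend; rewrite asm_length in Hend;
    cbn [asm psize] in HC, Hend.
  - intros l r Hr. exists l, r. rewrite Nat.add_0_r. now split.
  - apply code_at_cons in HC. rewrite Nat.add_1_r.
    exact (runs_instr facc C q h T _ (proj1 HC)).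
  - apply code_at_cons in HC. rewrite Nat.add_1_r. apply (runs_keep (k := h)).
    exact (runs_instr facc C q h T _ (proj1 HC)).
  - apply code_at_cons in HC. rewrite Nat.add_1_r. apply (runs_keep (k := h)).
    exact (runs_instr facc C q h T _ (proj1 HC)).
  - apply code_at_app in HC. destruct HC as [H1 H2]. rewrite asm_length in H2.
    rewrite Nat.add_assoc. eapply runs_trans; eauto.
  - specialize (Hend ltac:(discriminate)).
    apply code_at_cons in HC. destruct HC as [H1 H2]. apply code_at_app in H2.
    rewrite asm_length in H2. destruct H2 as [H2 H3]. apply code_at_cons in H3.
    pose proof (runs_instr facc C q h T _ H1) as R1. cbn [instr_step] in R1. rewrite H in R1.
    pose proof (runs_instr facc C _ h' T' _ (proj1 H3)) as R3. cbn [instr_step] in R3.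
    rewrite Nat.min_l in R3 by lia. rewrite Nat.add_1_r in H2.
    exact (runs_trans (runs_keep R1)
      (runs_trans (IHexec _ H2) (runs_keep R3))).
  - specialize (Hend ltac:(discriminate)).
    apply code_at_cons in HC. destruct HC as [H1 H2]. apply code_at_app in H2.
    rewrite asm_length in H2. destruct H2 as [_ H2]. apply code_at_cons in H2. destruct H2 as [_ H2].
    pose proof (runs_instr facc C q h T _ H1) as R1. cbn [instr_step] in R1. rewrite H in R1.
    rewrite Nat.min_l in R1 by lia.
    replace (S (S q + psize a)) with (q + 1 + psize a + 1) in H2 by lia.
    replace (q + (1 + (psize a + (1 + psize b)))) with (q + 1 + psize a + 1 + psize b) by lia.
    exact (runs_trans (runs_keep R1) (IHexec _ H2)).
  - specialize (Hend ltac:(discriminate)).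
    apply code_at_cons in HC. destruct HC as [H1 _].
    pose proof (runs_instr facc C q h T _ H1) as R1. cbn [instr_step] in R1. rewrite H in R1.
    rewrite Nat.min_l in R1 by lia. exact (runs_keep R1).
  - specialize (Hend ltac:(discriminate)). pose proof (IHexec2 q HC) as R4.
    apply code_at_cons in HC. destruct HC as [H2 H3]. apply code_at_app in H3.
    rewrite asm_length in H3. destruct H3 as [H3 H4]. apply code_at_cons in H4.
    pose proof (runs_instr facc C q h T _ H2) as R1. cbn [instr_step] in R1. rewrite H in R1.
    pose proof (runs_instr facc C _ h1 T1 _ (proj1 H4)) as R3. cbn [instr_step] in R3.
    rewrite Nat.min_l in R3 by lia. rewrite Nat.add_1_r in H3.
    exact (runs_trans (runs_keep R1)
      (runs_trans (IHexec1 _ H3)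
        (runs_trans (runs_keep R3) R4))).
Qed.

Lemma tm_run_halted M q l r n :
  q = qacc M \/ q = qrej M -> tm_run M n (q, l, r) = (q, l, r).
Proof.
  intros H. induction n; [reflexivity|].
  change (tm_run M (S n) (q, l, r)) with (tm_step M (tm_run M n (q, l, r))).
  rewrite IHn. unfold tm_step.
  destruct H as [-> | ->]; rewrite Nat.eqb_refl, ?orb_true_r; reflexivity.
Qed.

Definition word_tape (w : list bool) : tape := fun i => nth i (map Some w) None.

(** The strict time bound pays for the final test at the address past the code; the steps left over
    after it are idle because the state is halting. *)
Theorem exec_decides facc P (L : list bool -> Prop) c k :
  (forall w, exists t h T, exec P 0 (word_tape w) t h T /\ t < poly c k (length w) /\
     (facc (T h) = true <-> L w)) ->
  in_P L.
Proof.
  intros H. exists (machine facc (asm 0 P)), c, k. intros w q.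
  destruct (H w) as (t & h & T & E & Ht & Hacc).
  destruct (exec_sound facc (asm 0 P) _ _ _ _ _ _ E 0 (fun _ _ Hi => Hi) [] (map Some w))
    as (l & r & Er & R).
  { split; [reflexivity|]. intros i. reflexivity. }
  assert (Eq : q = if facc (T h) then S (psize P) else S (S (psize P))).
  { unfold q. replace (poly c k (length w)) with (t + (1 + (poly c k (length w) - t - 1))) by lia.
    rewrite tm_run_add.
    change (tm_run (machine facc (asm 0 P)) t (tm_init w) = (psize P, l, r)) in Er.
    rewrite Er, tm_run_add.
    change (tm_run ?M 1 ?c) with (tm_step M c).
    rewrite tm_step_machine by (rewrite asm_length; lia). unfold machine_delta.
    replace (nth_error (asm 0 P) (psize P)) with (@None instr)
      by (symmetry; apply nth_error_None; rewrite asm_length; lia).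
    rewrite asm_length, (represents_head _ _ _ _ R).
    destruct (facc (T h)); rewrite tm_run_halted;
      cbn [machine qacc qrej]; rewrite ?asm_length; auto. }
  clearbody q. subst q. cbn [machine qacc qrej]. rewrite asm_length.
  destruct (facc (T h)); split; auto; rewrite <- Hacc.
  - split; auto.
  - split; [lia|discriminate].
Qed.

(** * Unary registers on a tape *)

(** Total correctness with a time budget: termination, the bound [B] and the postcondition travel
    together, so a proof about a program splits its budget along the program. *)
Definition reach (P : prog) (h : nat) (T : tape) (B : nat) (Q : nat -> tape -> Prop) : Prop :=
  exists t h' T', exec P h T t h' T' /\ t <= B /\ Q h' T'.

Lemma reach_weaken {P h T B B'} {Q Q' : nat -> tape -> Prop} :
  reach P h T B Q -> B <= B' -> (forall h' T', Q h' T' -> Q' h' T') -> reach P h T B' Q'.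
Proof.
  intros (t & h' & T' & E & Ht & HQ) HB HI. exists t, h', T'. repeat split; auto; lia.
Qed.

Lemma reach_seq a b h T B B1 B2 (Q : nat -> tape -> Prop) :
  reach a h T B1 (fun h1 T1 => reach b h1 T1 B2 Q) -> B1 + B2 <= B ->
  reach (PSeq a b) h T B Q.
Proof.
  intros (t1 & h1 & T1 & E1 & Ht1 & (t2 & h2 & T2 & E2 & Ht2 & HQ)) HB.
  exists (t1 + t2), h2, T2. repeat split; auto; [|lia]. econstructor; eauto.
Qed.

Ltac rseq a b := apply (reach_seq _ _ _ _ _ a b); [|lia].

Lemma reach_write s h T B (Q : nat -> tape -> Prop) :
  Q h (upd T h s) -> 1 <= B -> reach (PWrite s) h T B Q.
Proof. intros HQ HB. eexists _, _, _. split; [constructor|]. now split. Qed.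

Lemma reach_left h T B (Q : nat -> tape -> Prop) :
  Q (pred h) T -> 1 <= B -> reach PLeft h T B Q.
Proof. intros HQ HB. eexists _, _, _. split; [constructor|]. now split. Qed.

Lemma reach_right h T B (Q : nat -> tape -> Prop) :
  Q (S h) T -> 1 <= B -> reach PRight h T B Q.
Proof. intros HQ HB. eexists _, _, _. split; [constructor|]. now split. Qed.

Lemma reach_if p a b h T B B1 (Q : nat -> tape -> Prop) :
  (p (T h) = true -> reach a h T B1 Q) -> (p (T h) = false -> reach b h T B1 Q) ->
  B1 + 2 <= B -> reach (PIf p a b) h T B Q.
Proof.
  intros Ha Hb HB. destruct (p (T h)) eqn:E.
  - destruct (Ha eq_refl) as (t & h' & T' & Ex & Ht & HQ).
    exists (1 + (t + 1)), h', T'. repeat split; auto; [now constructor|lia].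
  - destruct (Hb eq_refl) as (t & h' & T' & Ex & Ht & HQ).
    exists (1 + t), h', T'. repeat split; auto; [now constructor|lia].
Qed.

(** The invariant is indexed by the number of rounds left, which yields the running time at once.
    The extra 2 per round is the branch and the jump back, the final 1 the failing branch. *)
Lemma reach_while p a Bb (Inv : nat -> nat -> tape -> Prop) :
  (forall k h T, Inv (S k) h T -> p (T h) = true /\ reach a h T Bb (Inv k)) ->
  (forall h T, Inv 0 h T -> p (T h) = false) ->
  forall k h T B (Q : nat -> tape -> Prop), Inv k h T -> k * (Bb + 2) + 1 <= B ->
  (forall h' T', Inv 0 h' T' -> Q h' T') ->
  reach (PWhile p a) h T B Q.
Proof.
  intros Hs H0. induction k; intros h T B Q HI HB HQ.
  - exists 1, h, T. split; [constructor; auto|]. split; [lia|auto].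
  - destruct (Hs _ _ _ HI) as [Hp (t1 & h1 & T1 & E1 & Ht1 & HI1)].
    destruct (IHk h1 T1 (k * (Bb + 2) + 1) Q HI1 (le_n _) HQ)
      as (t2 & h2 & T2 & E2 & Ht2 & HQ2).
    exists (1 + (t1 + (1 + t2))), h2, T2. repeat split; auto; [|nia].
    econstructor; eauto.
Qed.

Fixpoint prepeat (k : nat) (P : prog) : prog :=
  match k with 0 => PSkip | S k => PSeq P (prepeat k P) end.

Lemma reach_rights k h T B (Q : nat -> tape -> Prop) :
  Q (h + k) T -> k <= B -> reach (prepeat k PRight) h T B Q.
Proof.
  revert h B. induction k; intros h B HQ HB; cbn.
  - exists 0, h, T. rewrite Nat.add_0_r in HQ. split; [constructor|]. split; [lia|auto].
  - rseq 1 k. apply reach_right; [|lia].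
    apply IHk; [|lia]. now replace (S h + k) with (h + S k) by lia.
Qed.

Lemma reach_lefts k h T B (Q : nat -> tape -> Prop) :
  Q (h - k) T -> k <= B -> reach (prepeat k PLeft) h T B Q.
Proof.
  revert h B. induction k; intros h B HQ HB; cbn.
  - exists 0, h, T. rewrite Nat.sub_0_r in HQ. split; [constructor|]. split; [lia|auto].
  - rseq 1 k. apply reach_left; [|lia].
    apply IHk; [|lia]. now replace (pred h - k) with (h - S k) by lia.
Qed.

Definition nonblank (s : symbol) : bool := match s with None => false | _ => true end.
Definition unmarked (s : symbol) : bool := match s with Some true => false | _ => true end.
Definition marked (s : symbol) : bool := negb (unmarked s).

Lemma reach_scan_left h T g B (Q : nat -> tape -> Prop) :
  g <= h -> T g = None -> (forall j, g < j <= h -> nonblank (T j) = true) ->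
  Q g T -> 3 * (h - g) + 1 <= B ->
  reach (PWhile nonblank PLeft) h T B Q.
Proof.
  intros Hgh Hg Hnb HQ HB.
  apply (reach_while nonblank PLeft 1 (fun k h' T' => T' = T /\ h' = g + k /\ h' <= h))
    with (k := h - g); [| |repeat split; lia|lia|].
  - intros k h' T' (-> & -> & Hh'). split; [apply Hnb; lia|].
    apply reach_left; [|lia]. repeat split; lia.
  - intros h' T' (-> & -> & _). now rewrite Nat.add_0_r, Hg.
  - intros h' T' (-> & -> & _). now rewrite Nat.add_0_r.
Qed.

Lemma reach_scan_right h T g B (Q : nat -> tape -> Prop) :
  h <= g -> T g = None -> (forall j, h <= j < g -> nonblank (T j) = true) ->
  Q g T -> 3 * (g - h) + 1 <= B ->
  reach (PWhile nonblank PRight) h T B Q.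
Proof.
  intros Hgh Hg Hnb HQ HB.
  apply (reach_while nonblank PRight 1 (fun k h' T' => T' = T /\ h' + k = g /\ h <= h'))
    with (k := g - h); [| |repeat split; lia|lia|].
  - intros k h' T' (-> & E & Hh'). split; [apply Hnb; lia|].
    apply reach_right; [|lia]. repeat split; lia.
  - intros h' T' (-> & E & _). replace h' with g by lia. now rewrite Hg.
  - intros h' T' (-> & E & _). replace h' with g by lia. exact HQ.
Qed.

Section Blocks.

Variables (K : nat) (w : list bool).
Let n := length w.

(** Cells [0] to [n - 1] belong to the input and cell [n] is the left border blank, so the blocks
    start at [S n]. *)
Definition addr (i t : nat) : nat := S n + i * S K + t.
Definition zone : nat := S n * S K.

(* The register file on the tape: [n + 1] blocks of [K + 1] cells each, between
   two blanks. Block [i] holds the [i]-th input bit followed by one mark cell per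
   register; register [r] has value [v] when its mark is set in block [v] only. *)
Definition marks_inv (m : nat -> nat -> bool) (T : tape) : Prop :=
  T n = None /\
  (forall i, i <= n -> T (addr i 0) = Some (nth i w false)) /\
  (forall i r, i <= n -> r < K -> T (addr i (S r)) = Some (m r i)) /\
  (forall j, addr (S n) 0 <= j -> T j = None).

Definition regs_inv (env : nat -> nat) (T : tape) : Prop :=
  marks_inv (fun r i => env r =? i) T /\ forall r, r < K -> env r <= n.

(** The state in the middle of an assignment: [r0] has lost its mark, all other registers keep
    theirs. *)
Definition erased (r0 : nat) (env : nat -> nat) (T : tape) : Prop :=
  marks_inv (fun r i => if r =? r0 then false else env r =? i) T /\
  forall r, r < K -> env r <= n.

Lemma addr_inj i t i' t' :
  t < S K -> t' < S K -> addr i t = addr i' t' -> i = i' /\ t = t'.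
Proof. unfold addr. intros. assert (i = i') by nia. subst. lia. Qed.

Lemma addr_cases j : S n <= j -> exists i t, t < S K /\ j = addr i t.
Proof.
  intros Hj. exists ((j - S n) / S K), ((j - S n) mod S K).
  split; [apply Nat.mod_upper_bound; lia|]. unfold addr.
  pose proof (Nat.div_mod (j - S n) (S K) ltac:(lia)). lia.
Qed.

Lemma addr_zone i t : i <= n -> t < S K -> S n <= addr i t < S n + zone.
Proof. unfold addr, zone. intros. nia. Qed.

Lemma addr_end : addr (S n) 0 = S n + zone.
Proof. unfold addr, zone. lia. Qed.

Lemma marks_inv_nonblank m T j :
  marks_inv m T -> S n <= j < S n + zone -> nonblank (T j) = true.
Proof.
  intros (_ & Hb & Hm & _) [H1 H2]. destruct (addr_cases j H1) as (i & t & Ht & ->).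
  assert (i <= n) by (unfold addr, zone in H2; nia).
  destruct t; [now rewrite Hb|]. now rewrite Hm by lia.
Qed.

Lemma marks_inv_set m T r v b :
  v <= n -> r < K -> marks_inv m T ->
  marks_inv (fun r' i => if (r' =? r) && (i =? v) then b else m r' i)
    (upd T (addr v (S r)) (Some b)).
Proof.
  intros Hv Hr (H1 & H2 & H3 & H4).
  pose proof (addr_zone v (S r) Hv ltac:(lia)) as Hz. split; [|split; [|split]].
  - rewrite upd_other by lia. exact H1.
  - intros i Hi. rewrite upd_other; [auto|]. intros E. apply addr_inj in E; lia.
  - intros i r' Hi Hr'. destruct (Nat.eqb_spec r' r), (Nat.eqb_spec i v); cbn [andb]; subst.
    + apply upd_same.
    + rewrite upd_other; [auto|]. intros E. apply addr_inj in E; lia.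
    + rewrite upd_other; [auto|]. intros E. apply addr_inj in E; lia.
    + rewrite upd_other; [auto|]. intros E. apply addr_inj in E; lia.
  - intros j Hj. rewrite addr_end in Hj. rewrite upd_other by lia. apply H4.
    rewrite addr_end. exact Hj.
Qed.

Lemma marks_inv_ext m m' T :
  (forall r i, r < K -> i <= n -> m r i = m' r i) -> marks_inv m T -> marks_inv m' T.
Proof.
  intros E (H1 & H2 & H3 & H4). split; [|split; [|split]]; auto.
  intros i r Hi Hr. rewrite H3, E; auto.
Qed.

Lemma erase_inv env T r :
  r < K -> regs_inv env T -> erased r env (upd T (addr (env r) (S r)) (Some false)).
Proof.
  intros Hr [Hi Hb]. split; [|exact Hb].
  eapply marks_inv_ext; [|apply (marks_inv_set _ _ r (env r) false (Hb _ Hr) Hr Hi)].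
  intros r' i _ _. cbn. destruct (Nat.eqb_spec r' r) as [->|]; cbn; [|reflexivity].
  destruct (Nat.eqb_spec i (env r)); [reflexivity|]. apply Nat.eqb_neq. lia.
Qed.

Lemma put_inv env T r v :
  r < K -> v <= n -> erased r env T ->
  regs_inv (upd env r v) (upd T (addr v (S r)) (Some true)).
Proof.
  intros Hr Hv [Hi Hb]. split.
  - eapply marks_inv_ext; [|apply (marks_inv_set _ _ r v true Hv Hr Hi)].
    intros r' i _ _. cbn. unfold upd. destruct (Nat.eqb_spec r' r) as [->|]; cbn; [|reflexivity].
    rewrite Nat.eqb_sym. now destruct (v =? i).
  - intros r' Hr'. unfold upd. destruct (r' =? r); auto.
Qed.

Lemma zone_bounds : S n <= zone /\ S K <= zone /\ n * S K + S K = zone.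
Proof. unfold zone. nia. Qed.

(** Inside the register file no cell is blank, so the nearest blank to the left is cell [n], and the
    first block starts right after it. *)
Definition home : prog := PSeq (PWhile nonblank PLeft) PRight.
Definition seek (r : nat) : prog :=
  PSeq (prepeat (S r) PRight) (PWhile unmarked (prepeat (S K) PRight)).
Definition switch_track (t t' : nat) : prog :=
  PSeq (prepeat t PLeft) (prepeat t' PRight).

Lemma reach_home m T h B (Q : nat -> tape -> Prop) :
  marks_inv m T -> n <= h < S n + zone -> Q (S n) T -> 3 * zone + 5 <= B ->
  reach home h T B Q.
Proof.
  intros Hi Hh HQ HB. rseq (3 * zone + 4) 1.
  apply (reach_scan_left _ _ n).
  - lia.
  - exact (proj1 Hi).
  - intros j Hj. apply (marks_inv_nonblank m); [exact Hi|lia].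
  - apply reach_right; [exact HQ|lia].
  - lia.
Qed.

Lemma reach_find m T r v B (Q : nat -> tape -> Prop) :
  marks_inv m T -> r < K -> v <= n -> m r v = true -> (forall i, i < v -> m r i = false) ->
  Q (addr v (S r)) T -> 6 * zone <= B ->
  reach (seek r) (S n) T B Q.
Proof.
  intros Hi Hr Hv Hm Hlt HQ HB. destruct zone_bounds as (Z1 & Z2 & Z3).
  apply (reach_seq _ _ _ _ _ (S r) (n * (S K + 2) + 1)); [|nia].
  apply reach_rights; [|lia].
  apply (reach_while unmarked (prepeat (S K) PRight) (S K)
           (fun k h' T' => T' = T /\ exists i, i + k = v /\ h' = addr i (S r)))
    with (k := v).
  - intros k h' T' (-> & i & Ei & ->). destruct Hi as (H1 & H2 & H3 & H4).
    split; [rewrite H3, Hlt by lia; reflexivity|].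
    apply reach_rights; [|lia]. split; [reflexivity|]. exists (S i).
    split; [lia|unfold addr; nia].
  - intros h' T' (-> & i & Ei & ->). destruct Hi as (H1 & H2 & H3 & H4).
    replace i with v by lia. rewrite H3, Hm by lia. reflexivity.
  - split; [reflexivity|]. exists 0. split; [lia|unfold addr; lia].
  - nia.
  - intros h' T' (-> & i & Ei & ->). replace i with v by lia. exact HQ.
Qed.

Lemma reach_switch i t t' T B (Q : nat -> tape -> Prop) :
  Q (addr i t') T -> t + t' <= B -> reach (switch_track t t') (addr i t) T B Q.
Proof.
  intros HQ HB. rseq t t'.
  apply reach_lefts; [|lia]. apply reach_rights; [|lia].
  replace (addr i t - t + t') with (addr i t') by (unfold addr; lia). exact HQ.
Qed.

Lemma reach_find_reg env T r B (Q : nat -> tape -> Prop) :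
  regs_inv env T -> r < K -> Q (addr (env r) (S r)) T -> 6 * zone <= B ->
  reach (seek r) (S n) T B Q.
Proof.
  intros [Hi Hb] Hr HQ HB. apply (reach_find _ _ r (env r) _ _ Hi); auto.
  - apply Nat.eqb_refl.
  - intros i Hlt. apply Nat.eqb_neq. lia.
Qed.

Lemma reach_find_erased env T r r0 B (Q : nat -> tape -> Prop) :
  erased r0 env T -> r <> r0 -> r < K -> Q (addr (env r) (S r)) T -> 6 * zone <= B ->
  reach (seek r) (S n) T B Q.
Proof.
  intros [Hi Hb] Hne Hr HQ HB. apply Nat.eqb_neq in Hne.
  apply (reach_find _ _ r (env r) _ _ Hi); auto.
  - now rewrite Hne, Nat.eqb_refl.
  - intros i Hlt. rewrite Hne. apply Nat.eqb_neq. lia.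
Qed.

(** Every register program starts and ends at the first cell of block 0, so programs compose without
    tracking head positions. A relation [R], rather than a function, leaves the contents of scratch
    registers open. *)
Definition computes (P : prog) (B : nat) (R : (nat -> nat) -> (nat -> nat) -> Prop) : Prop :=
  forall env T, regs_inv env T ->
    reach P (S n) T B (fun h' T' => h' = S n /\ exists env', R env env' /\ regs_inv env' T').

Lemma computes_seq P1 P2 B1 B2 (R1 R2 R : (nat -> nat) -> (nat -> nat) -> Prop) :
  computes P1 B1 R1 -> computes P2 B2 R2 ->
  (forall e e' e'', R1 e e' -> R2 e' e'' -> R e e'') ->
  computes (PSeq P1 P2) (B1 + B2) R.
Proof.
  intros H1 H2 HR env T Hi. rseq B1 B2.
  apply (reach_weaken (H1 _ _ Hi)); [lia|].
  intros h T1 (-> & env1 & HR1 & Hi1).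
  apply (reach_weaken (H2 _ _ Hi1)); [lia|].
  intros h' T2 (-> & env2 & HR2 & Hi2). eauto.
Qed.

(** * Assignments, tests and loops on marked registers *)

Definition erase (r : nat) : prog :=
  PSeq (seek r) (PSeq (PWrite (Some false)) home).

Lemma reach_erase env T r B (Q : nat -> tape -> Prop) :
  regs_inv env T -> r < K -> (forall T', erased r env T' -> Q (S n) T') ->
  15 * zone <= B -> reach (erase r) (S n) T B Q.
Proof.
  intros Hi Hr HQ HB. destruct zone_bounds as (Z1 & Z2 & Z3).
  pose proof (addr_zone (env r) (S r) (proj2 Hi _ Hr) ltac:(lia)).
  rseq (6 * zone) (9 * zone).
  apply (reach_find_reg _ _ _ _ _ Hi Hr); [|lia].
  rseq 1 (8 * zone).
  apply reach_write; [|lia].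
  pose proof (erase_inv _ _ _ Hr Hi) as He.
  apply (reach_home _ _ _ _ _ (proj1 He)); [lia| |lia]. auto.
Qed.

Lemma reach_put env T r v B (Q : nat -> tape -> Prop) :
  erased r env T -> r < K -> v <= n ->
  (forall T', regs_inv (upd env r v) T' -> Q (S n) T') -> 9 * zone <= B ->
  reach (PSeq (PWrite (Some true)) home) (addr v (S r)) T B Q.
Proof.
  intros He Hr Hv HQ HB. destruct zone_bounds as (Z1 & Z2 & Z3).
  pose proof (addr_zone v (S r) Hv ltac:(lia)).
  rseq 1 (8 * zone). apply reach_write; [|lia].
  pose proof (put_inv _ _ _ _ Hr Hv He) as Hp.
  apply (reach_home _ _ _ _ _ (proj1 Hp)); [lia| |lia]. auto.
Qed.

Definition put_true : prog := PSeq (PWrite (Some true)) home.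

Definition zero_reg (r : nat) : prog :=
  PSeq (erase r) (PSeq (prepeat (S r) PRight) put_true).
Definition copy_reg (r u : nat) : prog :=
  PSeq (erase r) (PSeq (seek u) (PSeq (switch_track (S u) (S r)) put_true)).
(** The first blank to the right lies just past block [n]; one block back is where the mark for the
    value [n] belongs. *)
Definition len_reg (r : nat) : prog :=
  PSeq (erase r) (PSeq (PWhile nonblank PRight)
    (PSeq (prepeat (S K) PLeft) (PSeq (prepeat (S r) PRight) put_true))).
(** The cap at [n] comes from the tape: if the cell one block further is blank, the mark was in the
    last block and is put back there. *)
Definition inc_reg (r : nat) : prog :=
  PSeq (seek r) (PSeq (PWrite (Some false)) (PSeq (prepeat (S K) PRight)
    (PSeq (PIf nonblank PSkip (prepeat (S K) PLeft)) put_true))).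

Definition prim_bound : nat := 40 * zone.

Lemma computes_zero r :
  r < K -> computes (zero_reg r) prim_bound (fun env env' => env' = upd env r 0).
Proof.
  intros Hr env T Hi. destruct zone_bounds as (Z1 & Z2 & Z3). unfold prim_bound.
  rseq (15 * zone) (20 * zone).
  apply (reach_erase _ _ _ _ _ Hi Hr); [|lia]. intros T1 He.
  rseq (S r) (10 * zone).
  apply reach_rights; [|lia].
  replace (S n + S r) with (addr 0 (S r)) by (unfold addr; lia).
  apply (reach_put _ _ _ _ _ _ He Hr); [lia| |lia]. eauto.
Qed.

Lemma computes_copy r u :
  r < K -> u < K -> u <> r ->
  computes (copy_reg r u) prim_bound (fun env env' => env' = upd env r (env u)).
Proof.
  intros Hr Hu Hne env T Hi. destruct zone_bounds as (Z1 & Z2 & Z3). unfold prim_bound.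
  rseq (15 * zone) (20 * zone).
  apply (reach_erase _ _ _ _ _ Hi Hr); [|lia]. intros T1 He.
  rseq (6 * zone) (14 * zone).
  apply (reach_find_erased _ _ _ _ _ _ He Hne Hu); [|lia].
  rseq (S u + S r) (10 * zone).
  apply reach_switch; [|lia].
  apply (reach_put _ _ _ _ _ _ He Hr); [apply Hi, Hu| |lia]. eauto.
Qed.

Lemma computes_len r :
  r < K -> computes (len_reg r) prim_bound (fun env env' => env' = upd env r n).
Proof.
  intros Hr env T Hi. destruct zone_bounds as (Z1 & Z2 & Z3). unfold prim_bound.
  rseq (15 * zone) (20 * zone).
  apply (reach_erase _ _ _ _ _ Hi Hr); [|lia]. intros T1 He.
  rseq (4 * zone) (14 * zone).
  apply (reach_scan_right _ _ (S n + zone)).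
  - lia.
  - apply (proj2 (proj2 (proj2 (proj1 He)))). rewrite addr_end. lia.
  - intros j Hj. apply (marks_inv_nonblank _ _ _ (proj1 He)). lia.
  - rseq (S K) (11 * zone).
    apply reach_lefts; [|lia].
    rseq (S r) (10 * zone).
    apply reach_rights; [|lia].
    replace (S n + zone - S K + S r) with (addr n (S r)) by (unfold addr; lia).
    apply (reach_put _ _ _ _ _ _ He Hr); [lia| |lia]. eauto.
  - lia.
Qed.

Lemma computes_inc r :
  r < K -> computes (inc_reg r) prim_bound (fun env env' => env' = upd env r (Nat.min n (S (env r)))).
Proof.
  intros Hr env T Hi. destruct zone_bounds as (Z1 & Z2 & Z3). unfold prim_bound.
  pose proof (proj2 Hi _ Hr) as Hv.
  rseq (6 * zone) (30 * zone).
  apply (reach_find_reg _ _ _ _ _ Hi Hr); [|lia].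
  rseq 1 (29 * zone). apply reach_write; [|lia].
  pose proof (erase_inv _ _ _ Hr Hi) as He.
  set (T1 := upd _ _ _) in *. clearbody T1.
  rseq (S K) (28 * zone). apply reach_rights; [|lia].
  replace (addr (env r) (S r) + S K) with (addr (S (env r)) (S r)) by (unfold addr; lia).
  rseq (S K + 2) (20 * zone).
  destruct (le_lt_dec n (env r)) as [Hge|Hlt].
  - apply (reach_if _ _ _ _ _ _ (S K)); [| |lia].
    + intros Hnb. exfalso.
      rewrite (proj2 (proj2 (proj2 (proj1 He)))) in Hnb; [discriminate|unfold addr; nia].
    + intros _. apply reach_lefts; [|lia].
      replace (addr (S (env r)) (S r) - S K) with (addr (env r) (S r)) by (unfold addr; lia).
      replace (Nat.min n (S (env r))) with (env r) by lia.
      apply (reach_put _ _ _ _ _ _ He Hr); [lia| |lia]. eauto.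
  - apply (reach_if _ _ _ _ _ _ (S K)); [| |lia].
    + intros _. eexists 0, _, _. split; [constructor|]. split; [lia|].
      replace (Nat.min n (S (env r))) with (S (env r)) by lia.
      apply (reach_put _ _ _ _ _ _ He Hr); [lia| |lia]. eauto.
    + intros Hb. exfalso.
      rewrite (marks_inv_nonblank _ _ _ (proj1 He)) in Hb; [discriminate|].
      apply addr_zone; lia.
Qed.

(** The head moves to the mark of [r] and then to the cell of [u] in the same block; that cell is
    marked exactly when both registers have the same value. *)
Definition test_eq (r u : nat) : prog := PSeq (seek r) (switch_track (S r) (S u)).

Lemma reach_test_eq env T r u B (Q : nat -> tape -> Prop) :
  regs_inv env T -> r < K -> u < K ->
  (T (addr (env r) (S u)) = Some (env u =? env r) -> Q (addr (env r) (S u)) T) ->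
  8 * zone <= B -> reach (test_eq r u) (S n) T B Q.
Proof.
  intros Hi Hr Hu HQ HB. destruct zone_bounds as (Z1 & Z2 & Z3).
  rseq (6 * zone) (2 * zone).
  apply (reach_find_reg _ _ _ _ _ Hi Hr); [|lia].
  apply reach_switch; [|lia]. apply HQ.
  destruct Hi as [(_ & _ & H3 & _) Hb]. apply H3; auto.
Qed.

Definition if_eq (r u : nat) (P1 P2 : prog) : prog :=
  PSeq (test_eq r u) (PIf marked (PSeq home P1) (PSeq home P2)).

Lemma computes_if_eq r u P1 P2 B f1 f2 :
  r < K -> u < K -> computes P1 B f1 -> computes P2 B f2 ->
  computes (if_eq r u P1 P2) (B + prim_bound)
    (fun env env' => if env r =? env u then f1 env env' else f2 env env').
Proof.
  intros Hr Hu H1 H2 env T Hi. destruct zone_bounds as (Z1 & Z2 & Z3). unfold prim_bound.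
  pose proof (addr_zone (env r) (S u) (proj2 Hi _ Hr) ltac:(lia)).
  rseq (8 * zone) (B + 20 * zone).
  apply (reach_test_eq _ _ _ _ _ _ Hi Hr Hu); [|lia]. intros E.
  rewrite Nat.eqb_sym in E.
  apply (reach_if _ _ _ _ _ _ (B + 10 * zone)); [| |lia]; rewrite E; intros Ht;
    apply (reach_seq _ _ _ _ _ (10 * zone) B); try lia;
    apply (reach_home _ _ _ _ _ (proj1 Hi)); try lia;
    destruct (env r =? env u); try discriminate; auto.
Qed.

Definition if_bit (r : nat) (P1 P2 : prog) : prog :=
  PSeq (PSeq (seek r) (switch_track (S r) 0)) (PIf marked (PSeq home P1) (PSeq home P2)).

Lemma computes_if_bit r P1 P2 B f1 f2 :
  r < K -> computes P1 B f1 -> computes P2 B f2 ->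
  computes (if_bit r P1 P2) (B + prim_bound)
    (fun env env' => if nth (env r) w false then f1 env env' else f2 env env').
Proof.
  intros Hr H1 H2 env T Hi. destruct zone_bounds as (Z1 & Z2 & Z3). unfold prim_bound.
  pose proof (addr_zone (env r) 0 (proj2 Hi _ Hr) ltac:(lia)).
  rseq (8 * zone) (B + 20 * zone).
  rseq (6 * zone) (2 * zone).
  apply (reach_find_reg _ _ _ _ _ Hi Hr); [|lia].
  apply reach_switch; [|lia].
  assert (E : T (addr (env r) 0) = Some (nth (env r) w false)).
  { destruct Hi as [(_ & H3 & _) Hb]. apply H3. auto. }
  apply (reach_if _ _ _ _ _ _ (B + 10 * zone)); [| |lia]; rewrite E; intros Ht;
    apply (reach_seq _ _ _ _ _ (10 * zone) B); try lia;
    apply (reach_home _ _ _ _ _ (proj1 Hi)); try lia;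
    destruct (nth (env r) w false); try discriminate; auto.
Qed.

Definition while_neq (r u : nat) (P : prog) : prog :=
  PSeq (test_eq r u) (PSeq (PWhile unmarked (PSeq home (PSeq P (test_eq r u)))) home).

(** At most [n] rounds are allowed for, since loops count up to a register value; the spare unit of
    the factor [S n] pays for the first test and the final return. *)
Lemma reach_while_neq r u P B (I : nat -> (nat -> nat) -> Prop) :
  r < K -> u < K ->
  (forall k env T, I (S k) env -> regs_inv env T -> env u <> env r /\
     reach P (S n) T B (fun h' T' => h' = S n /\ exists env', I k env' /\ regs_inv env' T')) ->
  (forall env, I 0 env -> env u = env r) ->
  forall k env T (Q : nat -> tape -> Prop), k <= n -> I k env -> regs_inv env T ->
  (forall env' T', I 0 env' -> regs_inv env' T' -> Q (S n) T') ->
  reach (while_neq r u P) (S n) T (S n * (B + prim_bound)) Q.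
Proof.
  intros Hr Hu Hs H0 k env T Q Hk HI Hi HQ.
  destruct zone_bounds as (Z1 & Z2 & Z3). unfold prim_bound.
  apply (reach_seq _ _ _ _ _ (8 * zone) (n * (B + 40 * zone) + 20 * zone)); [|nia].
  apply (reach_test_eq _ _ _ _ _ _ Hi Hr Hu); [|lia]. intros E.
  rseq (n * (B + 40 * zone) + 1) (10 * zone).
  apply (reach_while unmarked _ (B + 20 * zone)
    (fun k h' T' => exists env', I k env' /\ regs_inv env' T' /\ h' = addr (env' r) (S u) /\
       T' h' = Some (env' u =? env' r))) with (k := k).
  - intros k' h' T' (env' & HI' & Hi' & -> & E'). rewrite E'.
    destruct (Hs _ _ _ HI' Hi') as [Hne HP]. apply Nat.eqb_neq in Hne. rewrite Hne.
    split; [reflexivity|].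
    pose proof (addr_zone (env' r) (S u) (proj2 Hi' _ Hr) ltac:(lia)).
    rseq (10 * zone) (B + 10 * zone).
    apply (reach_home _ _ _ _ _ (proj1 Hi')); [lia| |lia].
    rseq B (10 * zone).
    apply (reach_weaken HP); [lia|].
    intros h1 T1 (-> & env1 & HI1 & Hi1).
    apply (reach_test_eq _ _ _ _ _ _ Hi1 Hr Hu); [|lia]. intros E1.
    exists env1. auto.
  - intros h' T' (env' & HI' & Hi' & -> & E'). rewrite E', (H0 _ HI'), Nat.eqb_refl.
    reflexivity.
  - exists env. auto.
  - nia.
  - intros h' T' (env' & HI' & Hi' & -> & E').
    pose proof (addr_zone (env' r) (S u) (proj2 Hi' _ Hr) ltac:(lia)).
    apply (reach_home _ _ _ _ _ (proj1 Hi')); [lia| |lia]. eauto.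
Qed.

End Blocks.

(** * Expressions over registers *)

(** The base [S n] makes every power at least 1, also at [n = 0], so that bounds can be added and
    multiplied without case distinctions. *)
Definition pbounded (f : nat -> nat) : Prop := exists c k, forall n, f n <= c * S n ^ k.

Lemma pbounded_const c : pbounded (fun _ => c).
Proof. exists c, 0. intros n. cbn. lia. Qed.

Lemma pow_S_pos n k : 1 <= S n ^ k.
Proof. induction k; cbn; lia. Qed.

Lemma pbounded_S : pbounded S.
Proof. exists 1, 1. intros n. cbn. lia. Qed.

Lemma pbounded_add f g : pbounded f -> pbounded g -> pbounded (fun n => f n + g n).
Proof.
  intros (c1 & k1 & H1) (c2 & k2 & H2). exists (c1 + c2), (k1 + k2). intros n.
  rewrite Nat.pow_add_r. specialize (H1 n). specialize (H2 n).
  pose proof (pow_S_pos n k1). pose proof (pow_S_pos n k2).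
  set (a := S n ^ k1) in *. set (b := S n ^ k2) in *. clearbody a b.
  assert (c1 * a <= c1 * (a * b)) by (apply Nat.mul_le_mono_l; nia).
  assert (c2 * b <= c2 * (a * b)) by (apply Nat.mul_le_mono_l; nia). lia.
Qed.

Lemma pbounded_mul f g : pbounded f -> pbounded g -> pbounded (fun n => f n * g n).
Proof.
  intros (c1 & k1 & H1) (c2 & k2 & H2). exists (c1 * c2), (k1 + k2). intros n.
  rewrite Nat.pow_add_r. specialize (H1 n). specialize (H2 n).
  transitivity (c1 * S n ^ k1 * (c2 * S n ^ k2)); [now apply Nat.mul_le_mono|nia].
Qed.

(** [S n] is at most [2 * n] for positive [n], and the additive constant of [poly] covers [n = 0].
    Strictness, needed for the final test of the machine, comes from passing from [c] to [S c]. *)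
Lemma pbounded_poly f : pbounded f -> exists c k, forall n, f n < poly c k n.
Proof.
  intros (c & k & H). exists (S c * 2 ^ k), k. intros n. unfold poly.
  assert (Hp : S n ^ k <= 2 ^ k * n ^ k + 2 ^ k).
  { destruct n; [rewrite Nat.pow_1_l; pose proof (Nat.pow_nonzero 2 k); lia|].
    rewrite <- Nat.pow_mul_l. transitivity ((2 * S n) ^ k); [|lia].
    apply Nat.pow_le_mono_l. lia. }
  specialize (H n). pose proof (pow_S_pos n k).
  apply Nat.lt_le_trans with (S c * S n ^ k); [nia|].
  transitivity (S c * (2 ^ k * n ^ k + 2 ^ k)); [now apply Nat.mul_le_mono_l|nia].
Qed.

Lemma pbounded_prim K : pbounded (fun n => 40 * (S n * S K)).
Proof.
  apply pbounded_mul; [apply pbounded_const|].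
  apply pbounded_mul; [apply pbounded_S|apply pbounded_const].
Qed.

Definition natrec (c z : nat) (f : nat -> nat -> nat) : nat :=
  nat_rect (fun _ => nat) z f c.

Inductive exp : Type :=
| EVar (l : nat)
| EZero
| ESucc (e : exp)
| ELen
| EBit (e : exp)
| EIf (a b c d : exp)
| ERec (c z s : exp).

(* Variables are levels: at depth [d] the variables below [d] are in scope. The
   body of [ERec] sees the loop bound, the index and the accumulator as the
   levels [d], [d + 1] and [d + 2]. *)
Fixpoint eval (w : list bool) (d : nat) (env : nat -> nat) (e : exp) : nat :=
  match e with
  | EVar l => if l <? d then env l else 0
  | EZero => 0
  | ESucc e => Nat.min (length w) (S (eval w d env e))
  | ELen => length w
  | EBit e => Nat.b2n (nth (eval w d env e) w false)
  | EIf a b c e =>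
      let va := eval w d env a in
      if va =? eval w (S d) (upd env d va) b then eval w d env c else eval w d env e
  | ERec c z s =>
      let vc := eval w d env c in
      natrec vc (eval w (2 + d) (upd (upd env d vc) (S d) 0) z)
        (fun i a => eval w (3 + d) (upd (upd (upd env d vc) (S d) i) (2 + d) a) s)
  end.

Lemma natrec_ext c z z' f f' :
  z = z' -> (forall i a, f i a = f' i a) -> natrec c z f = natrec c z' f'.
Proof. intros -> H. unfold natrec. induction c; cbn; congruence. Qed.

Lemma upd_agree {A : Type} (f g : nat -> A) d a :
  (forall r, r < d -> f r = g r) -> forall r, r < S d -> upd f d a r = upd g d a r.
Proof.
  intros H r Hr. unfold upd. destruct (Nat.eqb_spec r d); [reflexivity|]. apply H. lia.
Qed.

(** Registers from level [d] on are scratch space: what earlier computations left there cannot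
    influence the value. *)
Lemma eval_agree w e : forall d env env',
  (forall r, r < d -> env r = env' r) -> eval w d env e = eval w d env' e.
Proof.
  induction e; intros d0 env env' H; cbn [eval]; try reflexivity.
  - destruct (Nat.ltb_spec l d0); auto.
  - now rewrite (IHe _ _ _ H).
  - now rewrite (IHe _ _ _ H).
  - rewrite (IHe1 _ _ _ H), (IHe3 _ _ _ H), (IHe4 _ _ _ H).
    erewrite IHe2; [reflexivity|]. now apply upd_agree.
  - rewrite (IHe1 _ _ _ H). apply natrec_ext.
    + apply IHe2. apply upd_agree, upd_agree, H.
    + intros i a. apply IHe3. apply upd_agree, upd_agree, upd_agree, H.
Qed.

Fixpoint width (d : nat) (e : exp) : nat :=
  match e with
  | EVar _ | EZero | ELen => S d
  | ESucc e | EBit e => width d e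
  | EIf a b c e => Nat.max (Nat.max (width d a) (width (S d) b)) (Nat.max (width d c) (width d e))
  | ERec c z s => Nat.max (width d c) (Nat.max (width (2 + d) z) (width (3 + d) s))
  end.

Lemma width_gt e : forall d, d < width d e.
Proof.
  induction e; intros d0; cbn; auto.
  - specialize (IHe1 d0). lia.
  - specialize (IHe1 d0). lia.
Qed.

(** At depth [d] the result is left in register [d] and the registers below keep their values, so
    the depth acts as a stack pointer. *)
Fixpoint compile (K d : nat) (e : exp) : prog :=
  match e with
  | EVar l => if l <? d then copy_reg K d l else zero_reg K d
  | EZero => zero_reg K d
  | ESucc e => PSeq (compile K d e) (inc_reg K d)
  | ELen => len_reg K d
  | EBit e => PSeq (compile K d e)
                (if_bit K d (PSeq (zero_reg K d) (inc_reg K d)) (zero_reg K d))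
  | EIf a b c e => PSeq (compile K d a) (PSeq (compile K (S d) b)
                     (if_eq K d (S d) (compile K d c) (compile K d e)))
  | ERec c z s =>
      PSeq (compile K d c) (PSeq (zero_reg K (S d)) (PSeq (compile K (2 + d) z)
        (PSeq (while_neq K (S d) d
                 (PSeq (compile K (3 + d) s)
                    (PSeq (copy_reg K (2 + d) (3 + d)) (inc_reg K (S d)))))
           (copy_reg K d (2 + d)))))
  end.

Definition result_in (w : list bool) (d : nat) (e : exp) (env env' : nat -> nat) : Prop :=
  env' d = eval w d env e /\ forall r, r < d -> env' r = env r.

Lemma computes_weaken K w P B B' (R R' : (nat -> nat) -> (nat -> nat) -> Prop) :
  computes K w P B R -> B <= B' -> (forall e e', R e e' -> R' e e') -> computes K w P B' R'.
Proof.
  intros H HB HR env T Hi. apply (reach_weaken (H env T Hi) HB).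
  intros h T' (-> & env' & H1 & H2). eauto.
Qed.

Lemma regs_inv_le K w env T r : regs_inv K w env T -> r < K -> env r <= length w.
Proof. intros [_ H]. apply H. Qed.

(** The index counts up from 0 until it equals the loop bound kept in register [d]. Its increments
    are exact, because the loop bound is itself a register value and thus at most [length w]. *)
Lemma computes_rec K w d c z s Bc Bz Bs :
  3 + d < K ->
  computes K w (compile K d c) Bc (result_in w d c) ->
  computes K w (compile K (2 + d) z) Bz (result_in w (2 + d) z) ->
  computes K w (compile K (3 + d) s) Bs (result_in w (3 + d) s) ->
  computes K w (compile K d (ERec c z s))
    (Bc + (prim_bound K w + (Bz +
      (S (length w) * (Bs + (prim_bound K w + prim_bound K w) + prim_bound K w)
       + prim_bound K w))))
    (result_in w d (ERec c z s)).
Proof.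
  intros HK Hc Hz Hs env T Hi. cbn [compile].
  eapply reach_seq; [|apply le_n].
  apply (reach_weaken (Hc _ _ Hi) (le_n _)).
  intros h1 T1 (-> & env1 & [E1 A1] & Hi1).
  eapply reach_seq; [|apply le_n].
  apply (reach_weaken (computes_zero K w (S d) ltac:(lia) _ _ Hi1) (le_n _)).
  intros h2 T2 (-> & env2 & E2 & Hi2).
  eapply reach_seq; [|apply le_n].
  apply (reach_weaken (Hz _ _ Hi2) (le_n _)).
  intros h3 T3 (-> & env3 & [E3 A3] & Hi3).
  eapply reach_seq; [|apply le_n].
  set (vc := eval w d env c) in *.
  set (F := fun i a => eval w (3 + d) (upd (upd (upd env d vc) (S d) i) (2 + d) a) s).
  set (z0 := eval w (2 + d) (upd (upd env d vc) (S d) 0) z).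
  assert (Hd : env3 d = vc).
  { rewrite A3 by lia. subst env2. now rewrite upd_other by lia. }
  assert (Hvc : vc <= length w).
  { rewrite <- Hd. apply (regs_inv_le _ _ _ _ _ Hi3). lia. }
  apply (reach_while_neq K w (S d) d _ _
    (fun k e => k <= vc /\ e d = vc /\ e (S d) = vc - k /\
       e (2 + d) = natrec (vc - k) z0 F /\ forall r, r < d -> e r = env r))
    with (k := vc) (env := env3).
  - lia.
  - lia.
  - intros k e T' (Hk & Ed & Ei & Ea & Er) HT'. split; [lia|].
    apply (reach_weaken (B := Bs + (prim_bound K w + prim_bound K w))
      (Q := fun h' T' => h' = S (length w) /\ exists e1 : nat -> nat,
          (e1 (2 + d) = eval w (3 + d) e s /\ (e1 (S d) = Nat.min (length w) (S (e (S d)))) /\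
          forall r, r <= d -> e1 r = e r) /\ regs_inv K w e1 T')).
    + refine (computes_seq K w _ _ _ _ _ _
        (fun e e1 => e1 (2 + d) = eval w (3 + d) e s /\ (e1 (S d) = Nat.min (length w) (S (e (S d)))) /\
          forall r, r <= d -> e1 r = e r) Hs
        (computes_seq K w _ _ _ _ _ _
          (fun e e' => e' (2 + d) = e (3 + d) /\ (e' (S d) = Nat.min (length w) (S (e (S d)))) /\
             forall r, r <= d -> e' r = e r)
          (computes_copy K w (2 + d) (3 + d) ltac:(lia) ltac:(lia) ltac:(lia))
          (computes_inc K w (S d) ltac:(lia)) _) _ e T' HT').
      * intros e0 e1 e2 -> ->. split; [|split].
        -- rewrite upd_other by lia. apply upd_same.
        -- rewrite upd_same. now rewrite (upd_other _ (2 + d)) by lia.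
        -- intros r Hr. now rewrite !upd_other by lia.
      * intros e0 e1 e2 [H1 H2] (H3 & H4 & H5). split; [|split].
        -- congruence.
        -- rewrite H4, H2 by lia. reflexivity.
        -- intros r Hr. rewrite H5, H2 by lia. reflexivity.
    + apply le_n.
    + intros h' T4 (-> & e1 & (H1 & H2 & H3) & Hi4). split; [reflexivity|].
      exists e1. split; [|exact Hi4]. split; [lia|]. split; [rewrite H3; auto|].
      split; [rewrite H2, Ei; lia|]. split.
      * rewrite H1. replace (vc - k) with (S (vc - S k)) by lia. cbn [natrec nat_rect].
        change (nat_rect _ z0 F (vc - S k)) with (natrec (vc - S k) z0 F). rewrite <- Ea.
        unfold F at 1. apply eval_agree. intros r Hr.
        unfold upd. destruct (Nat.eqb_spec r (2 + d)); [now subst|].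
        destruct (Nat.eqb_spec r (S d)); [now subst|].
        destruct (Nat.eqb_spec r d); [now subst|]. apply Er. lia.
      * intros r Hr. rewrite H3 by lia. now apply Er.
  - intros e (_ & Ed & Ei & _). lia.
  - exact Hvc.
  - split; [lia|]. split; [exact Hd|]. split; [|split].
    + rewrite A3 by lia. subst env2. rewrite upd_same. lia.
    + rewrite Nat.sub_diag. cbn [natrec nat_rect]. rewrite E3. apply eval_agree.
      subst env2. intros r Hr. unfold upd. destruct (Nat.eqb_spec r (S d)); [reflexivity|].
      destruct (Nat.eqb_spec r d); [now subst|]. apply A1. lia.
    + intros r Hr. rewrite A3 by lia. subst env2. rewrite upd_other by lia. now apply A1.
  - exact Hi3.
  - intros e T4 (_ & Ed & Ei & Ea & Er) Hi4.
    apply (reach_weaken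
      (computes_copy K w d (2 + d) ltac:(lia) ltac:(lia) ltac:(lia) _ _ Hi4) (le_n _)).
    intros h' T5 (-> & env5 & -> & Hi5). split; [reflexivity|].
    eexists. split; [|exact Hi5]. split.
    + rewrite upd_same, Ea, Nat.sub_0_r. reflexivity.
    + intros r Hr. rewrite upd_other by lia. now apply Er.
Qed.

Theorem compile_correct K e : forall d, width d e <= K ->
  exists f, pbounded f /\
    forall w, computes K w (compile K d e) (f (length w)) (result_in w d e).
Proof.
  (* Expressions that compile to a single assignment share the bound [prim_bound]. *)
  assert (Hprim : forall P d e0, d < K ->
    (forall w, exists v : (nat -> nat) -> nat, computes K w P (prim_bound K w) (fun env env' => env' = upd env d (v env)) /\
      forall env, v env = eval w d env e0) ->
    exists f, pbounded f /\ forall w, computes K w P (f (length w)) (result_in w d e0)).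
  { intros P d e0 Hd HP. eexists. split; [apply (pbounded_prim K)|]. intros w.
    destruct (HP w) as (v & Hv & Ev).
    apply (computes_weaken _ _ _ _ _ _ _ Hv (le_n _)). intros env env' ->. split.
    - now rewrite upd_same.
    - intros r Hr. apply upd_other. lia. }
  induction e; intros d0 Hw; cbn [width] in Hw.
  - apply Hprim; [lia|]. intros w. cbn [compile eval]. destruct (Nat.ltb_spec l d0).
    + exists (fun env => env l). split; [|reflexivity]. apply computes_copy; lia.
    + exists (fun _ => 0). split; [|reflexivity]. apply computes_zero; lia.
  - apply Hprim; [lia|]. intros w. exists (fun _ => 0). split; [|reflexivity].
    apply computes_zero; lia.
  - pose proof (width_gt e d0). destruct (IHe _ Hw) as (f & Hf & He).
    exists (fun n => f n + 40 * (S n * S K)).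
    split; [exact (pbounded_add _ _ Hf (pbounded_prim K))|]. intros w.
    refine (computes_seq _ _ _ _ _ _ _ _ _ (He w) (computes_inc K w d0 ltac:(lia)) _).
    intros e0 e1 e2 [H1 H2] ->. split.
    + rewrite upd_same, H1. reflexivity.
    + intros r Hr. rewrite upd_other by lia. auto.
  - apply Hprim; [lia|]. intros w. exists (fun _ => length w). split; [|reflexivity].
    apply computes_len; lia.
  - pose proof (width_gt e d0). destruct (IHe _ Hw) as (f & Hf & He).
    exists (fun n => f n + (40 * (S n * S K) + 40 * (S n * S K) + 40 * (S n * S K))).
    split.
    { exact (pbounded_add _ _ Hf (pbounded_add _ _
        (pbounded_add _ _ (pbounded_prim K) (pbounded_prim K)) (pbounded_prim K))). }
    intros w.
    refine (computes_seq _ _ _ _ _ _ _ _ _ (He w)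
      (computes_if_bit K w d0 _ _ _
        (fun env env' => env' d0 = Nat.min (length w) 1 /\ forall r, r < d0 -> env' r = env r)
        (fun env env' => env' d0 = 0 /\ forall r, r < d0 -> env' r = env r) ltac:(lia) _ _) _).
    + refine (computes_seq _ _ _ _ _ _ _ _ _ (computes_zero K w d0 ltac:(lia))
        (computes_inc K w d0 ltac:(lia)) _).
      intros e0 e1 e2 -> ->. split; [now rewrite !upd_same|].
      intros r Hr. now rewrite !upd_other by lia.
    + apply (computes_weaken _ _ _ _ _ _ _ (computes_zero K w d0 ltac:(lia))).
      * unfold prim_bound, zone. lia.
      * intros e0 e1 ->. split; [apply upd_same|]. intros r Hr. now rewrite upd_other by lia.
    + intros e0 e1 e2 [H1 H2] H3. unfold result_in. cbn [eval]. rewrite H1 in H3.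
      destruct (nth _ w false) eqn:E; destruct H3 as [H3 H4].
      * split; [|intros r Hr; rewrite H4; auto]. rewrite H3. cbn [Nat.b2n].
        (* A true bit exists only in a nonempty word, so the capped successor of 0 is really 1. *)
        destruct w; [now destruct (eval _ _ _ _)|cbn; lia].
      * split; [exact H3|]. intros r Hr; rewrite H4; auto.
  - pose proof (width_gt e1 d0). pose proof (width_gt e2 (S d0)).
    destruct (IHe1 d0 ltac:(lia)) as (f1 & Hf1 & He1).
    destruct (IHe2 (S d0) ltac:(lia)) as (f2 & Hf2 & He2).
    destruct (IHe3 d0 ltac:(lia)) as (f3 & Hf3 & He3).
    destruct (IHe4 d0 ltac:(lia)) as (f4 & Hf4 & He4).
    exists (fun n => f1 n + (f2 n + (f3 n + f4 n + 40 * (S n * S K)))).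
    split.
    { exact (pbounded_add _ _ Hf1 (pbounded_add _ _ Hf2
        (pbounded_add _ _ (pbounded_add _ _ Hf3 Hf4) (pbounded_prim K)))). }
    intros w.
    refine (computes_seq _ _ _ _ _ _ _ _ _ (He1 w) (computes_seq _ _ _ _ _ _ _ _
      (fun env1 env2 => exists env3, result_in w (S d0) e2 env1 env3 /\
         if env3 d0 =? env3 (S d0) then result_in w d0 e3 env3 env2
         else result_in w d0 e4 env3 env2) (He2 w)
      (computes_if_eq K w d0 (S d0) _ _ _ _ _ ltac:(lia) ltac:(lia)
        (computes_weaken _ _ _ _ (f3 (length w) + f4 (length w)) _ _ (He3 w) ltac:(lia) (fun _ _ H => H))
        (computes_weaken _ _ _ _ (f3 (length w) + f4 (length w)) _ _ (He4 w) ltac:(lia) (fun _ _ H => H)))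
      (fun _ env3 _ H H' => ex_intro _ env3 (conj H H'))) _).
    intros env env1 env2 [H1 H2] (env3 & [H3 H4] & H5). unfold result_in. cbn [eval].
    (* The second operand is compiled one level deeper, where register [d0] already holds the value
       of the first. *)
    assert (E : eval w (S d0) env1 e2 = eval w (S d0) (upd env d0 (eval w d0 env e1)) e2).
    { apply eval_agree. intros r Hr. unfold upd.
      destruct (Nat.eqb_spec r d0); [now subst|]. apply H2. lia. }
    rewrite H3, E, H4, H1 in H5 by lia.
    assert (A : forall r, r < d0 -> env3 r = env r).
    { intros r Hr. rewrite H4 by lia. auto. }
    destruct (_ =? _); destruct H5 as [H5 H6];
      (split; [rewrite H5; apply eval_agree, A|intros r Hr; rewrite H6, A; auto]).
  - pose proof (width_gt e1 d0). pose proof (width_gt e2 (2 + d0)). pose proof (width_gt e3 (3 + d0)).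
    destruct (IHe1 d0 ltac:(lia)) as (f1 & Hf1 & He1).
    destruct (IHe2 (2 + d0) ltac:(lia)) as (f2 & Hf2 & He2).
    destruct (IHe3 (3 + d0) ltac:(lia)) as (f3 & Hf3 & He3).
    pose (p := fun n => 40 * (S n * S K)). assert (Hp : pbounded p) by apply pbounded_prim.
    exists (fun n => f1 n + (p n + (f2 n + (S n * (f3 n + (p n + p n) + p n) + p n)))).
    split.
    + exact (pbounded_add _ _ Hf1 (pbounded_add _ _ Hp (pbounded_add _ _ Hf2
        (pbounded_add _ _ (pbounded_mul _ _ pbounded_S
          (pbounded_add _ _ (pbounded_add _ _ Hf3 (pbounded_add _ _ Hp Hp)) Hp)) Hp)))).
    + intros w. apply (computes_rec K w d0 e1 e2 e3); auto. lia.
Qed.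

(** * Building the register file from the input word *)

Lemma reach_fill b k : forall h T B (Q : nat -> tape -> Prop),
  (forall T', (forall j, h <= j < h + k -> T' j = Some b) ->
     (forall j, j < h \/ h + k <= j -> T' j = T j) -> Q (h + k) T') -> 2 * k <= B ->
  reach (prepeat k (PSeq (PWrite (Some b)) PRight)) h T B Q.
Proof.
  induction k; intros h T B Q HQ HB; cbn [prepeat].
  - exists 0, h, T. split; [constructor|]. split; [lia|].
    rewrite Nat.add_0_r in HQ. apply HQ; intros; [lia|reflexivity].
  - rseq 2 (2 * k).
    rseq 1 1. apply reach_write; [|lia]. apply reach_right; [|lia].
    apply IHk; [|lia]. intros T' H1 H2. replace (S h + k) with (h + S k) by lia. apply HQ.
    + intros j Hj. destruct (Nat.eq_dec j h) as [->|].
      * rewrite H2 by lia. apply upd_same.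
      * apply H1. lia.
    + intros j Hj. rewrite H2 by lia. apply upd_other. lia.
Qed.

Section Setup.

Variables (K : nat) (w : list bool).
Let n := length w.

Definition append_block (b : bool) : prog :=
  PSeq (PWrite (Some b)) (PSeq PRight (prepeat K (PSeq (PWrite (Some false)) PRight))).
Definition next_blank_right : prog := PSeq PRight (PWhile nonblank PRight).
Definition next_blank_left : prog := PSeq PLeft (PWhile nonblank PLeft).
(** The erased input cell is the landmark for the way back: coming from the right, the first blank
    is cell [n], the second the cell just erased, and the next input bit stands right of it. The
    erased bit is remembered by the choice between two copies of this program. *)
Definition consume (b : bool) : prog :=
  PSeq (PWrite None) (PSeq next_blank_right (PSeq next_blank_right (PSeq (append_block b)
    (PSeq next_blank_left (PSeq next_blank_left PRight))))).
(** Block [n] gets the bit false, the value read beyond the word. Each [PLeft] before [home] leaves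
    a cell that may be blank, on which [home] would stop too early. Marking all of block 0
    initialises every register to 0. *)
Definition setup : prog :=
  PSeq (PWhile nonblank (PIf marked (consume true) (consume false)))
    (PSeq next_blank_right (PSeq (append_block false) (PSeq PLeft (PSeq home
      (PSeq PRight (PSeq (prepeat K (PSeq (PWrite (Some true)) PRight))
        (PSeq PLeft home))))))).

(* Cells [i .. n - 1] still hold input, the blocks [0 .. i - 1] are already built. *)
Definition setup_inv (i : nat) (T : tape) : Prop :=
  i <= n /\
  (forall j, j < i -> T j = None) /\
  (forall j, i <= j < n -> T j = Some (nth j w false)) /\
  T n = None /\
  (forall i', i' < i -> T (addr K w i' 0) = Some (nth i' w false)) /\
  (forall i' r, i' < i -> r < K -> T (addr K w i' (S r)) = Some false) /\
  (forall j, addr K w i 0 <= j -> T j = None).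

Lemma reach_append b i T B (Q : nat -> tape -> Prop) :
  (forall T', T' (addr K w i 0) = Some b ->
     (forall r, r < K -> T' (addr K w i (S r)) = Some false) ->
     (forall j, j < addr K w i 0 \/ addr K w (S i) 0 <= j -> T' j = T j) ->
     Q (addr K w (S i) 0) T') -> 2 * K + 2 <= B ->
  reach (append_block b) (addr K w i 0) T B Q.
Proof.
  intros HQ HB. rseq 1 (2 * K + 1).
  apply reach_write; [|lia].
  rseq 1 (2 * K). apply reach_right; [|lia].
  apply reach_fill; [|lia]. intros T' H1 H2.
  replace (S (addr K w i 0) + K) with (addr K w (S i) 0) in * by (unfold addr; lia).
  apply HQ.
  - rewrite H2 by lia. apply upd_same.
  - intros r Hr. apply H1. unfold addr. lia.
  - intros j Hj. rewrite H2 by lia. apply upd_other. unfold addr in *. lia.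
Qed.

Lemma setup_nonblank i T j :
  setup_inv i T -> S n <= j < addr K w i 0 -> nonblank (T j) = true.
Proof.
  intros (_ & _ & _ & _ & Hb & Hm & _) [H1 H2].
  destruct (addr_cases K w j H1) as (i' & t & Ht & ->).
  assert (i' < i) by (unfold addr in H2; nia).
  destruct t; [now rewrite Hb|]. now rewrite Hm by lia.
Qed.

Lemma reach_next_right h T g B (Q : nat -> tape -> Prop) :
  h < g -> T g = None -> (forall j, h < j < g -> nonblank (T j) = true) ->
  Q g T -> 3 * g + 2 <= B -> reach next_blank_right h T B Q.
Proof.
  intros Hgh Hg Hnb HQ HB. rseq 1 (3 * g + 1).
  apply reach_right; [|lia]. apply (reach_scan_right _ _ g); auto; try lia.
Qed.

Lemma reach_next_left h T g B (Q : nat -> tape -> Prop) :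
  g < h -> T g = None -> (forall j, g < j < h -> nonblank (T j) = true) ->
  Q g T -> 3 * h + 2 <= B -> reach next_blank_left h T B Q.
Proof.
  intros Hgh Hg Hnb HQ HB. rseq 1 (3 * h + 1).
  apply reach_left; [|lia]. apply (reach_scan_left _ _ g); auto; try lia.
  intros j Hj. apply Hnb. lia.
Qed.

Let total := S n + zone K w.

Lemma addr_total i : i <= S n -> addr K w i 0 <= total.
Proof. unfold addr, total, zone. fold n. intros. nia. Qed.

Lemma reach_consume i b T :
  setup_inv i T -> i < n -> nth i w false = b ->
  reach (consume b) i T (30 * total) (fun h' T' => h' = S i /\ setup_inv (S i) T').
Proof.
  intros Hi Hlt Eb.
  pose proof (fun j => setup_nonblank i T j Hi) as Hnb.
  destruct Hi as (_ & H1 & H2 & H3 & H4 & H5 & H6).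
  pose proof (addr_total i ltac:(lia)). pose proof (addr_total (S i) ltac:(lia)).
  assert (Ha : S n <= addr K w i 0) by (unfold addr; fold n; lia).
  assert (Hb : addr K w (S i) 0 = addr K w i 0 + S K) by (unfold addr; lia).
  assert (n < total) by (unfold total; lia).
  rseq 1 (29 * total). apply reach_write; [|lia].
  rseq (5 * total) (24 * total).
  apply (reach_next_right _ _ n); [lia| | | |lia].
  { rewrite upd_other by lia. exact H3. }
  { intros j Hj. rewrite upd_other, H2 by lia. reflexivity. }
  rseq (5 * total) (19 * total).
  apply (reach_next_right _ _ (addr K w i 0)); [lia| | | |lia].
  { rewrite upd_other by lia. apply H6. lia. }
  { intros j Hj. rewrite upd_other by lia. apply Hnb. lia. }
  rseq (4 * total) (15 * total).
  apply reach_append; [|lia]. intros T' A1 A2 A3.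
  assert (HT' : setup_inv (S i) T').
  { split; [lia|]. split; [|split; [|split; [|split; [|split]]]].
    - intros j Hj. rewrite A3 by lia. destruct (Nat.eq_dec j i) as [->|]; [apply upd_same|].
      rewrite upd_other by lia. apply H1. lia.
    - intros j Hj. rewrite A3, upd_other by lia. apply H2. lia.
    - rewrite A3, upd_other by lia. exact H3.
    - intros i' Hi'. destruct (Nat.eq_dec i' i) as [->|]; [now rewrite A1, Eb|].
      assert (S n <= addr K w i' 0 < addr K w i 0) by (unfold addr; fold n; nia).
      rewrite A3, upd_other by lia. apply H4. lia.
    - intros i' r Hi' Hr. destruct (Nat.eq_dec i' i) as [->|]; [now apply A2|].
      assert (S n <= addr K w i' (S r) < addr K w i 0) by (unfold addr; fold n; nia).
      rewrite A3, upd_other by lia. apply H5; lia.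
    - intros j Hj. rewrite A3, upd_other by lia. apply H6. lia. }
  pose proof (fun j => setup_nonblank _ _ j HT') as Hnb'.
  pose proof HT' as (_ & H1' & H2' & H3' & _).
  rseq (5 * total) (10 * total).
  apply (reach_next_left _ _ n); [lia|exact H3'| | |lia].
  { intros j Hj. apply Hnb'. lia. }
  rseq (5 * total) (5 * total).
  apply (reach_next_left _ _ i); [lia|apply H1'; lia| | |lia].
  { intros j Hj. now rewrite H2' by lia. }
  apply reach_right; [|lia]. now split.
Qed.

Lemma reach_setup :
  reach setup 0 (word_tape w) (n * (30 * total + 4) + 100 * total)
    (fun h' T' => h' = S n /\ regs_inv K w (fun _ => 0) T').
Proof.
  assert (Hz : S K <= zone K w /\ n < total /\ zone K w < total) by (unfold total, zone; nia).
  rseq (n * (30 * total + 4) + 1) (50 * total).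
  apply (reach_while nonblank _ (30 * total + 2)
    (fun k h' T' => h' + k = n /\ setup_inv h' T')) with (k := n); [| | |lia|].
  - intros k h' T' [E Hi]. pose proof Hi as (_ & _ & H2 & _). rewrite H2 by lia.
    split; [reflexivity|]. apply (reach_if _ _ _ _ _ _ (30 * total)); [| |lia]; rewrite H2 by lia;
      intros Hb; (eapply reach_weaken;
       [apply (reach_consume h' _ _ Hi); [lia|now destruct (nth h' w false)]|lia|]);
       intros h1 T1 [-> H1]; (split; [lia|exact H1]).
  - intros h' T' [E Hi]. replace h' with n by lia. destruct Hi as (_ & _ & _ & -> & _). reflexivity.
  - split; [lia|]. unfold word_tape. split; [lia|]. split; [lia|]. split; [|split; [|split; [lia|split; [lia|]]]].
    + intros j Hj. rewrite (nth_indep _ None (Some false)) by (rewrite length_map; fold n; lia).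
      apply map_nth.
    + apply nth_overflow. rewrite length_map. fold n. lia.
    + intros j Hj. apply nth_overflow. rewrite length_map. unfold addr in Hj. lia.
  - intros h T [E Hi]. rewrite Nat.add_0_r in E. subst h.
    pose proof (fun j => setup_nonblank _ _ j Hi) as Hnb.
    destruct Hi as (_ & H1 & H2 & H3 & H4 & H5 & H6).
    pose proof (addr_total n ltac:(lia)). pose proof (addr_total (S n) ltac:(lia)).
    assert (Ha : S n <= addr K w n 0) by (unfold addr; fold n; lia).
    assert (Hb : addr K w (S n) 0 = addr K w n 0 + S K) by (unfold addr; lia).
    rseq (5 * total) (45 * total).
    apply (reach_next_right _ _ (addr K w n 0)); [lia|apply H6; lia| | |lia].
    { intros j Hj. apply Hnb. lia. }
    rseq (4 * total) (41 * total).
    apply reach_append; [|lia]. intros T1 A1 A2 A3.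
    assert (M1 : marks_inv K w (fun _ _ => false) T1).
    { split; [|split; [|split]].
      - rewrite A3 by lia. exact H3.
      - intros i Hi. fold n in Hi. destruct (Nat.eq_dec i n) as [->|].
        + rewrite A1. now rewrite nth_overflow by (fold n; lia).
        + rewrite A3 by (left; unfold addr; nia). apply H4. lia.
      - intros i r Hi Hr. fold n in Hi. destruct (Nat.eq_dec i n) as [->|]; [now apply A2|].
        rewrite A3 by (left; unfold addr; nia). apply H5; lia.
      - intros j Hj. fold n in Hj. rewrite A3 by lia. apply H6. lia. }
    rseq 1 (40 * total). apply reach_left; [|lia].
    rseq (10 * total) (30 * total).
    apply (reach_home K w _ _ _ _ _ M1); [fold n; fold total; lia| |lia].
    rseq 1 (29 * total). apply reach_right; [|lia].
    rseq (3 * total) (26 * total).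
    apply reach_fill; [|lia]. fold n. intros T2 F1 F2.
    assert (M2 : marks_inv K w (fun _ i => 0 =? i) T2).
    { destruct M1 as (B1 & B2 & B3 & B4). split; [|split; [|split]].
      - rewrite F2 by lia. exact B1.
      - intros i Hi. rewrite F2; [now apply B2|]. unfold addr. fold n. destruct i; [left|right]; nia.
      - intros i r Hi Hr. destruct i.
        + rewrite F1 by (unfold addr; fold n; lia). reflexivity.
        + rewrite F2 by (right; unfold addr; fold n; nia). rewrite B3; auto.
      - intros j Hj. rewrite F2; [now apply B4|]. right. unfold addr in Hj. fold n in Hj. nia. }
    rseq 1 (25 * total). apply reach_left; [|lia].
    apply (reach_home K w _ _ _ _ _ M2); [fold n; fold total; unfold total; lia| |lia].
    split; [reflexivity|]. split; [exact M2|]. intros. lia.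
Qed.

End Setup.

(** One cell right of the home position is the mark of register 0 in block 0, set exactly when the
    result is 0; hence acceptance by [unmarked]. *)
Theorem exp_in_P e : in_P (fun w => eval w 0 (fun _ => 0) e <> 0).
Proof.
  pose proof (width_gt e 0) as Hwd.
  pose (K := width 0 e).
  destruct (compile_correct K e 0 (le_n _)) as (f & Hf & Hc).
  pose (total := fun n => S n + S n * S K).
  assert (Htot : pbounded total).
  { exact (pbounded_add _ _ pbounded_S (pbounded_mul _ _ pbounded_S (pbounded_const (S K)))). }
  pose (g := fun n => S n * (30 * total n + 4) + 100 * total n + (f n + 1)).
  assert (Hg : pbounded g).
  { exact (pbounded_add _ _
      (pbounded_add _ _
        (pbounded_mul _ _ pbounded_S
          (pbounded_add _ _ (pbounded_mul _ _ (pbounded_const 30) Htot) (pbounded_const 4)))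
        (pbounded_mul _ _ (pbounded_const 100) Htot))
      (pbounded_add _ _ Hf (pbounded_const 1))). }
  destruct (pbounded_poly g Hg) as (c & k & Hp).
  apply (exec_decides unmarked (PSeq (setup K) (PSeq (compile K 0 e) PRight)) _ c k).
  intros w. specialize (Hp (length w)).
  assert (R : reach (PSeq (setup K) (PSeq (compile K 0 e) PRight)) 0 (word_tape w)
    (g (length w))
    (fun h T => T h = Some (eval w 0 (fun _ => 0) e =? 0))).
  { apply (reach_seq _ _ _ _ _
      (length w * (30 * total (length w) + 4) + 100 * total (length w)) (f (length w) + 1));
      [|unfold g; nia].
    apply (reach_weaken (reach_setup K w)); [unfold total, zone; lia|].
    intros h T [-> Hi]. rseq (f (length w)) 1.
    apply (reach_weaken (Hc w _ _ Hi) (le_n _)).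
    intros h T' (-> & env' & [E _] & Hi'). apply reach_right; [|lia].
    destruct Hi' as [(_ & _ & H3 & _) _].
    replace (S (S (length w))) with (addr K w 0 1) by (unfold addr; lia).
    rewrite H3 by (unfold K; lia). now rewrite E. }
  destruct R as (t & h & T & Ex & Ht & HT). exists t, h, T.
  split; [exact Ex|]. split; [lia|]. rewrite HT. cbn.
  destruct (Nat.eqb_spec (eval w 0 (fun _ => 0) e) 0); split; auto; congruence.
Qed.

(** * The verifier *)

(* Programs are written once over an abstract language [Lang], which has two
   instances: plain numbers ([nat_lang w]), used for reasoning, and expressions
   ([exp_lang]), used for compilation. *)
Class Lang : Type := {
  car : Type;
  zero : car;
  succ : car -> car;
  len : car;
  bit : car -> car;
  ife : car -> car -> car -> car -> car;
  rec : car -> car -> (car -> car -> car) -> car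
}.

Definition nat_lang (w : list bool) : Lang := {|
  car := nat;
  zero := 0;
  succ := fun v => Nat.min (length w) (S v);
  len := length w;
  bit := fun v => Nat.b2n (nth v w false);
  ife := fun a b c d => if a =? b then c else d;
  rec := natrec
|}.

(** An element is an expression for every depth. As variables are levels, a bound variable is a
    constant function of the depth and can be used under further binders without shifting. *)
Definition exp_lang : Lang := {|
  car := nat -> exp;
  zero := fun _ => EZero;
  succ := fun e d => ESucc (e d);
  len := fun _ => ELen;
  bit := fun e d => EBit (e d);
  ife := fun a b c e d => EIf (a d) (b (S d)) (c d) (e d);
  rec := fun c z f d =>
    ERec (c d) (z (2 + d)) (f (fun _ => EVar (S d)) (fun _ => EVar (2 + d)) (3 + d))
|}.

Section Programs.
Context {L : Lang}.

Definition tt_ : car := succ zero.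
Definition eqb_ (a b : car) : car := ife a b tt_ zero.
Definition neg_ (a : car) : car := ife a zero tt_ zero.
Definition and_ (a b : car) : car := ife a zero zero b.
Definition or_ (a b : car) : car := ife a zero b tt_.
Definition imp_ (a b : car) : car := or_ (neg_ a) b.
Definition plus_ (a b : car) : car := rec b a (fun _ acc => succ acc).
Definition twice_ (a : car) : car := plus_ a a.
Definition mul_ (a b : car) : car := rec a zero (fun _ acc => plus_ acc b).
Definition ex_ (c : car) (f : car -> car) : car := rec c zero (fun i acc => or_ acc (f i)).
Definition all_ (c : car) (f : car -> car) : car := rec c tt_ (fun i acc => and_ acc (f i)).
Definition lt_ (a b : car) : car := ex_ b (fun i => eqb_ i a).
(* least index satisfying [f], or the bound [c] if there is none *)
Definition mu_ (c : car) (f : car -> car) : car :=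
  rec c c (fun i acc => ife acc c (ife (f i) zero acc i) acc).
Definition iter_ (c : car) (f : car -> car) (p : car) : car := rec c p (fun _ acc => f acc).
Fixpoint lit_ (k : nat) : car := match k with 0 => zero | S k => succ (lit_ k) end.

(** In a doubled word the two bits of each pair agree, so the first pair of different bits is a
    separator. *)
Definition differ_ (p : car) : car := neg_ (eqb_ (bit p) (bit (succ p))).
Definition xlen_ : car := mu_ len (fun i => differ_ (twice_ i)).
Definition yoff_ : car := succ (succ (twice_ xlen_)).
Definition ylen_ : car := mu_ len (fun j => differ_ (plus_ yoff_ (twice_ j))).
Definition zoff_ : car := succ (succ (plus_ yoff_ (twice_ ylen_))).
Definition xb_ (i : car) : car := and_ (lt_ i xlen_) (bit (twice_ i)).
Definition yb_ (j : car) : car := and_ (lt_ j ylen_) (bit (plus_ yoff_ (twice_ j))).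
Definition zb_ (j : car) : car := bit (plus_ zoff_ (twice_ j)).

(* [y] and [z] hold arrays of numbers in the format [(1^v 0)*]: the value of
   entry [i] is the number of ones preceded by exactly [i] zeros. *)
Definition zeros_ (b : car -> car) (p : car) : car :=
  rec p zero (fun q a => ife (b q) zero (succ a) a).
Definition get_ (b : car -> car) (i : car) : car :=
  rec len zero (fun p a => ife (and_ (b p) (eqb_ (zeros_ b p) i)) zero a (succ a)).
(** Arrays are read as matrices in row-major order with one column per position of [x]; this is
    enough for identifiers of names, argument positions and indices in a cycle. *)
Definition Y_ (i j : car) : car := get_ yb_ (plus_ (mul_ i xlen_) j).
Definition Z_ (i j : car) : car := get_ zb_ (plus_ (mul_ i xlen_) j).

(* Objects encoded in [x] are handled through the position where their code starts. *)
Definition pairs_ (p : car) : car :=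
  mu_ xlen_ (fun k => neg_ (eqb_ (xb_ (plus_ p (twice_ k))) (xb_ (succ (plus_ p (twice_ k)))))).
Definition next_ (p : car) : car := succ (succ (plus_ p (twice_ (pairs_ p)))).
Definition pow_ (i : car) : car := rec i tt_ (fun _ a => twice_ a).
Definition val_ (p : car) : car :=
  rec (pairs_ p) zero (fun i a => ife (xb_ (plus_ p (twice_ i))) zero a (plus_ a (pow_ i))).
(** Besides the separator, the most significant bit is checked: it must be 1, as otherwise a padded
    binary word would pass for a code of the same number. *)
Definition oknat_ (p : car) : car :=
  and_ (lt_ (succ (plus_ p (twice_ (pairs_ p)))) xlen_)
    (and_ (eqb_ (xb_ (plus_ p (twice_ (pairs_ p)))) zero)
      (or_ (eqb_ (pairs_ p) zero)
        (ex_ (pairs_ p) (fun j => and_ (eqb_ (succ j) (pairs_ p)) (xb_ (plus_ p (twice_ j))))))).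
(** Names are compared bit by bit, because [val_] is capped and would identify large names. Only
    lengths of lists are read through [val_]. *)
Definition eqname_ (p q : car) : car :=
  and_ (eqb_ (pairs_ p) (pairs_ q))
    (all_ (succ (succ (twice_ (pairs_ p)))) (fun i => eqb_ (xb_ (plus_ p i)) (xb_ (plus_ q i)))).
Definition rep_ (p : car) : car := mu_ xlen_ (fun q => eqname_ p q).

Definition arity_ (a : car) : car := val_ (next_ a).
Definition arg_ (a k : car) : car := iter_ k next_ (next_ (next_ a)).
Definition atom_end_ (a : car) : car := arg_ a (arity_ a).
Definition atom_ (l j : car) : car := iter_ j atom_end_ (next_ l).
Definition head_ (t : car) : car := atom_ t (val_ t).
Definition tgd_end_ (t : car) : car := atom_ (head_ t) (val_ (head_ t)).
Definition tgd_ (i : car) : car := iter_ i tgd_end_ (next_ zero).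
Definition ntgds_ : car := val_ zero.

Definition exL_ (l : car) (f : car -> car) : car := ex_ (val_ l) (fun j => f (atom_ l j)).
Definition allL_ (l : car) (f : car -> car) : car := all_ (val_ l) (fun j => f (atom_ l j)).
Definition inL_ (l p : car) : car :=
  exL_ l (fun a => ex_ (arity_ a) (fun k => eqname_ (arg_ a k) p)).

Definition okatom_ (a : car) : car :=
  and_ (oknat_ a) (and_ (oknat_ (next_ a)) (all_ (arity_ a) (fun k => oknat_ (arg_ a k)))).
Definition oklist_ (l : car) : car := and_ (oknat_ l) (allL_ l okatom_).
Definition oktgd_ (t : car) : car := and_ (oklist_ t) (oklist_ (head_ t)).
Definition okx_ : car :=
  and_ (oknat_ zero) (and_ (all_ ntgds_ (fun i => oktgd_ (tgd_ i))) (eqb_ (tgd_ ntgds_) xlen_)).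
Definition allA_ (t : car) (f : car -> car) : car := and_ (allL_ t f) (allL_ (head_ t) f).
Definition wfx_ : car :=
  all_ ntgds_ (fun i => all_ ntgds_ (fun j =>
    allA_ (tgd_ i) (fun a => allA_ (tgd_ j) (fun b =>
      imp_ (eqname_ a b) (eqb_ (arity_ a) (arity_ b)))))).

Definition m_ : car := Y_ zero zero.
Definition tau_ (e : car) : car := tgd_ (Y_ (lit_ 1) e).
Definition succ_cyc_ (e : car) : car := ife (succ e) m_ zero (succ e).
Definition code1_ (e p : car) : car :=
  ife (inL_ (tau_ e) p) zero (succ (twice_ (rep_ p)))
    (twice_ (Y_ (plus_ (lit_ 7) (twice_ e)) (rep_ p))).
Definition code2_ (e p : car) : car := twice_ (Y_ (plus_ (lit_ 8) (twice_ e)) (rep_ p)).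
Definition codeg_ (e p : car) : car :=
  ife (inL_ (tau_ (succ_cyc_ e)) p) zero
    (ife (Z_ zero (rep_ p)) zero (code1_ e (Z_ (lit_ 1) (rep_ p)))
       (code2_ e (Z_ (lit_ 1) (rep_ p))))
    (code2_ e p).
Definition eqfact_ (f g : car -> car) (a b : car) : car :=
  and_ (eqname_ a b) (and_ (eqb_ (arity_ a) (arity_ b))
    (all_ (arity_ a) (fun k => eqb_ (f (arg_ a k)) (g (arg_ b k))))).
Definition edgeok_ (e : car) : car :=
  exL_ (tau_ (succ_cyc_ e)) (fun a =>
    and_ (neg_ (exL_ (tau_ e) (fun b => eqfact_ (code2_ e) (code1_ e) a b)))
      (exL_ (head_ (tau_ e)) (fun b => eqfact_ (code2_ e) (code1_ e) a b))).
(** Codes are uniquely readable, so two tgds are equal when their codes are equal words of a common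
    length [l]. *)
Definition eqtgd_ (t u : car) : car :=
  ex_ len (fun l => and_ (eqb_ (plus_ t l) (tgd_end_ t)) (and_ (eqb_ (plus_ u l) (tgd_end_ u))
    (all_ l (fun i => eqb_ (xb_ (plus_ t i)) (xb_ (plus_ u i)))))).

Definition tau0_ : car := tau_ (Y_ (lit_ 2) zero).
Definition batom_ : car := atom_ tau0_ (Y_ (lit_ 3) zero).
Definition bpos_ : car := Y_ (lit_ 4) zero.
Definition hatom_ : car := atom_ (head_ tau0_) (Y_ (lit_ 5) zero).
Definition hpos_ : car := Y_ (lit_ 6) zero.
Definition exedge_ : car :=
  and_ (lt_ (Y_ (lit_ 2) zero) m_)
  (and_ (and_ (lt_ (Y_ (lit_ 3) zero) (val_ tau0_)) (lt_ bpos_ (arity_ batom_)))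
  (and_ (inL_ (head_ tau0_) (arg_ batom_ bpos_))
  (and_ (and_ (lt_ (Y_ (lit_ 5) zero) (val_ (head_ tau0_))) (lt_ hpos_ (arity_ hatom_)))
     (neg_ (inL_ tau0_ (arg_ hatom_ hpos_)))))).
Definition distinct_ : car :=
  all_ m_ (fun e => all_ m_ (fun f => or_ (eqb_ e f) (neg_ (eqtgd_ (tau_ e) (tau_ f))))).
Definition ycond_ : car :=
  and_ (lt_ zero m_) (and_ (all_ m_ (fun e => lt_ (Y_ (lit_ 1) e) ntgds_))
    (and_ distinct_ (and_ (all_ m_ edgeok_) exedge_))).

Definition zhom_ : car :=
  ex_ m_ (fun e => allL_ (head_ (tau_ (succ_cyc_ e))) (fun b =>
    or_ (exL_ (tau_ e) (fun a => eqfact_ (codeg_ e) (code1_ e) b a))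
    (or_ (exL_ (head_ (tau_ e)) (fun a => eqfact_ (codeg_ e) (code1_ e) b a))
         (exL_ (tau_ (succ_cyc_ e)) (fun a => eqfact_ (codeg_ e) (code2_ e) b a))))).
Definition inS_ (a k : car) : car := Z_ (plus_ (lit_ 3) (rep_ a)) k.
Definition zset_ : car :=
  and_ (inS_ hatom_ hpos_) (and_ (neg_ (inS_ batom_ bpos_))
    (all_ m_ (fun e => allL_ (tau_ e) (fun a => all_ (arity_ a) (fun k =>
      imp_ (and_ (inL_ (head_ (tau_ e)) (arg_ a k)) (inS_ a k))
        (allL_ (head_ (tau_ e)) (fun b => all_ (arity_ b) (fun l =>
          imp_ (or_ (eqname_ (arg_ b l) (arg_ a k)) (neg_ (inL_ (tau_ e) (arg_ b l))))
            (inS_ b l))))))))).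
Definition verifier_ : car :=
  and_ okx_ (and_ wfx_ (or_ (neg_ ycond_) (or_ zhom_ zset_))).

End Programs.

(** * Agreement of the numeric and the compiled reading of programs *)

Section Adequacy.

Variable w : list bool.

Definition ctx : Type := (nat * (nat -> nat))%type.
Definition ctx_le (G G' : ctx) : Prop :=
  fst G <= fst G' /\ forall r, r < fst G -> snd G' r = snd G r.

Lemma ctx_le_refl G : ctx_le G G.
Proof. split; auto. Qed.

Lemma ctx_le_trans G1 G2 G3 : ctx_le G1 G2 -> ctx_le G2 G3 -> ctx_le G1 G3.
Proof.
  intros [H1 H2] [H3 H4]. split; [lia|]. intros r Hr. rewrite H4, H2 by lia. reflexivity.
Qed.

(** A Kripke-style logical relation: the expression has to denote [v] in all extensions of the
    context, because a program may use its argument under further binders. [denf] is the same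
    relation at function type. *)
Definition den (b : @car exp_lang) (G : ctx) (v : @car (nat_lang w)) : Prop :=
  forall G', ctx_le G G' -> eval w (fst G') (snd G') (b (fst G')) = v.

Definition denf (f : @car exp_lang -> @car exp_lang) (G : ctx)
    (g : @car (nat_lang w) -> @car (nat_lang w)) : Prop :=
  forall G' b v, ctx_le G G' -> den b G' v -> den (f b) G' (g v).

Lemma den_mono b G G' v : den b G v -> ctx_le G G' -> den b G' v.
Proof. intros H HG G'' HG'. apply H. eapply ctx_le_trans; eauto. Qed.

Lemma den_zero G : den zero G zero.
Proof. intros G' _. reflexivity. Qed.

Lemma den_succ a G v : den a G v -> den (succ a) G (succ v).
Proof. intros H G' HG. cbn. now rewrite (H G' HG). Qed.

Lemma den_len G : den len G len.
Proof. intros G' _. reflexivity. Qed.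

Lemma den_bit a G v : den a G v -> den (bit a) G (bit v).
Proof. intros H G' HG. cbn. now rewrite (H G' HG). Qed.

Lemma ctx_le_upd d env G v : ctx_le G (d, env) -> ctx_le G (S d, upd env d v).
Proof.
  intros [H1 H2]. cbn in *. split; cbn; [lia|]. intros r Hr. rewrite upd_other by lia. auto.
Qed.

Lemma den_ife a b c e G va vb vc ve :
  den a G va -> den b G vb -> den c G vc -> den e G ve -> den (ife a b c e) G (ife va vb vc ve).
Proof.
  intros Ha Hb Hc He [d env] HG. cbn [ife exp_lang nat_lang eval fst snd].
  rewrite (Ha _ HG : eval w d env (a d) = va).
  rewrite (Hc _ HG : eval w d env (c d) = vc), (He _ HG : eval w d env (e d) = ve).
  now rewrite (Hb _ (ctx_le_upd _ _ _ va HG) : eval w (S d) (upd env d va) (b (S d)) = vb).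
Qed.

Lemma den_rec c z f G vc vz (g : nat -> nat -> nat) :
  den c G vc -> den z G vz ->
  (forall G' bi ba i a, ctx_le G G' -> den bi G' i -> den ba G' a -> den (f bi ba) G' (g i a)) ->
  den (rec c z f) G (@rec (nat_lang w) vc vz g).
Proof.
  intros Hc Hz Hf [d env] HG. cbn [rec exp_lang nat_lang eval fst snd].
  rewrite (Hc _ HG : eval w d env (c d) = vc). apply natrec_ext.
  - apply (Hz (2 + d, upd (upd env d vc) (S d) 0)). now apply ctx_le_upd, ctx_le_upd.
  - intros i a. set (G' := (3 + d, upd (upd (upd env d vc) (S d) i) (2 + d) a) : ctx).
    assert (HG' : ctx_le G G') by now apply ctx_le_upd, ctx_le_upd, ctx_le_upd.
    (* The body is applied to the variables for index and accumulator, which denote [i] and [a] in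
       the extended context. *)
    refine (Hf G' (fun _ => EVar (S d)) (fun _ => EVar (2 + d)) i a HG' _ _ G' (ctx_le_refl _)).
    + intros G'' [H1 H2]. cbn in H1, H2. cbn [eval].
      destruct (Nat.ltb_spec (S d) (fst G'')); [|lia]. rewrite H2 by lia.
      rewrite upd_other by lia. apply upd_same.
    + intros G'' [H1 H2]. cbn in H1, H2. cbn [eval].
      destruct (Nat.ltb_spec (2 + d) (fst G'')); [|lia]. rewrite H2 by lia.
      apply upd_same.
Qed.

Ltac ctx_solve :=
  first [ assumption | apply ctx_le_refl
        | match goal with
          | H : ctx_le ?A ?B |- ctx_le ?A ?C => apply (ctx_le_trans A B C H); ctx_solve
          end ].

Ltac den_hyp :=
  match goal with
  | H : den ?b ?G ?v |- den ?b ?G' ?v => apply (den_mono b G G' v H); ctx_solve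
  | H : denf ?f ?G ?g |- den (?f ?b) ?G' (?g ?v) => apply (H G' b v); [ctx_solve|]
  end.

#[local] Create HintDb den discriminated.
#[local] Hint Constants Opaque : den.
#[local] Hint Extern 0 (den _ _ _) => den_hyp : den.
#[local] Hint Extern 0 (denf _ _ _) => intros ? ? ? ? ? : den.
#[local] Hint Resolve den_zero den_succ den_len den_bit den_ife den_rec : den.
Ltac den_solve d := intros; unfold d; auto 100 with den nocore.

Lemma den_lit k G : den (lit_ k) G (lit_ k).
Proof. induction k; cbn [lit_]; auto with den nocore. Qed.
#[local] Hint Resolve den_lit : den.
Notation den0 f := (forall G, den (f exp_lang) G (f (nat_lang w))).
Notation den1 f := (forall a v G, den a G v -> den (f exp_lang a) G (f (nat_lang w) v)).
Notation den2 f := (forall a b u v G, den a G u -> den b G v ->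
  den (f exp_lang a b) G (f (nat_lang w) u v)).
Notation den_bind f := (forall a h v k G, den a G v -> denf h G k ->
  den (f exp_lang a h) G (f (nat_lang w) v k)).

Lemma den_tt : den0 (@tt_).
Proof. den_solve @tt_. Qed.
#[local] Hint Resolve den_tt : den.
Lemma den_eqb : den2 (@eqb_).
Proof. den_solve @eqb_. Qed.
#[local] Hint Resolve den_eqb : den.
Lemma den_neg : den1 (@neg_).
Proof. den_solve @neg_. Qed.
#[local] Hint Resolve den_neg : den.
Lemma den_and : den2 (@and_).
Proof. den_solve @and_. Qed.
#[local] Hint Resolve den_and : den.
Lemma den_or : den2 (@or_).
Proof. den_solve @or_. Qed.
#[local] Hint Resolve den_or : den.
Lemma den_imp : den2 (@imp_).
Proof. den_solve @imp_. Qed.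
#[local] Hint Resolve den_imp : den.
Lemma den_plus : den2 (@plus_).
Proof. den_solve @plus_. Qed.
#[local] Hint Resolve den_plus : den.
Lemma den_twice : den1 (@twice_).
Proof. den_solve @twice_. Qed.
#[local] Hint Resolve den_twice : den.
Lemma den_mul : den2 (@mul_).
Proof. den_solve @mul_. Qed.
#[local] Hint Resolve den_mul : den.
Lemma den_ex : den_bind (@ex_).
Proof. den_solve @ex_. Qed.
#[local] Hint Resolve den_ex : den.
Lemma den_all : den_bind (@all_).
Proof. den_solve @all_. Qed.
#[local] Hint Resolve den_all : den.
Lemma den_lt : den2 (@lt_).
Proof. den_solve @lt_. Qed.
#[local] Hint Resolve den_lt : den.
Lemma den_mu : den_bind (@mu_).
Proof. den_solve @mu_. Qed.
#[local] Hint Resolve den_mu : den.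
Lemma den_iter a1 f2 a3 v1 g2 v3 G :
  den a1 G v1 -> denf f2 G g2 -> den a3 G v3 -> den (iter_ a1 f2 a3) G (iter_ v1 g2 v3).
Proof. den_solve @iter_. Qed.
#[local] Hint Resolve den_iter : den.
Lemma den_differ : den1 (@differ_).
Proof. den_solve @differ_. Qed.
#[local] Hint Resolve den_differ : den.
Lemma den_xlen : den0 (@xlen_).
Proof. den_solve @xlen_. Qed.
#[local] Hint Resolve den_xlen : den.
Lemma den_yoff : den0 (@yoff_).
Proof. den_solve @yoff_. Qed.
#[local] Hint Resolve den_yoff : den.
Lemma den_ylen : den0 (@ylen_).
Proof. den_solve @ylen_. Qed.
#[local] Hint Resolve den_ylen : den.
Lemma den_zoff : den0 (@zoff_).
Proof. den_solve @zoff_. Qed.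
#[local] Hint Resolve den_zoff : den.
Lemma den_xb : den1 (@xb_).
Proof. den_solve @xb_. Qed.
#[local] Hint Resolve den_xb : den.
Lemma den_yb : den1 (@yb_).
Proof. den_solve @yb_. Qed.
#[local] Hint Resolve den_yb : den.
Lemma den_zb : den1 (@zb_).
Proof. den_solve @zb_. Qed.
#[local] Hint Resolve den_zb : den.
Lemma den_zeros f1 a2 g1 v2 G :
  denf f1 G g1 -> den a2 G v2 -> den (zeros_ f1 a2) G (zeros_ g1 v2).
Proof. den_solve @zeros_. Qed.
#[local] Hint Resolve den_zeros : den.
Lemma den_get f1 a2 g1 v2 G :
  denf f1 G g1 -> den a2 G v2 -> den (get_ f1 a2) G (get_ g1 v2).
Proof. den_solve @get_. Qed.
#[local] Hint Resolve den_get : den.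
Lemma den_Y : den2 (@Y_).
Proof. den_solve @Y_. Qed.
#[local] Hint Resolve den_Y : den.
Lemma den_Z : den2 (@Z_).
Proof. den_solve @Z_. Qed.
#[local] Hint Resolve den_Z : den.
Lemma den_pairs : den1 (@pairs_).
Proof. den_solve @pairs_. Qed.
#[local] Hint Resolve den_pairs : den.
Lemma den_next : den1 (@next_).
Proof. den_solve @next_. Qed.
#[local] Hint Resolve den_next : den.
Lemma den_pow : den1 (@pow_).
Proof. den_solve @pow_. Qed.
#[local] Hint Resolve den_pow : den.
Lemma den_val : den1 (@val_).
Proof. den_solve @val_. Qed.
#[local] Hint Resolve den_val : den.
Lemma den_oknat : den1 (@oknat_).
Proof. den_solve @oknat_. Qed.
#[local] Hint Resolve den_oknat : den.
Lemma den_eqname : den2 (@eqname_).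
Proof. den_solve @eqname_. Qed.
#[local] Hint Resolve den_eqname : den.
Lemma den_rep : den1 (@rep_).
Proof. den_solve @rep_. Qed.
#[local] Hint Resolve den_rep : den.
Lemma den_arity : den1 (@arity_).
Proof. den_solve @arity_. Qed.
#[local] Hint Resolve den_arity : den.
Lemma den_arg : den2 (@arg_).
Proof. den_solve @arg_. Qed.
#[local] Hint Resolve den_arg : den.
Lemma den_atom_end : den1 (@atom_end_).
Proof. den_solve @atom_end_. Qed.
#[local] Hint Resolve den_atom_end : den.
Lemma den_atom : den2 (@atom_).
Proof. den_solve @atom_. Qed.
#[local] Hint Resolve den_atom : den.
Lemma den_head : den1 (@head_).
Proof. den_solve @head_. Qed.
#[local] Hint Resolve den_head : den.
Lemma den_tgd_end : den1 (@tgd_end_).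
Proof. den_solve @tgd_end_. Qed.
#[local] Hint Resolve den_tgd_end : den.
Lemma den_tgd : den1 (@tgd_).
Proof. den_solve @tgd_. Qed.
#[local] Hint Resolve den_tgd : den.
Lemma den_ntgds : den0 (@ntgds_).
Proof. den_solve @ntgds_. Qed.
#[local] Hint Resolve den_ntgds : den.
Lemma den_exL : den_bind (@exL_).
Proof. den_solve @exL_. Qed.
#[local] Hint Resolve den_exL : den.
Lemma den_allL : den_bind (@allL_).
Proof. den_solve @allL_. Qed.
#[local] Hint Resolve den_allL : den.
Lemma den_inL : den2 (@inL_).
Proof. den_solve @inL_. Qed.
#[local] Hint Resolve den_inL : den.
Lemma den_okatom : den1 (@okatom_).
Proof. den_solve @okatom_. Qed.
#[local] Hint Resolve den_okatom : den.
Lemma den_oklist : den1 (@oklist_).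
Proof. den_solve @oklist_. Qed.
#[local] Hint Resolve den_oklist : den.
Lemma den_oktgd : den1 (@oktgd_).
Proof. den_solve @oktgd_. Qed.
#[local] Hint Resolve den_oktgd : den.
Lemma den_okx : den0 (@okx_).
Proof. den_solve @okx_. Qed.
#[local] Hint Resolve den_okx : den.
Lemma den_allA : den_bind (@allA_).
Proof. den_solve @allA_. Qed.
#[local] Hint Resolve den_allA : den.
Lemma den_wfx : den0 (@wfx_).
Proof. den_solve @wfx_. Qed.
#[local] Hint Resolve den_wfx : den.
Lemma den_m : den0 (@m_).
Proof. den_solve @m_. Qed.
#[local] Hint Resolve den_m : den.
Lemma den_tau : den1 (@tau_).
Proof. den_solve @tau_. Qed.
#[local] Hint Resolve den_tau : den.
Lemma den_succ_cyc : den1 (@succ_cyc_).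
Proof. den_solve @succ_cyc_. Qed.
#[local] Hint Resolve den_succ_cyc : den.
Lemma den_code1 : den2 (@code1_).
Proof. den_solve @code1_. Qed.
#[local] Hint Resolve den_code1 : den.
Lemma den_code2 : den2 (@code2_).
Proof. den_solve @code2_. Qed.
#[local] Hint Resolve den_code2 : den.
Lemma den_codeg : den2 (@codeg_).
Proof. den_solve @codeg_. Qed.
#[local] Hint Resolve den_codeg : den.
Lemma den_eqfact f1 f2 a3 a4 g1 g2 v3 v4 G :
  denf f1 G g1 -> denf f2 G g2 -> den a3 G v3 -> den a4 G v4 -> den (eqfact_ f1 f2 a3 a4) G (eqfact_ g1 g2 v3 v4).
Proof. den_solve @eqfact_. Qed.
#[local] Hint Resolve den_eqfact : den.
Lemma den_edgeok : den1 (@edgeok_).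
Proof. den_solve @edgeok_. Qed.
#[local] Hint Resolve den_edgeok : den.
Lemma den_eqtgd : den2 (@eqtgd_).
Proof. den_solve @eqtgd_. Qed.
#[local] Hint Resolve den_eqtgd : den.
Lemma den_tau0 : den0 (@tau0_).
Proof. den_solve @tau0_. Qed.
#[local] Hint Resolve den_tau0 : den.
Lemma den_batom : den0 (@batom_).
Proof. den_solve @batom_. Qed.
#[local] Hint Resolve den_batom : den.
Lemma den_bpos : den0 (@bpos_).
Proof. den_solve @bpos_. Qed.
#[local] Hint Resolve den_bpos : den.
Lemma den_hatom : den0 (@hatom_).
Proof. den_solve @hatom_. Qed.
#[local] Hint Resolve den_hatom : den.
Lemma den_hpos : den0 (@hpos_).
Proof. den_solve @hpos_. Qed.
#[local] Hint Resolve den_hpos : den.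
Lemma den_exedge : den0 (@exedge_).
Proof. den_solve @exedge_. Qed.
#[local] Hint Resolve den_exedge : den.
Lemma den_distinct : den0 (@distinct_).
Proof. den_solve @distinct_. Qed.
#[local] Hint Resolve den_distinct : den.
Lemma den_ycond : den0 (@ycond_).
Proof. den_solve @ycond_. Qed.
#[local] Hint Resolve den_ycond : den.
Lemma den_zhom : den0 (@zhom_).
Proof. den_solve @zhom_. Qed.
#[local] Hint Resolve den_zhom : den.
Lemma den_inS : den2 (@inS_).
Proof. den_solve @inS_. Qed.
#[local] Hint Resolve den_inS : den.
Lemma den_zset : den0 (@zset_).
Proof. den_solve @zset_. Qed.
#[local] Hint Resolve den_zset : den.
Lemma den_verifier : den0 (@verifier_).
Proof. den_solve @verifier_. Qed.
#[local] Hint Resolve den_verifier : den.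

End Adequacy.

Definition accepted (w : list bool) : Prop := @verifier_ (nat_lang w) <> 0.

(** At depth 0 the expression obtained from [verifier_] has the value of the numeric program, so the
    machine for the former decides the latter. *)
Theorem accepted_in_P : in_P accepted.
Proof.
  destruct (exp_in_P (@verifier_ exp_lang 0)) as (M & c & k & HM).
  exists M, c, k. intros w. specialize (HM w). cbv zeta in *.
  pose proof (den_verifier w (0, fun _ => 0) (0, fun _ => 0) (ctx_le_refl _)) as E.
  unfold accepted. rewrite <- E. exact HM.
Qed.

(** * Numeric meaning of programs *)

(* Programs represent truth values by numbers. *)
Definition T (v : nat) : Prop := v <> 0.

Fixpoint zero_count (l : list bool) : nat :=
  match l with [] => 0 | b :: l => (if b then 0 else 1) + zero_count l end.

Fixpoint array (l : list bool) (i : nat) : nat :=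
  match l with
  | [] => 0
  | true :: l => (if i =? 0 then 1 else 0) + array l i
  | false :: l => match i with 0 => 0 | S i => array l i end
  end.

Lemma zero_count_app l l' : zero_count (l ++ l') = zero_count l + zero_count l'.
Proof. induction l as [|[] l IH]; cbn; lia. Qed.

Lemma zero_count_le l : zero_count l <= length l.
Proof. induction l as [|[] l IH]; cbn; lia. Qed.

(** Programs scan a word from left to right, whereas [array] recurses from its head; this equation
    aligns the two. *)
Lemma array_snoc l b i :
  array (l ++ [b]) i = array l i + (if b && (zero_count l =? i) then 1 else 0).
Proof.
  revert i. induction l as [|[] l IH]; intros i; cbn [app array zero_count].
  - destruct b; cbn; [|now destruct i]. now destruct i.
  - rewrite IH. cbn. lia.
  - destruct i; [cbn; now rewrite andb_false_r|]. rewrite IH. reflexivity.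
Qed.

Lemma array_le l i : array l i <= length l.
Proof.
  revert i. induction l as [|[] l IH]; intros i; cbn; [lia| |].
  - specialize (IH i). destruct (i =? 0); lia.
  - destruct i; [lia|]. specialize (IH i). lia.
Qed.

Lemma array_large l i : length l <= i -> array l i = 0.
Proof.
  revert i. induction l as [|[] l IH]; intros i Hi; cbn in *; [reflexivity| |].
  - destruct i; [lia|]. cbn. apply IH. lia.
  - destruct i; [lia|]. apply IH. lia.
Qed.

Lemma firstn_snoc (l : list bool) p :
  p < length l -> firstn (S p) l = firstn p l ++ [nth p l false].
Proof.
  revert p. induction l as [|a l IH]; intros p Hp; cbn in *; [lia|].
  destruct p; [reflexivity|]. cbn. f_equal. apply IH. lia.
Qed.

Section Semantics.

Variable w : list bool.
Let n := length w.
Hypothesis Hn : 1 <= n.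
#[local] Instance NL : Lang := nat_lang w.

(** Equality up to the cap. Saturated operations respect it and agree with the true ones modulo it,
    so intermediate results may overflow; equality is recovered once both sides are known to be at
    most [n]. *)
Definition cong (u v : nat) : Prop := Nat.min n u = Nat.min n v.

Lemma cong_refl u : cong u u.
Proof. reflexivity. Qed.

Lemma cong_le u v : cong u v -> u <= n -> v <= n -> u = v.
Proof. unfold cong. lia. Qed.

Lemma succ_cong (u v : nat) : cong u v -> cong (succ u) (S v).
Proof. unfold cong. cbn. fold n. lia. Qed.

Lemma plus_cong (a b u v : nat) : cong a u -> cong b v -> cong (plus_ a b) (u + v).
Proof.
  intros Ha Hb. assert (H : forall b, cong (plus_ a b) (a + b)).
  { clear. intros b. unfold plus_. cbn. fold n. induction b as [|b IH].
    - rewrite Nat.add_0_r. reflexivity.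
    - unfold cong in *. cbn [natrec nat_rect] in *. unfold natrec in IH. lia. }
  specialize (H b). unfold cong in *. lia.
Qed.

Lemma plus_le (a b : nat) : a <= n -> plus_ a b <= n.
Proof.
  intros Ha. unfold plus_. cbn. fold n. destruct b; cbn; [exact Ha|lia].
Qed.

Lemma plus_exact (a b : nat) : a + b <= n -> plus_ a b = a + b.
Proof.
  intros H. apply cong_le; [apply plus_cong; apply cong_refl|apply plus_le; lia|exact H].
Qed.

Lemma twice_cong (a u : nat) : cong a u -> cong (twice_ a) (2 * u).
Proof.
  intros H. replace (2 * u) with (u + u) by lia. now apply plus_cong.
Qed.

Lemma twice_exact (a : nat) : 2 * a <= n -> twice_ a = 2 * a.
Proof. intros H. unfold twice_. rewrite plus_exact by lia. lia. Qed.

Lemma succ_exact (a : nat) : a < n -> succ a = S a.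
Proof. cbn. fold n. lia. Qed.

(** If one factor reaches the cap, so does the product, unless the other factor is 0; and a number
    congruent to 0 is 0, because [n] is positive. *)
Lemma mul_cong (a b u v : nat) : cong a u -> cong b v -> cong (mul_ a b) (u * v).
Proof.
  intros Ha Hb. assert (H : forall a, cong (mul_ a b) (a * b)).
  { intros c. unfold mul_. induction c as [|c IH]; [reflexivity|].
    change (cong (plus_ (mul_ c b) b) (b + c * b)).
    replace (b + c * b) with (c * b + b) by lia. apply plus_cong; [exact IH|reflexivity]. }
  unfold cong in *. rewrite H.
  destruct (le_lt_dec n a), (le_lt_dec n b); try (replace u with a by lia); try (replace v with b by lia); try reflexivity.
  - destruct v; nia.
  - destruct b; [replace v with 0 by lia; lia|]. rewrite !Nat.min_l; nia.
  - destruct a; [replace u with 0 by lia; lia|]. rewrite !Nat.min_l; nia.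
Qed.

Lemma lit_cong k : cong (lit_ k) k.
Proof. induction k; [reflexivity|]. cbn [lit_]. now apply succ_cong. Qed.

Lemma tt_eq : @eq nat tt_ 1.
Proof. unfold tt_. cbn. fold n. lia. Qed.

Lemma T_tt : T tt_.
Proof. unfold T. rewrite tt_eq. lia. Qed.

Lemma T_eqb (a b : nat) : T (eqb_ a b) <-> a = b.
Proof.
  unfold eqb_, T. rewrite tt_eq. cbn [ife NL nat_lang zero].
  destruct (Nat.eqb_spec a b); lia.
Qed.

Lemma T_neg (a : nat) : T (neg_ a) <-> ~ T a.
Proof.
  unfold neg_, T. rewrite tt_eq. cbn [ife NL nat_lang zero].
  destruct (Nat.eqb_spec a 0); lia.
Qed.

Lemma T_and (a b : nat) : T (and_ a b) <-> T a /\ T b.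
Proof.
  unfold and_, T. cbn [ife NL nat_lang zero]. destruct (Nat.eqb_spec a 0); lia.
Qed.

Lemma T_or (a b : nat) : T (or_ a b) <-> T a \/ T b.
Proof.
  unfold or_, T. rewrite tt_eq. cbn [ife NL nat_lang zero].
  destruct (Nat.eqb_spec a 0); lia.
Qed.

Lemma T_dec (a : nat) : T a \/ ~ T a.
Proof. unfold T. lia. Qed.

Lemma T_imp (a b : nat) : T (imp_ a b) <-> (T a -> T b).
Proof. unfold imp_. rewrite T_or, T_neg. destruct (T_dec a); tauto. Qed.

Lemma T_ex (c : nat) (f : nat -> nat) : T (ex_ c f) <-> exists i, i < c /\ T (f i).
Proof.
  unfold ex_. induction c as [|c IH].
  - cbn. unfold T. split; [lia|]. intros (i & Hi & _). lia.
  - change (T (or_ (rec c zero (fun i acc => or_ acc (f i)) : nat) (f c))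
      <-> exists i, i < S c /\ T (f i)).
    rewrite T_or, IH. split.
    + intros [(i & Hi & H)|H]; [exists i|exists c]; split; auto; lia.
    + intros (i & Hi & H). destruct (Nat.eq_dec i c) as [->|]; [now right|].
      left. exists i. split; auto; lia.
Qed.

Lemma T_all (c : nat) (f : nat -> nat) : T (all_ c f) <-> forall i, i < c -> T (f i).
Proof.
  unfold all_. induction c as [|c IH].
  - cbn [rec NL nat_lang natrec nat_rect]. split; [lia|intros; apply T_tt].
  - change (T (and_ (rec c tt_ (fun i acc => and_ acc (f i)) : nat) (f c))
      <-> forall i, i < S c -> T (f i)).
    rewrite T_and, IH. split.
    + intros [H1 H2] i Hi. destruct (Nat.eq_dec i c) as [->|]; [auto|]. apply H1. lia.
    + intros H. split; [intros i Hi|]; apply H; lia.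
Qed.

Lemma T_lt (a b : nat) : T (lt_ a b) <-> a < b.
Proof.
  unfold lt_. rewrite T_ex. split.
  - intros (i & Hi & H). apply T_eqb in H. lia.
  - intros H. exists a. split; [exact H|]. now apply T_eqb.
Qed.

(** The accumulator [c] doubles as the mark that nothing has been found so far, which is unambiguous
    because indices that are found lie below [c]. *)
Lemma mu_spec (c : nat) (f : nat -> nat) :
  mu_ c f <= c /\ (forall i, i < mu_ c f -> ~ T (f i)) /\ (mu_ c f < c -> T (f (mu_ c f))).
Proof.
  pose (F := fun i acc => if acc =? c then if f i =? 0 then acc else i else acc).
  change (@mu_ NL c f) with (natrec c c F).
  assert (H : forall k, k <= c ->
    (natrec k c F = c /\ forall i, i < k -> ~ T (f i)) \/
    (natrec k c F < k /\ (forall i, i < natrec k c F -> ~ T (f i)) /\ T (f (natrec k c F)))).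
  { induction k as [|k IH]; intros Hk.
    - left. split; [reflexivity|lia].
    - change (natrec (S k) c F) with (F k (natrec k c F)).
      destruct (IH ltac:(lia)) as [[E Hlt]|(Hr & Hlt & Ht)].
      + rewrite E. unfold F. rewrite Nat.eqb_refl.
        destruct (Nat.eqb_spec (f k) 0) as [E0|E0].
        * left. split; [reflexivity|]. intros i Hi. destruct (Nat.eq_dec i k) as [->|].
          -- unfold T. lia.
          -- apply Hlt. lia.
        * right. split; [lia|]. split; [exact Hlt|exact E0].
      + right. replace (F k (natrec k c F)) with (natrec k c F).
        * split; [lia|]. split; [exact Hlt|exact Ht].
        * unfold F at 2. destruct (Nat.eqb_spec (natrec k c F) c); [lia|reflexivity]. }
  destruct (H c (le_n _)) as [[E Hlt]|(Hr & Hlt & Ht)].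
  - rewrite E. split; [lia|]. split; [exact Hlt|lia].
  - split; [lia|]. split; [exact Hlt|]. intros _. exact Ht.
Qed.

Lemma mu_unique (c : nat) (f : nat -> nat) v :
  v <= c -> (forall i, i < v -> ~ T (f i)) -> (v < c -> T (f v)) -> mu_ c f = v.
Proof.
  intros Hv Hlt Ht. destruct (mu_spec c f) as (H1 & H2 & H3).
  destruct (lt_eq_lt_dec (@mu_ NL c f) v) as [[H|H]|H]; [|exact H|].
  - exfalso. apply (Hlt _ H). apply H3. lia.
  - exfalso. apply (H2 _ H). apply Ht. lia.
Qed.

Lemma iter_eq (c : nat) (f : nat -> nat) (p : nat) : iter_ c f p = Nat.iter c f p.
Proof. unfold iter_. induction c; [reflexivity|]. cbn in *. unfold natrec in *. now rewrite IHc. Qed.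

Lemma bit_cong (u v : nat) : cong u v -> bit u = Nat.b2n (nth v w false).
Proof.
  intros H. cbn. f_equal. unfold cong in H.
  destruct (le_lt_dec n u).
  - rewrite !nth_overflow; [reflexivity|fold n; lia|exact l].
  - f_equal. lia.
Qed.

Lemma array_cong l i j : length l <= n -> cong i j -> array l i = array l j.
Proof.
  intros Hl H. unfold cong in H. destruct (le_lt_dec n i).
  - rewrite !array_large by lia. reflexivity.
  - f_equal. lia.
Qed.

Lemma zeros_eq (b : nat -> nat) l :
  length l <= n -> (forall q, b q = Nat.b2n (nth q l false)) ->
  forall p, p <= length l -> zeros_ b p = zero_count (firstn p l).
Proof.
  intros Hl Hb. induction p as [|p IH]; intros Hp; [reflexivity|].
  change (@zeros_ NL b (S p)) with (if b p =? 0 then Nat.min n (S (@zeros_ NL b p)) else @zeros_ NL b p).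
  rewrite firstn_snoc, zero_count_app, IH by lia.
  pose proof (zero_count_le (firstn p l)) as Hz. rewrite length_firstn in Hz.
  rewrite Hb. destruct (nth p l false); cbn; [lia|].
  fold n. lia.
Qed.

Lemma get_eq (b : nat -> nat) l (i j : nat) :
  length l <= n -> (forall q, b q = Nat.b2n (nth q l false)) -> cong i j ->
  get_ b i = array l j.
Proof.
  intros Hl Hb Hij. rewrite <- (array_cong l i j Hl Hij).
  pose (F := fun p a : nat =>
    if @and_ NL (b p) (@eqb_ NL (@zeros_ NL b p) i) =? 0 then a else Nat.min n (S a)).
  change (@get_ NL b i) with (natrec n 0 F).
  assert (H : forall p, natrec p 0 F = array (firstn p l) i).
  { induction p as [|p IH]; [reflexivity|].
    change (natrec (S p) 0 F) with (F p (natrec p 0 F)). rewrite IH. unfold F.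
    set (X := @and_ NL (b p) (@eqb_ NL (@zeros_ NL b p) i)).
    assert (Ht : T X <-> T (Nat.b2n (nth p l false)) /\ @zeros_ NL b p = i).
    { unfold X. rewrite T_and, T_eqb, Hb. reflexivity. }
    clearbody X.
    (* Beyond [l] only zeros are read, so no further ones are counted. *)
    destruct (le_lt_dec (length l) p) as [Hp|Hp].
    - rewrite !firstn_all2 by lia. unfold T in Ht. rewrite (nth_overflow l) in Ht by lia.
      destruct (Nat.eqb_spec X 0) as [E|E]; [reflexivity|].
      apply Ht in E. cbn in E. lia.
    - rewrite firstn_snoc, array_snoc by lia.
      rewrite (zeros_eq b l) in Ht by (auto; lia).
      pose proof (array_le (firstn p l) i) as Ha. rewrite length_firstn in Ha.
      destruct (Nat.eqb_spec X 0) as [E|E].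
      + assert (N : ~ (T (Nat.b2n (nth p l false)) /\ zero_count (firstn p l) = i)).
        { rewrite <- Ht. unfold T. intros N. now apply N. }
        destruct (nth p l false); cbn [andb]; [|lia].
        destruct (Nat.eqb_spec (zero_count (firstn p l)) i); [|lia].
        exfalso. apply N. split; [cbn; unfold T; lia|assumption].
      + apply Ht in E. destruct (nth p l false); [|now destruct E].
        destruct E as [_ ->]. rewrite Nat.eqb_refl. cbn [andb]. lia. }
  rewrite H, firstn_all2 by lia. reflexivity.
Qed.

End Semantics.

(** * Reading the components of a triple *)

Lemma dbl_length l : length (dbl l) = 2 * length l.
Proof. unfold dbl. induction l; cbn in *; lia. Qed.

Lemma dbl_nth_even l : forall i, nth (2 * i) (dbl l) false = nth i l false.
Proof.
  induction l as [|b l IH]; intros i; [now destruct i, (2 * _)|].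
  destruct i; [reflexivity|]. replace (2 * S i) with (S (S (2 * i))) by lia. apply IH.
Qed.

Lemma dbl_nth_odd l : forall i, nth (S (2 * i)) (dbl l) false = nth i l false.
Proof.
  induction l as [|b l IH]; intros i; [now destruct i, (2 * _)|].
  destruct i; [reflexivity|]. replace (S (2 * S i)) with (S (S (S (2 * i)))) by lia. apply IH.
Qed.

Lemma nth_app_skip {A : Type} (l r : list A) k d : nth (length l + k) (l ++ r) d = nth k r d.
Proof. rewrite app_nth2 by lia. f_equal. lia. Qed.

Definition bit_of (x : list bool) (i : nat) : bool := nth i x false.

Section Triple.

Variables x y z : list bool.
Let w := enc_triple x y z.
Let s := length x.
Let t := length y.
Let n := length w.

Notation L := (NL w).

Lemma triple_length : n = 2 * s + 2 + (2 * t + 2) + 2 * length z.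
Proof.
  unfold n, w, enc_triple. repeat rewrite length_app. rewrite !dbl_length. cbn [length sep].
  unfold s, t. lia.
Qed.

Lemma triple_pos : 1 <= n.
Proof. rewrite triple_length. lia. Qed.

Lemma triple_x i : i < s -> nth (2 * i) w false = nth i x false /\
  nth (S (2 * i)) w false = nth i x false.
Proof.
  intros Hi. unfold w, enc_triple. fold s in Hi.
  rewrite !app_nth1 by (rewrite dbl_length; unfold s in Hi; lia).
  now rewrite dbl_nth_even, dbl_nth_odd.
Qed.

Lemma triple_sep1 : nth (2 * s) w false = false /\ nth (S (2 * s)) w false = true.
Proof.
  unfold w, enc_triple, s. rewrite <- dbl_length.
  rewrite <- (Nat.add_0_r (length (dbl x))) at 1. rewrite nth_app_skip.
  rewrite <- Nat.add_1_r, nth_app_skip. split; reflexivity.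
Qed.

Lemma triple_tail k : nth (2 * s + 2 + k) w false = nth k (dbl y ++ sep ++ dbl z) false.
Proof.
  unfold w, enc_triple, s. rewrite <- dbl_length, <- Nat.add_assoc, nth_app_skip.
  reflexivity.
Qed.

Lemma triple_y j : j < t -> nth (2 * s + 2 + 2 * j) w false = nth j y false /\
  nth (S (2 * s + 2 + 2 * j)) w false = nth j y false.
Proof.
  intros Hj. rewrite <- Nat.add_succ_r, !triple_tail. unfold t in Hj.
  rewrite !app_nth1 by (rewrite dbl_length; lia).
  now rewrite dbl_nth_even, dbl_nth_odd.
Qed.

Lemma triple_sep2 :
  nth (2 * s + 2 + 2 * t) w false = false /\ nth (S (2 * s + 2 + 2 * t)) w false = true.
Proof.
  rewrite <- Nat.add_succ_r, !triple_tail. unfold t. rewrite <- dbl_length.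
  rewrite <- (Nat.add_0_r (length (dbl y))) at 1. rewrite nth_app_skip.
  rewrite <- Nat.add_1_r, nth_app_skip. split; reflexivity.
Qed.

Lemma triple_z j : nth (2 * s + 2 + 2 * t + 2 + 2 * j) w false = nth j z false.
Proof.
  rewrite <- !Nat.add_assoc, (Nat.add_assoc (2 * s) 2), triple_tail. unfold t.
  rewrite <- dbl_length, nth_app_skip. cbn [Nat.add]. apply dbl_nth_even.
Qed.

Lemma T_differ p : p < n -> (T (@differ_ L p) <-> nth p w false <> nth (S p) w false).
Proof.
  intros Hp. unfold differ_. rewrite (T_neg w triple_pos), (T_eqb w triple_pos).
  rewrite (succ_exact w triple_pos) by exact Hp. cbn [bit NL nat_lang].
  destruct (nth p w false), (nth (S p) w false); cbn; split; intros H; try discriminate; auto;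
    contradict H; reflexivity.
Qed.

Lemma xlen_eq : @xlen_ L = s.
Proof.
  pose proof triple_length as Hl. unfold xlen_. cbn [len NL nat_lang]. fold n.
  apply (mu_unique w triple_pos).
  - lia.
  - intros i Hi. rewrite (twice_exact w triple_pos) by (fold n; lia). rewrite T_differ by lia.
    destruct (triple_x i Hi) as [-> ->]. intros H. now apply H.
  - intros _. rewrite (twice_exact w triple_pos) by (fold n; lia). rewrite T_differ by lia.
    destruct triple_sep1 as [-> ->]. discriminate.
Qed.

Lemma yoff_eq : @yoff_ L = 2 * s + 2.
Proof.
  pose proof triple_length as Hl. unfold yoff_. rewrite xlen_eq.
  rewrite (twice_exact w triple_pos), !(succ_exact w triple_pos); rewrite ?(succ_exact w triple_pos); fold n; lia.
Qed.

Lemma ylen_eq : @ylen_ L = t.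
Proof.
  pose proof triple_length as Hl. unfold ylen_. cbn [len NL nat_lang]. fold n.
  apply (mu_unique w triple_pos).
  - lia.
  - intros j Hj. rewrite yoff_eq, (twice_exact w triple_pos), (plus_exact w triple_pos) by (fold n; lia).
    rewrite T_differ by lia. destruct (triple_y j Hj) as [-> ->]. intros H. now apply H.
  - intros _. rewrite yoff_eq, (twice_exact w triple_pos), (plus_exact w triple_pos) by (fold n; lia).
    rewrite T_differ by lia. destruct triple_sep2 as [-> ->]. discriminate.
Qed.

Lemma zoff_eq : @zoff_ L = 2 * s + 2 + 2 * t + 2.
Proof.
  pose proof triple_length as Hl. unfold zoff_. rewrite yoff_eq, ylen_eq.
  rewrite (twice_exact w triple_pos), (plus_exact w triple_pos), !(succ_exact w triple_pos); rewrite ?(succ_exact w triple_pos); fold n; lia.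
Qed.

Lemma and_lt_bit (i c v : nat) (b : bool) :
  (i < c -> @bit L v = Nat.b2n b) -> (c <= i -> b = false) ->
  @and_ L (@lt_ L i c) (@bit L v) = Nat.b2n b.
Proof.
  intros H1 H2. unfold and_. pose proof (T_lt w triple_pos i c) as Ht. unfold T in Ht.
  cbn [ife zero NL nat_lang] in *. destruct (Nat.eqb_spec (@lt_ L i c) 0) as [E|E].
  - rewrite H2; [reflexivity|]. change (@lt_ (NL w) i c) with (@lt_ L i c) in Ht. lia.
  - apply H1. now apply Ht.
Qed.

Lemma xb_eq (i j : nat) : cong w i j -> @xb_ L i = Nat.b2n (bit_of x j).
Proof.
  intros Hij. pose proof triple_length as Hl. unfold xb_, bit_of. rewrite xlen_eq.
  assert (E : nth i x false = nth j x false).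
  { unfold cong in Hij. fold n in Hij. destruct (le_lt_dec n i).
    - rewrite !nth_overflow; fold s; lia || reflexivity.
    - f_equal. lia. }
  rewrite <- E. apply and_lt_bit.
  - intros Hi. rewrite (twice_exact w triple_pos) by (fold n; lia). cbn [bit NL nat_lang].
    now rewrite (proj1 (triple_x i Hi)).
  - intros Hi. apply nth_overflow. exact Hi.
Qed.

Lemma yb_eq (i : nat) : @yb_ L i = Nat.b2n (nth i y false).
Proof.
  pose proof triple_length as Hl. unfold yb_. rewrite ylen_eq, yoff_eq. apply and_lt_bit.
  - intros Hi. rewrite (twice_exact w triple_pos), (plus_exact w triple_pos) by (fold n; lia). cbn [bit NL nat_lang].
    now rewrite (proj1 (triple_y i Hi)).
  - intros Hi. apply nth_overflow. exact Hi.
Qed.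

Lemma zb_eq (i : nat) : @zb_ L i = Nat.b2n (nth i z false).
Proof.
  unfold zb_. rewrite zoff_eq, <- (triple_z i). apply (bit_cong w triple_pos).
  apply (plus_cong w triple_pos); [reflexivity|]. apply (twice_cong w triple_pos). reflexivity.
Qed.

Lemma index_cong (i j u v : nat) :
  cong w i u -> cong w j v -> cong w (@plus_ L (@mul_ L i (@xlen_ L)) j) (u * s + v).
Proof.
  intros Hi Hj. apply (plus_cong w triple_pos); [|exact Hj]. apply (mul_cong w triple_pos); [exact Hi|].
  now rewrite xlen_eq.
Qed.

Definition y_entry (i j : nat) : nat := array y (i * s + j).
Definition z_entry (i j : nat) : nat := array z (i * s + j).

Lemma Y_eq (i j u v : nat) : cong w i u -> cong w j v -> @Y_ L i j = y_entry u v.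
Proof.
  intros Hi Hj. pose proof triple_length. apply (get_eq w triple_pos).
  - fold n t. lia.
  - apply yb_eq.
  - now apply index_cong.
Qed.

Lemma Z_eq (i j u v : nat) : cong w i u -> cong w j v -> @Z_ L i j = z_entry u v.
Proof.
  intros Hi Hj. pose proof triple_length. apply (get_eq w triple_pos).
  - fold n. lia.
  - apply zb_eq.
  - now apply index_cong.
Qed.

End Triple.

(** * Codes of numbers *)

Fixpoint bval (l : list bool) : nat :=
  match l with [] => 0 | b :: l => Nat.b2n b + 2 * bval l end.

Lemma bval_snoc l b : bval (l ++ [b]) = bval l + Nat.b2n b * 2 ^ length l.
Proof. induction l as [|c l IH]; cbn [app bval length]; [cbn; lia|]. rewrite IH. cbn. lia. Qed.

Lemma bin_aux_val f : forall m, m <= f -> bval (bin_aux f m) = m.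
Proof.
  induction f as [|f IH]; intros m Hm; cbn [bin_aux]; [cbn; lia|].
  destruct (Nat.eqb_spec m 0); [cbn; lia|]. cbn [bval].
  pose proof (Nat.div2_odd m). rewrite IH; lia.
Qed.

Lemma bval_bin m : bval (bin m) = m.
Proof. now apply bin_aux_val. Qed.

Lemma bin_inj m m' : bin m = bin m' -> m = m'.
Proof. intros H. now rewrite <- (bval_bin m), <- (bval_bin m'), H. Qed.

(** The default [true] puts the empty word for 0 and the words for positive numbers, whose top bit
    is 1, under one condition. By [bin_bval] this condition characterises the canonical binary
    words. *)
Lemma bin_aux_last f : forall m, m <= f -> last (bin_aux f m) true = true.
Proof.
  induction f as [|f IH]; intros m Hm; cbn [bin_aux]; [reflexivity|].
  destruct (Nat.eqb_spec m 0); [reflexivity|].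
  pose proof (Nat.div2_odd m) as Hd.
  specialize (IH (Nat.div2 m) ltac:(lia)).
  destruct (bin_aux f (Nat.div2 m)) eqn:E; [|exact IH].
  cbn. assert (H0 : Nat.div2 m = 0).
  { rewrite <- (bin_aux_val f (Nat.div2 m)) by lia. now rewrite E. }
  rewrite H0 in Hd. destruct (Nat.odd m); [reflexivity|cbn in Hd; lia].
Qed.

Lemma bval_pos l : l <> [] -> last l true = true -> 0 < bval l.
Proof.
  induction l as [|b l IH]; intros Hne Hl; [congruence|].
  destruct l as [|c l]; [cbn in Hl; subst; cbn; lia|].
  cbn [bval]. specialize (IH ltac:(discriminate) Hl). cbn [bval] in IH. lia.
Qed.

Lemma bin_bval l : last l true = true -> bin (bval l) = l.
Proof.
  unfold bin. assert (H : forall f l, last l true = true -> bval l <= f -> bin_aux f (bval l) = l).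
  { induction f as [|f IH]; intros k Hk Hf.
    - destruct k as [|b k]; [reflexivity|]. pose proof (bval_pos (b :: k) ltac:(discriminate) Hk). lia.
    - cbn [bin_aux]. destruct k as [|b k]; [reflexivity|].
      pose proof (bval_pos (b :: k) ltac:(discriminate) Hk) as Hp.
      destruct (Nat.eqb_spec (bval (b :: k)) 0); [lia|].
      pose proof (Nat.div2_odd (bval (b :: k))) as Hd.
      assert (Ho : Nat.odd (bval (b :: k)) = b).
      { cbn [bval]. rewrite Nat.odd_add, Nat.odd_mul. cbn [Nat.odd Nat.even negb andb]. now destruct b. }
      rewrite Ho in *. cbn [bval] in *.
      replace (Nat.div2 (Nat.b2n b + 2 * bval k)) with (bval k) by lia.
      f_equal. apply IH; [|destruct b; cbn in *; lia].
      destruct k; [reflexivity|exact Hk]. }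
  intros Hl. now apply H.
Qed.

(** * Occurrences of codes inside a word *)

Section At.

Variable x : list bool.

Definition At (p : nat) (u : list bool) : Prop :=
  p + length u <= length x /\ forall i, i < length u -> bit_of x (p + i) = nth i u false.

Lemma At_app p u v : At p (u ++ v) <-> At p u /\ At (p + length u) v.
Proof.
  unfold At. rewrite length_app. split.
  - intros [H1 H2]. split; split; try lia; intros i Hi.
    + rewrite H2 by lia. now rewrite app_nth1.
    + rewrite <- Nat.add_assoc, H2 by lia. apply nth_app_skip.
  - intros [[H1 H2] [H3 H4]]. split; [lia|]. intros i Hi.
    destruct (lt_dec i (length u)).
    + rewrite app_nth1 by lia. now apply H2.
    + rewrite app_nth2 by lia. rewrite <- H4 by lia. f_equal. lia.
Qed.

Lemma At_whole u : At 0 u -> length u = length x -> x = u.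
Proof.
  intros [_ H] Hl. apply (nth_ext _ _ false false); [easy|]. intros i Hi.
  rewrite <- H by lia. reflexivity.
Qed.

Lemma At_self : At 0 x.
Proof. split; [lia|]. reflexivity. Qed.

Lemma enc_nat_length m : length (enc_nat m) = 2 * length (bin m) + 2.
Proof. unfold enc_nat. rewrite length_app, dbl_length. reflexivity. Qed.

Lemma At_pairs p (bits : list bool) : At p (dbl bits ++ sep) <->
  let k := length bits in
  p + 2 * k + 2 <= length x /\
  (forall i, i < k -> bit_of x (p + 2 * i) = nth i bits false /\ bit_of x (p + 2 * i + 1) = nth i bits false) /\
  bit_of x (p + 2 * k) = false /\ bit_of x (p + 2 * k + 1) = true.
Proof.
  set (k := length bits). cbv zeta. rewrite At_app. unfold At. rewrite dbl_length. fold k. cbn [length sep]. split.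
  - intros [[H1 H2] [H3 H4]]. split; [lia|]. split; [|split].
    + intros i Hi. rewrite <- dbl_nth_even at 1. rewrite <- (dbl_nth_odd bits i) at 1.
      rewrite <- !H2 by lia. split; f_equal; lia.
    + specialize (H4 0 ltac:(lia)). rewrite Nat.add_0_r in H4. exact H4.
    + exact (H4 1 ltac:(lia)).
  - intros (H1 & H2 & H3 & H4). split; split; try lia.
    + intros i Hi. destruct (Nat.Even_or_Odd i) as [[j ->]|[j ->]].
      * rewrite dbl_nth_even. apply H2. lia.
      * replace (2 * j + 1) with (S (2 * j)) by lia. rewrite dbl_nth_odd.
        replace (p + S (2 * j)) with (p + 2 * j + 1) by lia. apply H2. lia.
    + intros i Hi. destruct i as [|[|i]]; [now rewrite Nat.add_0_r|exact H4|lia].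
Qed.

(** If the lengths differed, the separator of the shorter code would be a pair of the longer one,
    whose two bits agree. *)
Lemma At_nat_unique p m m' : At p (enc_nat m) -> At p (enc_nat m') -> m = m'.
Proof.
  unfold enc_nat. rewrite !At_pairs. cbv zeta. intros (H1 & H2 & H3 & H4) (H1' & H2' & H3' & H4').
  destruct (lt_eq_lt_dec (length (bin m)) (length (bin m'))) as [[H|H]|H].
  - destruct (H2' _ H). congruence.
  - apply bin_inj. apply (nth_ext _ _ false false); [exact H|]. intros i Hi.
    destruct (H2 i Hi) as [<- _]. destruct (H2' i ltac:(lia)) as [<- _]. reflexivity.
  - destruct (H2 _ H). congruence.
Qed.

Definition Atb (p : nat) (u : list bool) : bool :=
  (p + length u <=? length x) &&
  forallb (fun i => eqb (bit_of x (p + i)) (nth i u false)) (seq 0 (length u)).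

Lemma Atb_spec p u : Atb p u = true <-> At p u.
Proof.
  unfold Atb, At. rewrite andb_true_iff, Nat.leb_le, forallb_forall.
  split; intros [H1 H2]; (split; [exact H1|]); intros i Hi.
  - apply eqb_prop, H2, in_seq. lia.
  - apply in_seq in Hi. rewrite H2 by lia. apply eqb_reflx.
Qed.

Fixpoint first_true (f : nat -> bool) (c : nat) : nat :=
  match c with
  | 0 => 0
  | S c => if f 0 then 0 else S (first_true (fun i => f (S i)) c)
  end.

Lemma first_true_spec c : forall f,
  (forall i, i < first_true f c -> f i = false) /\
  (forall i, i < c -> f i = true -> first_true f c <= i /\ f (first_true f c) = true).
Proof.
  induction c as [|c IH]; intros f; cbn; [split; intros; lia|].
  destruct (f 0) eqn:E; [split; intros; [lia|split; [lia|exact E]]|].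
  destruct (IH (fun i => f (S i))) as [H1 H2]. split.
  - intros [|i] Hi; [exact E|]. apply H1. lia.
  - intros [|i] Hi Hf; [congruence|]. destruct (H2 i ltac:(lia) Hf). split; [lia|assumption].
Qed.

(* The least position at which the code of [m] occurs serves as an identifier
   of the name [m] that is bounded by the length of [x]. *)
Definition REP (m : nat) : nat := first_true (fun q => Atb q (enc_nat m)) (length x).

Lemma REP_spec p m : At p (enc_nat m) ->
  At (REP m) (enc_nat m) /\ REP m <= p /\ REP m < length x /\
  forall q, q < REP m -> ~ At q (enc_nat m).
Proof.
  intros H. pose proof (proj1 H) as Hl. rewrite enc_nat_length in Hl.
  destruct (first_true_spec (length x) (fun q => Atb q (enc_nat m))) as [H1 H2].
  fold (REP m) in H1, H2. apply Atb_spec in H. destruct (H2 p ltac:(lia) H) as [H3 H4].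
  split; [now apply Atb_spec|]. split; [exact H3|]. split; [lia|].
  intros q Hq Ha. apply Atb_spec in Ha. rewrite H1 in Ha; [discriminate|exact Hq].
Qed.

Lemma REP_inj p p' m m' :
  At p (enc_nat m) -> At p' (enc_nat m') -> REP m = REP m' -> m = m'.
Proof.
  intros H H' E. apply REP_spec in H, H'. rewrite E in H.
  apply (At_nat_unique (REP m')); tauto.
Qed.

(** [g] stands for a parser that skips one element. It has to be right only at positions where the
    code of an element of [l] really stands, so capped parsers qualify. *)
Lemma At_flat_map {A : Type} (f : A -> list bool) (g : nat -> nat) l : forall p,
  (forall q a, In a l -> At q (f a) -> g q = q + length (f a)) ->
  At p (flat_map f l) ->
  (forall j a, nth_error l j = Some a -> At (Nat.iter j g p) (f a)) /\
  Nat.iter (length l) g p = p + length (flat_map f l).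
Proof.
  induction l as [|a l IH]; intros p Hg H.
  - split; [intros [|j] a; discriminate|cbn; lia].
  - cbn [flat_map] in H. apply At_app in H. destruct H as [Ha Hl].
    assert (E : g p = p + length (f a)) by (apply Hg; [now left|exact Ha]).
    rewrite <- E in Hl. destruct (IH (g p)) as [H1 H2]; [intros; apply Hg; [now right|]; assumption|exact Hl|].
    split.
    + intros [|j] b Hj; cbn in Hj; [injection Hj as <-; exact Ha|].
      rewrite Nat.iter_succ_r. now apply H1.
    + cbn [length]. rewrite Nat.iter_succ_r, H2, E. cbn [flat_map]. rewrite length_app. lia.
Qed.

Lemma flat_map_length_ge {A : Type} (f : A -> list bool) l :
  (forall a, 1 <= length (f a)) -> length l <= length (flat_map f l).
Proof.
  intros Hf. induction l as [|a l IH]; cbn; [lia|]. rewrite length_app. specialize (Hf a). lia.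
Qed.

End At.

(** * Parsing sets of tgds *)

Lemma enc_nat_ge m : 1 <= length (enc_nat m).
Proof. rewrite enc_nat_length. lia. Qed.

Lemma enc_list_ge {A : Type} (f : A -> list bool) l : 1 <= length (enc_list f l).
Proof. unfold enc_list. rewrite length_app, enc_nat_length. lia. Qed.

Lemma enc_atom_ge a : 1 <= length (enc_atom a).
Proof. unfold enc_atom. rewrite length_app, enc_nat_length. lia. Qed.

Lemma enc_tgd_ge t : 1 <= length (enc_tgd t).
Proof. unfold enc_tgd. rewrite length_app. pose proof (enc_list_ge enc_atom (body t)). lia. Qed.

Lemma b2n_inj b c : Nat.b2n b = Nat.b2n c <-> b = c.
Proof. destruct b, c; cbn; split; congruence. Qed.

Lemma T_b2n b : T (Nat.b2n b) <-> b = true.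
Proof. unfold T. destruct b; cbn; split; congruence. Qed.

Section Parsing.

Variables x y z : list bool.
Let w := enc_triple x y z.
Let s := length x.
Let n := length w.
Let Hn : 1 <= n := triple_pos x y z.

Notation L := (NL w).
Notation At := (At x).
Notation X := (bit_of x).
Notation REP := (REP x).

(** The triple holds every bit of [x] twice and two separators besides. This slack keeps positions
    of [x], even doubled or slightly shifted, below the cap. *)
Lemma s_lt_n : 2 * s + 4 <= n.
Proof. unfold n, w, s. rewrite triple_length. lia. Qed.

Lemma xlen_s : @xlen_ L = s.
Proof. apply xlen_eq. Qed.

Lemma xb_plus (p i : nat) : @xb_ L (@plus_ L p i) = Nat.b2n (X (p + i)).
Proof. apply xb_eq. apply (plus_cong w Hn); reflexivity. Qed.

Lemma xb_pair (p k : nat) : @xb_ L (@plus_ L p (@twice_ L k)) = Nat.b2n (X (p + 2 * k)).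
Proof.
  apply xb_eq. apply (plus_cong w Hn); [reflexivity|]. apply (twice_cong w Hn). reflexivity.
Qed.

Lemma xb_pair_succ (p k : nat) :
  @xb_ L (@succ L (@plus_ L p (@twice_ L k))) = Nat.b2n (X (p + 2 * k + 1)).
Proof.
  apply xb_eq. rewrite Nat.add_1_r. apply (succ_cong w Hn).
  apply (plus_cong w Hn); [reflexivity|]. apply (twice_cong w Hn). reflexivity.
Qed.

Lemma X_true i : X i = true -> i < s.
Proof.
  intros H. destruct (lt_dec i s); [assumption|]. unfold bit_of in H.
  rewrite nth_overflow in H by (fold s; lia). discriminate.
Qed.

Lemma pairs_spec (p : nat) :
  @pairs_ L p <= s /\ (forall i, i < @pairs_ L p -> X (p + 2 * i) = X (p + 2 * i + 1)) /\
  (@pairs_ L p < s -> X (p + 2 * @pairs_ L p) <> X (p + 2 * @pairs_ L p + 1)).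
Proof.
  pose (f := fun k : nat => @neg_ L (@eqb_ L (@xb_ L (@plus_ L p (@twice_ L k)))
    (@xb_ L (@succ L (@plus_ L p (@twice_ L k)))))).
  assert (M : @pairs_ L p <= @xlen_ L /\ (forall i, i < @pairs_ L p -> ~ T (f i)) /\
    (@pairs_ L p < @xlen_ L -> T (f (@pairs_ L p)))) by exact (mu_spec w Hn (@xlen_ L) f).
  unfold f in M. destruct M as (H1 & H2 & H3). rewrite xlen_s in H1, H3. split; [exact H1|]. split.
  - intros i Hi. specialize (H2 i Hi). rewrite (T_neg w Hn), (T_eqb w Hn) in H2.
    rewrite xb_pair, xb_pair_succ, b2n_inj in H2.
    destruct (X (p + 2 * i)), (X (p + 2 * i + 1)); try reflexivity; exfalso; apply H2; discriminate.
  - intros Hlt. specialize (H3 Hlt). rewrite (T_neg w Hn), (T_eqb w Hn) in H3.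
    rewrite xb_pair, xb_pair_succ, b2n_inj in H3. exact H3.
Qed.

Lemma pairs_eq (p m : nat) : At p (enc_nat m) -> @pairs_ L p = length (bin m).
Proof.
  unfold enc_nat. rewrite At_pairs. cbv zeta. intros (H1 & H2 & H3 & H4). fold s in H1.
  destruct (pairs_spec p) as (P1 & P2 & P3).
  destruct (lt_eq_lt_dec (@pairs_ L p) (length (bin m))) as [[H|H]|H]; [|exact H|].
  - exfalso. apply P3; [lia|]. destruct (H2 _ H) as [-> ->]. reflexivity.
  - specialize (P2 _ H). congruence.
Qed.

Lemma next_eq (p m : nat) : At p (enc_nat m) -> @next_ L p = p + length (enc_nat m).
Proof.
  intros H. pose proof (pairs_eq p m H) as E. destruct H as [H _].
  rewrite enc_nat_length in *. fold s in H. pose proof s_lt_n. unfold next_. rewrite E.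
  rewrite (twice_exact w Hn), (plus_exact w Hn), !(succ_exact w Hn); rewrite ?(succ_exact w Hn); fold n; lia.
Qed.

Lemma pow_cong (i : nat) : cong w (@pow_ L i) (2 ^ i).
Proof.
  unfold pow_. induction i as [|i IH].
  - unfold cong. cbn. fold n. lia.
  - apply (twice_cong w Hn) in IH. exact IH.
Qed.

(** Powers of two may saturate on the way, but truncation is compatible with sums, so the outcome is
    the truncated number. *)
Lemma val_eq (p m : nat) : At p (enc_nat m) -> @val_ L p = Nat.min n m.
Proof.
  intros H. pose proof (pairs_eq p m H) as E. unfold enc_nat in H. rewrite At_pairs in H.
  cbv zeta in H. destruct H as (H1 & H2 & H3 & H4).
  pose (F := fun i a : nat => if @xb_ L (@plus_ L p (@twice_ L i)) =? 0 then a
             else @plus_ L a (@pow_ L i)).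
  change (@val_ L p) with (natrec (@pairs_ L p) 0 F). rewrite E.
  assert (G : forall i, i <= length (bin m) ->
    cong w (natrec i 0 F) (bval (firstn i (bin m))) /\ natrec i 0 F <= n).
  { induction i as [|i IH]; intros Hi; [split; [reflexivity|cbn; lia]|].
    destruct (IH ltac:(lia)) as [C1 C2].
    change (natrec (S i) 0 F) with (F i (natrec i 0 F)).
    rewrite firstn_snoc, bval_snoc, length_firstn by lia.
    replace (Nat.min i (length (bin m))) with i by lia.
    unfold F. rewrite xb_pair. destruct (H2 i ltac:(lia)) as [-> _].
    destruct (nth i (bin m) false); cbn [Nat.b2n Nat.eqb].
    - split; [|now apply (plus_le w Hn)].
      apply (plus_cong w Hn); [exact C1|]. rewrite Nat.mul_1_l. apply pow_cong.
    - rewrite Nat.mul_0_l, Nat.add_0_r. now split. }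
  destruct (G _ (le_n _)) as [C1 C2]. rewrite firstn_all, bval_bin in C1.
  unfold cong in C1. fold n in C1. lia.
Qed.

Lemma oknat_iff (p : nat) : T (@oknat_ L p) <-> exists m, At p (enc_nat m).
Proof.
  pose proof s_lt_n as Hs. unfold oknat_.
  rewrite !(T_and w Hn), (T_or w Hn), (T_lt w Hn), !(T_eqb w Hn), (T_ex w Hn), xlen_s, xb_pair.
  set (k := @pairs_ L p). change (@zero L) with 0. split.
  - intros (H1 & H2 & H3). destruct (pairs_spec p) as (P1 & P2 & P3). fold k in P1, P2, P3.
    (* The capped position lies below [s], hence below the cap, and so is the true position. *)
    assert (Hlt : p + 2 * k + 1 < s).
    { assert (C : cong w (@succ L (@plus_ L p (@twice_ L k))) (p + 2 * k + 1)).
      { rewrite Nat.add_1_r. apply (succ_cong w Hn), (plus_cong w Hn); [reflexivity|].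
        now apply (twice_cong w Hn). }
      unfold cong in C. fold n in C. lia. }
    specialize (P3 ltac:(lia)).
    assert (X0 : X (p + 2 * k) = false) by (destruct (X (p + 2 * k)); [discriminate H2|reflexivity]).
    assert (X1 : X (p + 2 * k + 1) = true) by (destruct (X (p + 2 * k + 1)); congruence).
    pose (bits := map (fun i => X (p + 2 * i)) (seq 0 k)).
    assert (Hk : length bits = k) by (unfold bits; rewrite length_map, length_seq; reflexivity).
    assert (Hb : forall i, i < k -> nth i bits false = X (p + 2 * i)).
    { intros i Hi. unfold bits.
      rewrite (nth_indep _ false (X (p + 2 * 0))) by (rewrite length_map, length_seq; exact Hi).
      rewrite (map_nth (fun i => X (p + 2 * i))). now rewrite seq_nth. }
    assert (Hlast : last bits true = true).
    { destruct H3 as [H3|(j & Hj & H3)].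
      - unfold bits. rewrite H3. reflexivity.
      - rewrite (T_and w Hn), (T_eqb w Hn), xb_pair, T_b2n in H3. destruct H3 as [H3 H4].
        rewrite (succ_exact w Hn) in H3 by (fold n; lia). unfold bits.
        rewrite <- H3, seq_S, map_app. cbn [map]. rewrite last_last. exact H4. }
    exists (bval bits). unfold enc_nat. rewrite bin_bval by exact Hlast.
    apply At_pairs. cbv zeta. rewrite Hk. fold s. split; [lia|]. split; [|now split].
    intros i Hi. rewrite Hb by exact Hi. split; [reflexivity|]. symmetry. now apply P2.
  - intros [m Hm]. unfold k. rewrite (pairs_eq p m Hm).
    pose proof (bin_aux_last m m (le_n _)) as Hlast. fold (bin m) in Hlast.
    unfold enc_nat in Hm. rewrite At_pairs in Hm. cbv zeta in Hm.
    destruct Hm as (H1 & H2 & H3 & H4). fold s in H1.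
    rewrite (twice_exact w Hn), (plus_exact w Hn), (succ_exact w Hn) by (fold n; lia).
    split; [lia|]. split; [now rewrite H3|].
    destruct (length (bin m)) as [|j] eqn:E; [now left|]. right. exists j. split; [lia|].
    rewrite (T_and w Hn), (T_eqb w Hn), xb_pair, T_b2n, (succ_exact w Hn) by (fold n; lia).
    split; [reflexivity|]. destruct (H2 j ltac:(lia)) as [-> _].
    destruct (bin m) as [|b l] using rev_ind; [discriminate E|].
    rewrite last_last in Hlast. rewrite length_app in E. cbn in E.
    rewrite app_nth2 by lia. replace (j - length l) with 0 by lia. exact Hlast.
Qed.

Lemma eqname_iff (p m q : nat) :
  At p (enc_nat m) -> (T (@eqname_ L p q) <-> At q (enc_nat m)).
Proof.
  intros Hp. pose proof (pairs_eq p m Hp) as E. pose proof s_lt_n as Hs.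
  assert (Hl : p + length (enc_nat m) <= s) by apply Hp. rewrite enc_nat_length in Hl.
  unfold eqname_. rewrite (T_and w Hn), (T_eqb w Hn), (T_all w Hn), E.
  rewrite (twice_exact w Hn), !(succ_exact w Hn); rewrite ?(succ_exact w Hn); try (fold n; lia).
  assert (Hi : forall i, T (@eqb_ L (@xb_ L (@plus_ L p i)) (@xb_ L (@plus_ L q i)))
    <-> X (p + i) = X (q + i)).
  { intros i. rewrite (T_eqb w Hn), !xb_plus. apply b2n_inj. }
  split.
  - intros [H1 H2].
    assert (H3 : forall i, i < 2 * length (bin m) + 2 -> X (q + i) = nth i (enc_nat m) false).
    { intros i Hlt. destruct Hp as [_ Hp]. rewrite <- Hp by (rewrite enc_nat_length; lia).
      symmetry. apply Hi, H2. lia. }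
    split; [|intros i Hlt; apply H3; rewrite enc_nat_length in Hlt; exact Hlt].
    rewrite enc_nat_length. fold s. enough (q + (2 * length (bin m) + 1) < s) by lia.
    (* The code ends in a 1 while bits outside [x] read as 0, so the copy at [q] lies inside [x]. *)
    apply X_true. rewrite H3 by lia. unfold enc_nat. rewrite <- dbl_length.
    rewrite nth_app_skip. reflexivity.
  - intros Hq. split; [symmetry; now apply pairs_eq|].
    intros i Hlt. apply Hi. destruct Hp as [_ Hp]. destruct Hq as [_ Hq].
    rewrite Hp, Hq by (rewrite enc_nat_length; lia). reflexivity.
Qed.

Lemma rep_eq (p m : nat) : At p (enc_nat m) -> @rep_ L p = REP m.
Proof.
  intros Hp. destruct (REP_spec x p m Hp) as (H1 & H2 & H3 & H4).
  unfold rep_. rewrite xlen_s. apply (mu_unique w Hn).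
  - unfold s. lia.
  - intros i Hi. rewrite (eqname_iff p m) by exact Hp. now apply H4.
  - intros _. now rewrite (eqname_iff p m) by exact Hp.
Qed.

(** Each element takes at least one bit, so a list inside [x] is shorter than the cap and its length
    is read exactly. *)
Lemma At_enc_list {A : Type} (f : A -> list bool) (g : nat -> nat) l (p : nat) :
  (forall a, 1 <= length (f a)) ->
  (forall q a, In a l -> At q (f a) -> g q = q + length (f a)) ->
  At p (enc_list f l) ->
  @val_ L p = length l /\
  (forall j a, nth_error l j = Some a -> At (Nat.iter j g (@next_ L p)) (f a)) /\
  Nat.iter (length l) g (@next_ L p) = p + length (enc_list f l).
Proof.
  intros Hf Hg H. unfold enc_list in *. apply At_app in H. destruct H as [H1 H2].
  rewrite (next_eq _ _ H1), (val_eq _ _ H1).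
  destruct (At_flat_map x f g l _ Hg H2) as [H3 H4]. split; [|split; [exact H3|]].
  - pose proof (flat_map_length_ge f l Hf). destruct H2 as [H2 _]. fold s in H2.
    pose proof s_lt_n. lia.
  - rewrite H4, length_app. lia.
Qed.

Lemma atom_facts (p : nat) a : At p (enc_atom a) ->
  At p (enc_nat (fst a)) /\ @arity_ L p = length (snd a) /\
  (forall k v, nth_error (snd a) k = Some v -> At (@arg_ L p k) (enc_nat v)) /\
  @atom_end_ L p = p + length (enc_atom a).
Proof.
  intros H. unfold enc_atom in *. apply At_app in H. destruct H as [H1 H2].
  rewrite <- (next_eq _ _ H1) in H2.
  destruct (At_enc_list enc_nat (@next_ L) (snd a) _ enc_nat_ge (fun q v _ => next_eq q v) H2)
    as (E1 & E2 & E3).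
  split; [exact H1|]. split; [exact E1|]. split.
  - intros k v Hk. unfold arg_. rewrite (iter_eq w). now apply E2.
  - unfold atom_end_, arg_, arity_. rewrite E1, (iter_eq w), E3, (next_eq _ _ H1), length_app. lia.
Qed.

Lemma atoms_facts (p : nat) l : At p (enc_list enc_atom l) ->
  @val_ L p = length l /\
  (forall j a, nth_error l j = Some a -> At (@atom_ L p j) (enc_atom a)) /\
  @atom_ L p (@val_ L p) = p + length (enc_list enc_atom l).
Proof.
  intros H.
  destruct (At_enc_list enc_atom (@atom_end_ L) l _ enc_atom_ge
    (fun q a _ Ha => proj2 (proj2 (proj2 (atom_facts q a Ha)))) H) as (E1 & E2 & E3).
  split; [exact E1|]. unfold atom_. split.
  - intros j a Hj. rewrite (iter_eq w). now apply E2.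
  - rewrite (iter_eq w), E1, E3. reflexivity.
Qed.

Lemma tgd_facts (p : nat) xi : At p (enc_tgd xi) ->
  At p (enc_list enc_atom (body xi)) /\ At (@head_ L p) (enc_list enc_atom (head xi)) /\
  @tgd_end_ L p = p + length (enc_tgd xi).
Proof.
  intros H. unfold enc_tgd in *. apply At_app in H. destruct H as [H1 H2].
  destruct (atoms_facts _ _ H1) as (_ & _ & E). fold (@head_ L p) in E.
  rewrite <- E in H2. destruct (atoms_facts _ _ H2) as (_ & _ & E').
  split; [exact H1|]. split; [exact H2|].
  unfold tgd_end_. rewrite E', E, length_app. lia.
Qed.

Lemma tgds_facts Sigma : x = enc_tgds Sigma ->
  @ntgds_ L = length Sigma /\
  (forall i xi, nth_error Sigma i = Some xi -> At (@tgd_ L i) (enc_tgd xi)) /\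
  @tgd_ L (@ntgds_ L) = s.
Proof.
  intros Hx. pose proof (At_self x) as H. rewrite Hx in H at 2.
  destruct (At_enc_list enc_tgd (@tgd_end_ L) Sigma 0 enc_tgd_ge
    (fun q a _ Ha => proj2 (proj2 (tgd_facts q a Ha))) H) as (E1 & E2 & E3).
  change (@val_ L 0) with (@ntgds_ L) in E1. split; [exact E1|]. unfold tgd_. split.
  - intros i xi Hi. rewrite (iter_eq w). now apply E2.
  - rewrite (iter_eq w), E1. change (@zero L) with 0. rewrite E3. symmetry. exact (f_equal (@length bool) Hx).
Qed.

(** The direction needed for input of unknown form: successful local checks imply that the code of
    some list is present. Elements are collected one at a time, up to the capped count. *)
Lemma parse_list {A : Type} (f : A -> list bool) (g : nat -> nat) (ok : nat -> Prop) (p : nat) :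
  (forall a, 1 <= length (f a)) ->
  (forall q a, At q (f a) -> g q = q + length (f a)) ->
  (forall q, ok q -> exists a, At q (f a)) ->
  T (@oknat_ L p) -> (forall j, j < @val_ L p -> ok (Nat.iter j g (@next_ L p))) ->
  exists l, At p (enc_list f l).
Proof.
  intros Hf Hg Hok Hp Hj. apply oknat_iff in Hp. destruct Hp as [m Hm].
  rewrite (next_eq _ _ Hm), (val_eq _ _ Hm) in Hj.
  assert (G : forall c, c <= Nat.min n m -> exists l, length l = c /\
    At (p + length (enc_nat m)) (flat_map f l)).
  { induction c as [|c IH]; intros Hc.
    - exists []. split; [reflexivity|]. split; [|cbn; lia].
      cbn. rewrite Nat.add_0_r. apply Hm.
    - destruct (IH ltac:(lia)) as (l & Hl & Hat).
      destruct (Hok _ (Hj c ltac:(lia))) as [a Ha].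
      destruct (At_flat_map x f g l _ (fun q b _ => Hg q b) Hat) as [_ E].
      rewrite Hl in E. rewrite E in Ha. exists (l ++ [a]). split; [rewrite length_app; cbn; lia|].
      rewrite flat_map_app. apply At_app. split; [exact Hat|]. cbn [flat_map].
      now rewrite app_nil_r. }
  destruct (G _ (le_n _)) as (l & Hl & Hat). exists l. unfold enc_list.
  (* The collected elements fit into [x], so there are fewer than [n] of them and the cap on the
     count was not active. *)
  pose proof (flat_map_length_ge f l Hf) as Hge. pose proof (proj1 Hat) as Hlen. fold s in Hlen.
  pose proof s_lt_n. replace (length l) with m by lia. apply At_app. now split.
Qed.

Lemma okatom_At (p : nat) : T (@okatom_ L p) -> exists a, At p (enc_atom a).
Proof.
  unfold okatom_. rewrite !(T_and w Hn), (T_all w Hn). intros (H1 & H2 & H3).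
  apply oknat_iff in H1. destruct H1 as [r Hr].
  destruct (parse_list enc_nat (@next_ L) (fun q => T (@oknat_ L q)) (@next_ L p) enc_nat_ge)
    as [l Hl].
  - exact next_eq.
  - intros q Hq. now apply oknat_iff.
  - exact H2.
  - intros j Hj. specialize (H3 j Hj). unfold arg_ in H3. rewrite (iter_eq w) in H3. exact H3.
  - exists (r, l). unfold enc_atom. apply At_app. split; [exact Hr|].
    cbn [fst snd]. rewrite <- (next_eq _ _ Hr). exact Hl.
Qed.

Lemma oklist_At (p : nat) : T (@oklist_ L p) -> exists l, At p (enc_list enc_atom l).
Proof.
  unfold oklist_. rewrite (T_and w Hn). unfold allL_. rewrite (T_all w Hn). intros (H1 & H2).
  apply (parse_list enc_atom (@atom_end_ L) (fun q => T (@okatom_ L q)) p enc_atom_ge).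
  - intros q a Ha. apply (atom_facts q a Ha).
  - apply okatom_At.
  - exact H1.
  - intros j Hj. specialize (H2 j Hj). unfold atom_ in H2. rewrite (iter_eq w) in H2. exact H2.
Qed.

Lemma oktgd_At (p : nat) : T (@oktgd_ L p) -> exists xi, At p (enc_tgd xi).
Proof.
  unfold oktgd_. rewrite (T_and w Hn). intros (H1 & H2).
  apply oklist_At in H1, H2. destruct H1 as [b Hb], H2 as [h Hh].
  exists (mkTgd b h). unfold enc_tgd. apply At_app. split; [exact Hb|]. cbn [body head].
  destruct (atoms_facts _ _ Hb) as (_ & _ & E). rewrite <- E. exact Hh.
Qed.

Lemma okx_iff : T (@okx_ L) <-> exists Sigma, x = enc_tgds Sigma.
Proof.
  unfold okx_. rewrite !(T_and w Hn), (T_all w Hn), (T_eqb w Hn), xlen_s.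
  change (@zero L) with 0. split.
  - intros (H1 & H2 & H3).
    destruct (parse_list enc_tgd (@tgd_end_ L) (fun q => T (@oktgd_ L q)) 0 enc_tgd_ge)
      as [Sigma HS].
    + intros q a Ha. apply (tgd_facts q a Ha).
    + apply oktgd_At.
    + exact H1.
    + intros j Hj. specialize (H2 j Hj). unfold tgd_ in H2. rewrite (iter_eq w) in H2. exact H2.
    + exists Sigma. apply At_whole; [exact HS|].
      destruct (At_enc_list enc_tgd (@tgd_end_ L) Sigma 0 enc_tgd_ge
        (fun q a _ Ha => proj2 (proj2 (tgd_facts q a Ha))) HS) as (E1 & _ & E3).
      change (@val_ L 0) with (@ntgds_ L) in E1. rewrite E1 in H3. unfold tgd_ in H3.
      rewrite (iter_eq w) in H3. change (@zero L) with 0 in H3. rewrite E3 in H3. exact H3.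
  - intros [Sigma HS]. destruct (tgds_facts Sigma HS) as (E1 & E2 & E3).
    split; [|split; [|exact E3]].
    + apply oknat_iff. exists (length Sigma). pose proof (At_self x) as H.
      rewrite HS in H at 2. unfold enc_tgds, enc_list in H. apply At_app in H. apply H.
    + assert (Hatom : forall q a, At q (enc_atom a) -> T (@okatom_ L q)).
      { intros q a Ha. pose proof Ha as Ha'. unfold enc_atom, enc_list in Ha'.
        rewrite !At_app in Ha'. destruct Ha' as (A1 & A2 & _).
        rewrite <- (next_eq _ _ A1) in A2. destruct (atom_facts q a Ha) as (_ & F2 & F3 & _).
        unfold okatom_. rewrite !(T_and w Hn), (T_all w Hn), !oknat_iff.
        split; [eauto|]. split; [eauto|]. intros k Hk. rewrite F2 in Hk.
        destruct (nth_error (snd a) k) as [v|] eqn:Ev.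
        - apply oknat_iff. eauto.
        - apply nth_error_None in Ev. lia. }
      assert (Hlist : forall q l, At q (enc_list enc_atom l) -> T (@oklist_ L q)).
      { intros q l Hq. pose proof Hq as Hq'. unfold enc_list in Hq'.
        rewrite !At_app in Hq'. destruct Hq' as (A1 & _).
        destruct (atoms_facts q l Hq) as (F1 & F2 & _).
        unfold oklist_, allL_. rewrite !(T_and w Hn), (T_all w Hn), !oknat_iff.
        split; [eauto|]. intros j Hj. rewrite F1 in Hj.
        destruct (nth_error l j) as [a|] eqn:Ea.
        - eauto.
        - apply nth_error_None in Ea. lia. }
      intros i Hi. rewrite E1 in Hi. destruct (nth_error Sigma i) as [xi|] eqn:Ei.
      * specialize (E2 _ _ Ei). destruct (tgd_facts _ _ E2) as (B1 & B2 & _).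
        unfold oktgd_. rewrite (T_and w Hn). split; eauto.
      * apply nth_error_None in Ei. lia.
Qed.

End Parsing.

(** * Coding instances and chase steps by numbers *)

Definition instn (v : nat -> nat) (a : vatom) : nat * list nat := (fst a, map v (snd a)).

Lemma in_uvars xi a x : In a (body xi) -> In x (snd a) -> In x (uvars xi).
Proof. intros. apply in_flat_map. eauto. Qed.

Lemma in_hvars xi a x : In a (head xi) -> In x (snd a) -> In x (hvars xi).
Proof. intros. apply in_flat_map. eauto. Qed.

Section Codes.

(* Values are coded by numbers: even codes for the values of the original
   instance, the odd code [2 * ID z + 1] for the null created for [z]. *)
Variable ID : nat -> nat.

Definition code1 (h1 : nat -> nat) (xi1 : tgd) (x : nat) : nat :=
  if in_dec Nat.eq_dec x (uvars xi1) then 2 * h1 x else S (2 * ID x).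
Definition code2 (h2 : nat -> nat) (x : nat) : nat := 2 * h2 x.

Definition trigger (v1 v2 : nat -> nat) (xi1 xi2 : tgd) : Prop :=
  exists a, In a (body xi2) /\
    (forall b, In b (body xi1) -> instn v2 a <> instn v1 b) /\
    exists b, In b (head xi1) /\ instn v2 a = instn v1 b.

Definition hom (v1 v2 : nat -> nat) (xi1 xi2 : tgd) (g : nat -> nat) : Prop :=
  (forall x, In x (uvars xi2) -> g x = v2 x) /\
  forall b, In b (head xi2) ->
    (exists a, In a (body xi1) /\ instn g b = instn v1 a) \/
    (exists a, In a (head xi1) /\ instn g b = instn v1 a) \/
    (exists a, In a (body xi2) /\ instn g b = instn v2 a).

Definition decode (c : nat) : value :=
  if Nat.even c then Const (Nat.div2 c) else Null (Nat.div2 c).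
Definition encode (v : value) : nat :=
  match v with Const c => 2 * c | Null r => S (2 * r) end.

Lemma decode_even c : decode (2 * c) = Const c.
Proof. unfold decode. rewrite Nat.even_even, Nat.div2_double. reflexivity. Qed.

Lemma decode_odd c : decode (S (2 * c)) = Null c.
Proof.
  unfold decode. rewrite Nat.even_succ, Nat.odd_even, Nat.div2_succ_double. reflexivity.
Qed.

Lemma encode_decode c : encode (decode c) = c.
Proof.
  destruct (Nat.Even_or_Odd c) as [[d ->]|[d ->]].
  - now rewrite decode_even.
  - now rewrite Nat.add_1_r, decode_odd.
Qed.

Definition fmap {A B : Type} (f : A -> B) (p : nat * list A) : nat * list B :=
  (fst p, map f (snd p)).

Lemma inst_fmap (f : nat -> value) v a :
  inst (fun x => f (v x)) a = fmap f (instn v a).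
Proof. unfold inst, fmap, instn. cbn. now rewrite map_map. Qed.

Lemma instn_fmap (f : value -> nat) v a :
  instn (fun x => f (v x)) a = fmap f (inst v a).
Proof. unfold inst, fmap, instn. cbn. now rewrite map_map. Qed.

Lemma inst_decode_inj v v' a b :
  inst (fun x => decode (v x)) a = inst (fun x => decode (v' x)) b -> instn v a = instn v' b.
Proof.
  rewrite (inst_fmap decode v), (inst_fmap decode v'). intros H. apply (f_equal (fmap encode)) in H. unfold fmap in H.
  cbn in H. rewrite !map_map in H.
  injection H as H1 H2. unfold instn. rewrite H1. f_equal.
  rewrite (map_ext _ v), (map_ext (fun x => encode (decode (v' x))) v') in H2
    by (intros; apply encode_decode). exact H2.
Qed.

Lemma inst_ext v v' a : (forall x, In x (snd a) -> v x = v' x) -> inst v a = inst v' a.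
Proof. intros H. unfold inst. f_equal. now apply map_ext_in. Qed.

Lemma instn_ext v v' a : (forall x, In x (snd a) -> v x = v' x) -> instn v a = instn v' a.
Proof. intros H. unfold instn. f_equal. now apply map_ext_in. Qed.

Lemma trigger_ext v1 v2 v1' v2' xi1 xi2 :
  (forall x, In x (uvars xi1) \/ In x (hvars xi1) -> v1 x = v1' x) ->
  (forall x, In x (uvars xi2) -> v2 x = v2' x) ->
  trigger v1 v2 xi1 xi2 -> trigger v1' v2' xi1 xi2.
Proof.
  intros E1 E2 (a & Ha & Hb & b & Hb1 & Hb2).
  assert (Ea : instn v2 a = instn v2' a).
  { apply instn_ext. intros x Hx. apply E2. eapply in_uvars; eauto. }
  exists a. split; [exact Ha|]. split.
  - intros b' Hb'. rewrite <- Ea, <- (instn_ext v1 v1' b'); [now apply Hb|].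
    intros x Hx. apply E1. left. eapply in_uvars; eauto.
  - exists b. split; [exact Hb1|]. rewrite <- Ea, <- (instn_ext v1 v1' b); [exact Hb2|].
    intros x Hx. apply E1. right. eapply in_hvars; eauto.
Qed.

Lemma hom_ext v1 v2 v1' v2' xi1 xi2 g :
  (forall x, In x (uvars xi1) \/ In x (hvars xi1) -> v1 x = v1' x) ->
  (forall x, In x (uvars xi2) -> v2 x = v2' x) ->
  hom v1 v2 xi1 xi2 g -> hom v1' v2' xi1 xi2 g.
Proof.
  intros E1 E2 [H1 H2]. split.
  - intros x Hx. rewrite H1 by exact Hx. now apply E2.
  - intros b Hb. destruct (H2 b Hb) as [(a & Ha & E)|[(a & Ha & E)|(a & Ha & E)]].
    + left. exists a. split; [exact Ha|]. rewrite E. apply instn_ext.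
      intros x Hx. apply E1. left. eapply in_uvars; eauto.
    + right; left. exists a. split; [exact Ha|]. rewrite E. apply instn_ext.
      intros x Hx. apply E1. right. eapply in_hvars; eauto.
    + right; right. exists a. split; [exact Ha|]. rewrite E. apply instn_ext.
      intros x Hx. apply E2. eapply in_uvars; eauto.
Qed.

Lemma code1_univ h1 xi1 x : In x (uvars xi1) -> code1 h1 xi1 x = 2 * h1 x.
Proof. intros H. unfold code1. now destruct (in_dec _ _ _). Qed.

Lemma code1_exist h1 xi1 x : ~ In x (uvars xi1) -> code1 h1 xi1 x = S (2 * ID x).
Proof. intros H. unfold code1. now destruct (in_dec _ _ _). Qed.

Definition codefact_dec (f g : nat * list nat) : {f = g} + {f <> g}.
Proof. repeat decide equality. Defined.

Lemma in_dom_inst v a (I : instance) x : In (inst v a) I -> In x (snd a) -> In (v x) (dom I).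
Proof.
  intros Ha Hx. apply in_flat_map. exists (inst v a). split; [exact Ha|]. now apply in_map.
Qed.

(** The instance is built from the codes, even ones as constants and odd ones as nulls. An extension
    in [J], read back through [encode], would be a [hom]. *)
Theorem prec_of_codes xi1 xi2 h1 h2 :
  (forall z z', In z (hvars xi1) -> In z' (hvars xi1) -> ID z = ID z' -> z = z') ->
  trigger (code1 h1 xi1) (code2 h2) xi1 xi2 ->
  ~ (exists g, hom (code1 h1 xi1) (code2 h2) xi1 xi2 g) ->
  prec xi1 xi2.
Proof.
  intros HID (a0 & Ha0 & Hnb & b0 & Hb0 & E0) Hno.
  set (v1 := code1 h1 xi1) in *. set (v2 := code2 h2) in *.
  pose (V1 := fun x => decode (v1 x)). pose (V2 := fun x => decode (v2 x)).
  (* All atoms with the same image as [a0] are left out of [I], not only [a0] itself, so that the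
     fact is really missing. *)
  pose (keep := fun a => if codefact_dec (instn v2 a) (instn v2 a0) then false else true).
  pose (I := map (inst V1) (body xi1) ++ map (inst V2) (filter keep (body xi2))).
  pose (J := I ++ map (inst V1) (head xi1)).
  assert (HI1 : forall b, In b (body xi1) -> In (inst V1 b) I).
  { intros b Hb. apply in_or_app. left. now apply in_map. }
  assert (HI2 : forall a, In a (body xi2) -> instn v2 a <> instn v2 a0 -> In (inst V2 a) I).
  { intros a Ha Hne. apply in_or_app. right. apply in_map, filter_In. split; [exact Ha|].
    unfold keep. now destruct (codefact_dec _ _). }
  assert (E0' : forall a, instn v2 a = instn v2 a0 -> inst V2 a = inst V1 b0).
  { intros a Ha. unfold V1, V2. rewrite (inst_fmap decode v2), (inst_fmap decode v1). congruence. }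
  assert (HJ2 : forall a, In a (body xi2) -> In (inst V2 a) J).
  { intros a Ha. apply in_or_app. destruct (codefact_dec (instn v2 a) (instn v2 a0)) as [E|E].
    - right. rewrite (E0' a E). now apply in_map.
    - left. now apply HI2. }
  exists I, J, V1, V2. split; [|split; [|split; [|split]]].
  - intros x Hx. apply in_flat_map in Hx. destruct Hx as (b & Hb & Hx).
    eapply in_dom_inst; eauto.
  - intros x Hx. apply in_flat_map in Hx. destruct Hx as (a & Ha & Hx).
    destruct (codefact_dec (instn v2 a) (instn v2 a0)) as [E|E];
      [|eapply in_dom_inst; eauto].
    (* A value in the omitted fact also occurs in the image of the head atom [b0]. Its code is even,
       so it is no new null but the value of a universal variable of [xi1], and thus lies in the
       domain of [I]. *)
    assert (Hin : In (v2 x) (map v1 (snd b0))).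
    { rewrite E0 in E. injection E as _ E. rewrite <- E. now apply in_map. }
    apply in_map_iff in Hin. destruct Hin as (u & Eu & Hu).
    destruct (in_dec Nat.eq_dec u (uvars xi1)) as [Hin|Hin].
    + replace (V2 x) with (V1 u) by (unfold V1, V2; congruence).
      apply in_flat_map in Hin. destruct Hin as (b & Hb & Hin). eapply in_dom_inst; eauto.
    + exfalso. unfold v1 in Eu. rewrite code1_exist in Eu by exact Hin.
      unfold v2, code2 in Eu. lia.
  (* [I] satisfies [xi2] under [V2] vacuously, since the image of [a0] is missing. *)
  - intros Hincl. exfalso. specialize (Hincl (inst V2 a0) (in_map _ _ _ Ha0)).
    apply in_app_or in Hincl. destruct Hincl as [Hin|Hin]; apply in_map_iff in Hin;
      destruct Hin as (b & Eb & Hb).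
    + symmetry in Eb. apply inst_decode_inj in Eb. now apply (Hnb b Hb).
    + apply inst_decode_inj in Eb. apply filter_In in Hb. destruct Hb as [_ Hb].
      unfold keep in Hb. now destruct (codefact_dec _ _).
  - split.
    { intros f Hf. apply in_or_app. now left. }
    exists V1. split; [reflexivity|]. split; [|split; [|reflexivity]].
    (* All values in [I] have even codes and are constants, so every null is fresh. *)
    + intros u [Hu1 Hu2]. exists (ID u). unfold V1, v1. rewrite code1_exist by exact Hu2.
      split; [apply decode_odd|]. intros Hin. apply in_flat_map in Hin.
      destruct Hin as (f & Hf & Hin). apply in_app_or in Hf.
      destruct Hf as [Hf|Hf]; apply in_map_iff in Hf; destruct Hf as (b & <- & Hb);
        apply in_map_iff in Hin; destruct Hin as (x & Ex & Hx).
      * unfold V1, v1 in Ex. rewrite code1_univ, decode_even in Ex; [discriminate|].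
        eapply in_uvars; eauto.
      * unfold V2, v2, code2 in Ex. rewrite decode_even in Ex. discriminate.
    + intros u1 u2 [Hu1 Hu1'] [Hu2 Hu2'] E. unfold V1, v1 in E.
      rewrite !code1_exist, !decode_odd in E by assumption. injection E as E. now apply HID.
  - intros Hsat. apply Hno. destruct Hsat as (G & HG1 & HG2).
    { intros f Hf. apply in_map_iff in Hf. destruct Hf as (a & <- & Ha). now apply HJ2. }
    exists (fun x => encode (G x)). split.
    { intros x Hx. rewrite HG1 by exact Hx. apply encode_decode. }
    assert (K : forall b a v, inst G b = inst (fun x => decode (v x)) a ->
      instn (fun x => encode (G x)) b = instn v a).
    { intros b a v E. rewrite (instn_fmap encode G), E, <- (instn_fmap encode (fun x => decode (v x))).
      apply instn_ext.
      intros x _. apply encode_decode. }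
    intros b Hb. specialize (HG2 (inst G b) (in_map _ _ _ Hb)).
    apply in_app_or in HG2. destruct HG2 as [HG2|HG2].
    + apply in_app_or in HG2. destruct HG2 as [HG2|HG2]; apply in_map_iff in HG2;
        destruct HG2 as (a & Ea & Ha).
      * left. exists a. split; [exact Ha|]. now apply K.
      * right; right. apply filter_In in Ha. exists a. split; [apply Ha|]. now apply K.
    + apply in_map_iff in HG2. destruct HG2 as (a & Ea & Ha).
      right; left. exists a. split; [exact Ha|]. now apply K.
Qed.

Definition value_dec (u v : value) : {u = v} + {u <> v}.
Proof. repeat decide equality. Defined.

Fixpoint index_of (v : value) (l : list value) : nat :=
  match l with [] => 0 | u :: l => if value_dec u v then 0 else S (index_of v l) end.

Lemma index_of_le v l : index_of v l <= length l.
Proof. induction l as [|u l IH]; cbn; [lia|]. destruct (value_dec u v); lia. Qed.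

Lemma index_of_nth v l d : In v l -> nth (index_of v l) l d = v.
Proof.
  induction l as [|u l IH]; intros Hin; [destruct Hin|]. cbn.
  destruct (value_dec u v); [assumption|]. destruct Hin; [contradiction|auto].
Qed.

Lemma map_transfer {A B C : Type} (f g : A -> B) (F G : A -> C) l : forall l',
  map f l = map g l' ->
  (forall x y, In x l -> In y l' -> f x = g y -> F x = G y) -> map F l = map G l'.
Proof.
  induction l as [|x l IH]; intros [|y l'] E H; try discriminate; [reflexivity|].
  cbn in *. injection E as E1 E2. f_equal; auto.
Qed.

(** Values are numbered by their first index in the list of values that the two mappings take on
    universal variables, whence the bound. To exclude a [hom], a map [psi] from codes back to values
    is enough: it sends coded facts to facts of [J], so a coded extension would give an actual
    one. *)
Theorem codes_of_prec xi1 xi2 :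
  (forall z z', In z (hvars xi1) -> In z' (hvars xi1) -> ID z = ID z' -> z = z') ->
  prec xi1 xi2 ->
  exists h1 h2,
    (forall x, h1 x <= length (uvars xi1) + length (uvars xi2)) /\
    (forall x, h2 x <= length (uvars xi1) + length (uvars xi2)) /\
    trigger (code1 h1 xi1) (code2 h2) xi1 xi2 /\
    ~ (exists g, hom (code1 h1 xi1) (code2 h2) xi1 xi2 g).
Proof.
  intros HID (I & J & H1 & H2 & Hm1 & Hm2 & HsI & [Hinc (H' & Hag & Hfresh & _ & EJ)] & HsJ).
  apply imply_to_and in HsJ. destruct HsJ as [HbJ HnG].
  set (l := map H1 (uvars xi1) ++ map H2 (uvars xi2)).
  assert (Hl : length l = length (uvars xi1) + length (uvars xi2))
    by (unfold l; now rewrite length_app, !length_map).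
  pose (h1 := fun x => index_of (H1 x) l). pose (h2 := fun x => index_of (H2 x) l).
  exists h1, h2. split; [intros; rewrite <- Hl; apply index_of_le|].
  split; [intros; rewrite <- Hl; apply index_of_le|].
  set (v1 := code1 h1 xi1). set (v2 := code2 h2).
  (* Recovers an existential variable from its identifier; the default 0 does not occur for
     identifiers of head variables. *)
  pose (inv := fun r => match find (fun u => ID u =? r) (hvars xi1) with
                        | Some u => u | None => 0 end).
  pose (psi := fun c => match decode c with
                        | Const i => nth i l (Const 0) | Null r => H' (inv r) end).
  assert (Hinv : forall u, In u (hvars xi1) -> inv (ID u) = u).
  { intros u Hu. unfold inv. destruct (find _ _) as [u'|] eqn:E.
    - apply find_some in E. destruct E as [Hu' E]. apply Nat.eqb_eq in E. now apply HID.
    - apply (find_none _ _ E) in Hu. now rewrite Nat.eqb_refl in Hu. }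
  assert (P1 : forall x, In x (uvars xi1) \/ In x (hvars xi1) -> psi (v1 x) = H' x).
  { intros x Hx. unfold psi, v1. destruct (in_dec Nat.eq_dec x (uvars xi1)) as [Hu|Hu].
    - rewrite code1_univ, decode_even by exact Hu. rewrite Hag by exact Hu.
      apply index_of_nth. apply in_or_app. left. now apply in_map.
    - rewrite code1_exist, decode_odd by exact Hu. rewrite Hinv; tauto. }
  assert (P2 : forall x, In x (uvars xi2) -> psi (v2 x) = H2 x).
  { intros x Hx. unfold psi, v2, code2. rewrite decode_even.
    apply index_of_nth. apply in_or_app. right. now apply in_map. }
  assert (Q1 : forall a, In a (body xi1) -> fmap psi (instn v1 a) = inst H1 a).
  { intros a Ha. rewrite <- inst_fmap. apply inst_ext. intros x Hx.
    assert (In x (uvars xi1)) by (eapply in_uvars; eauto). rewrite P1, Hag; auto. }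
  assert (Q2 : forall a, In a (body xi2) -> fmap psi (instn v2 a) = inst H2 a).
  { intros a Ha. rewrite <- inst_fmap. apply inst_ext. intros x Hx.
    apply P2. eapply in_uvars; eauto. }
  assert (Q3 : forall a, In a (head xi1) -> fmap psi (instn v1 a) = inst H' a).
  { intros a Ha. rewrite <- inst_fmap. apply inst_ext. intros x Hx.
    apply P1. right. eapply in_hvars; eauto. }
  assert (HIJ : incl I J) by (subst J; apply incl_appl, incl_refl).
  split.
  (* Were the whole body of [xi2] already in [I], the extension provided by [I] would persist in the
     larger [J]. *)
  - assert (Hex : exists a, In a (body xi2) /\ ~ In (inst H2 a) I).
    { apply NNPP. intros Hn. apply HnG. destruct HsI as (g & Hg1 & Hg2).
      - intros f Hf. apply in_map_iff in Hf. destruct Hf as (a & <- & Ha).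
        apply NNPP. intros Hna. apply Hn. eauto.
      - exists g. split; [exact Hg1|]. eapply incl_tran; eauto. }
    destruct Hex as (a & Ha & Hna). exists a. split; [exact Ha|]. split.
    + intros b Hb E. apply Hna. rewrite <- Q2, E, Q1 by assumption.
      apply Hinc. now apply in_map.
    + specialize (HbJ (inst H2 a) (in_map _ _ _ Ha)). subst J. apply in_app_or in HbJ.
      destruct HbJ as [Hin|Hin]; [contradiction|]. apply in_map_iff in Hin.
      destruct Hin as (b & E & Hb). exists b. split; [exact Hb|].
      unfold inst in E. injection E as E1 E2. unfold instn. f_equal; [easy|].
      symmetry. apply (map_transfer _ _ _ _ _ _ E2). intros u x Hu Hx Eux.
      destruct (in_dec Nat.eq_dec u (uvars xi1)) as [Hin|Hin].
      * unfold v1, v2, code2. rewrite code1_univ by exact Hin. rewrite Hag in Eux by exact Hin.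
        unfold h1, h2. now rewrite Eux.
      (* A fresh null is no value of [H2] on universal variables, since these are mapped into the
         domain of [I]. *)
      * exfalso. destruct (Hfresh u) as (k & Ek & Hk).
        { split; [eapply in_hvars; eauto|exact Hin]. }
        apply Hk. rewrite <- Ek, Eux. apply Hm2. eapply in_uvars; eauto.
  - intros (g & Hg1 & Hg2). apply HnG.
    pose (G := fun x => if in_dec Nat.eq_dec x (uvars xi2) then H2 x else psi (g x)).
    assert (EG : forall x, G x = psi (g x)).
    { intros x. unfold G. destruct (in_dec _ _ _) as [Hx|Hx]; [|reflexivity].
      rewrite Hg1 by exact Hx. symmetry. now apply P2. }
    exists G. split.
    + intros x Hx. unfold G. now destruct (in_dec _ _ _).
    + intros f Hf. apply in_map_iff in Hf. destruct Hf as (b & <- & Hb).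
      rewrite (inst_ext G (fun x => psi (g x))) by (intros; apply EG).
      rewrite (inst_fmap psi g).
      destruct (Hg2 b Hb) as [(a & Ha & ->)|[(a & Ha & ->)|(a & Ha & ->)]].
      * rewrite Q1 by exact Ha. apply HIJ, Hinc. now apply in_map.
      * rewrite Q3 by exact Ha. subst J. apply in_or_app. right. now apply in_map.
      * rewrite Q2 by exact Ha. apply HbJ. now apply in_map.
Qed.

End Codes.

Lemma clos_rt_invariant {A : Type} (R : A -> A -> Prop) (P : A -> Prop) p q :
  (forall u v, R u v -> P u -> P v) -> clos_refl_trans A R p q -> P p -> P q.
Proof. intros H. induction 1; eauto. Qed.

(** * Meaning of the verifier *)

Section Verifier.

Variables x y z : list bool.
Notation w := (enc_triple x y z).
Notation s := (length x).
Notation n := (length w).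
Let Hn : 1 <= n := triple_pos x y z.

Notation L := (NL w).
Notation At := (At x).
Notation REP := (REP x).
Notation Yt := (y_entry x y).
Notation Zt := (z_entry x z).

Lemma eqname_eq (p q m m' : nat) :
  At p (enc_nat m) -> At q (enc_nat m') -> (T (@eqname_ L p q) <-> m = m').
Proof.
  intros Hp Hq. rewrite (eqname_iff x y z p m q Hp). split.
  - intros H. exact (At_nat_unique x q _ _ H Hq).
  - intros <-. exact Hq.
Qed.

Lemma exL_iff (p : nat) l (f : nat -> nat) (F : vatom -> Prop) :
  At p (enc_list enc_atom l) ->
  (forall q a, In a l -> At q (enc_atom a) -> (T (f q) <-> F a)) ->
  (T (@exL_ L p f) <-> exists a, In a l /\ F a).
Proof.
  intros Hp Hf. destruct (atoms_facts x y z p l Hp) as (E1 & E2 & _).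
  unfold exL_. rewrite (T_ex w Hn). rewrite E1. split.
  - intros (j & Hj & H). destruct (nth_error l j) as [a|] eqn:Ea.
    + exists a. split; [now apply nth_error_In in Ea|].
      apply (Hf (@atom_ L p j)); eauto using nth_error_In.
    + apply nth_error_None in Ea. lia.
  - intros (a & Ha & H). apply In_nth_error in Ha. destruct Ha as [j Ej]. exists j.
    split; [apply nth_error_Some; congruence|].
    apply (Hf (@atom_ L p j) a); eauto using nth_error_In.
Qed.

Lemma allL_iff (p : nat) l (f : nat -> nat) (F : vatom -> Prop) :
  At p (enc_list enc_atom l) ->
  (forall q a, In a l -> At q (enc_atom a) -> (T (f q) <-> F a)) ->
  (T (@allL_ L p f) <-> forall a, In a l -> F a).
Proof.
  intros Hp Hf. destruct (atoms_facts x y z p l Hp) as (E1 & E2 & _).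
  unfold allL_. rewrite (T_all w Hn). rewrite E1. split.
  - intros H a Ha. pose proof Ha as Ha'. apply In_nth_error in Ha. destruct Ha as [j Ej].
    apply (Hf (@atom_ L p j) a Ha'); [auto|]. apply H. apply nth_error_Some. congruence.
  - intros H j Hj. destruct (nth_error l j) as [a|] eqn:Ea.
    + apply (Hf (@atom_ L p j) a); eauto using nth_error_In.
    + apply nth_error_None in Ea. lia.
Qed.

Lemma arity_eq (q : nat) a : At q (enc_atom a) -> @arity_ L q = length (snd a).
Proof. intros H. apply (atom_facts x y z q a H). Qed.

Lemma arg_At (q : nat) a k v :
  At q (enc_atom a) -> nth_error (snd a) k = Some v -> At (@arg_ L q k) (enc_nat v).
Proof. intros H. apply (atom_facts x y z q a H). Qed.

Lemma exArg_iff (q : nat) a (f : nat -> nat) (F : nat -> nat -> Prop) :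
  At q (enc_atom a) ->
  (forall k v, nth_error (snd a) k = Some v -> (T (f k) <-> F k v)) ->
  (T (@ex_ L (@arity_ L q) f) <-> exists k v, nth_error (snd a) k = Some v /\ F k v).
Proof.
  intros Hq Hf. rewrite (T_ex w Hn), (arity_eq q a Hq). split.
  - intros (k & Hk & H). destruct (nth_error (snd a) k) as [v|] eqn:Ev.
    + exists k, v. split; [exact Ev|]. now apply (Hf k v).
    + apply nth_error_None in Ev. lia.
  - intros (k & v & Ev & H). exists k. split; [apply nth_error_Some; congruence|].
    now apply (Hf k v).
Qed.

Lemma allArg_iff (q : nat) a (f : nat -> nat) (F : nat -> nat -> Prop) :
  At q (enc_atom a) ->
  (forall k v, nth_error (snd a) k = Some v -> (T (f k) <-> F k v)) ->
  (T (@all_ L (@arity_ L q) f) <-> forall k v, nth_error (snd a) k = Some v -> F k v).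
Proof.
  intros Hq Hf. rewrite (T_all w Hn), (arity_eq q a Hq). split.
  - intros H k v Ev. apply (Hf k v Ev), H. apply nth_error_Some. congruence.
  - intros H k Hk. destruct (nth_error (snd a) k) as [v|] eqn:Ev.
    + apply (Hf k v Ev). now apply H.
    + apply nth_error_None in Ev. lia.
Qed.

Lemma inL_iff (p q v : nat) l :
  At p (enc_list enc_atom l) -> At q (enc_nat v) ->
  (T (@inL_ L p q) <-> In v (flat_map snd l)).
Proof.
  intros Hp Hq. unfold inL_.
  rewrite (exL_iff p l _ (fun a => In v (snd a)) Hp).
  - rewrite in_flat_map. reflexivity.
  - intros p' a Ha Hp'.
    rewrite (exArg_iff p' a _ (fun k u => u = v) Hp').
    + split.
      * intros (k & u & Ek & <-). now apply nth_error_In in Ek.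
      * intros Hin. apply In_nth_error in Hin. destruct Hin as [k Ek]. eauto.
    + intros k u Ek. apply eqname_eq; [|exact Hq]. now apply (arg_At p' a).
Qed.

Lemma map_eq_nth_error {A B C : Type} (F : A -> C) (G : B -> C) l l' :
  length l = length l' ->
  (forall k u v, nth_error l k = Some u -> nth_error l' k = Some v -> F u = G v) ->
  map F l = map G l'.
Proof.
  revert l'. induction l as [|a l IH]; intros [|b l'] Hl H; try discriminate; [reflexivity|].
  cbn. f_equal; [exact (H 0 a b eq_refl eq_refl)|]. apply IH; [now injection Hl|].
  intros k. exact (H (S k)).
Qed.

Lemma eqfact_iff (f g : nat -> nat) (qa qb : nat) a b (F G : nat -> nat) :
  At qa (enc_atom a) -> At qb (enc_atom b) ->
  (forall q v, In v (snd a) -> At q (enc_nat v) -> f q = F v) ->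
  (forall q v, In v (snd b) -> At q (enc_nat v) -> g q = G v) ->
  (T (@eqfact_ L f g qa qb) <-> instn F a = instn G b).
Proof.
  intros Ha Hb Hf Hg. unfold eqfact_. rewrite !(T_and w Hn), (T_eqb w Hn).
  destruct (atom_facts x y z qa a Ha) as (A1 & _).
  destruct (atom_facts x y z qb b Hb) as (B1 & _).
  rewrite (eqname_eq _ _ _ _ A1 B1), (arity_eq qa a Ha), (arity_eq qb b Hb).
  rewrite <- (arity_eq qa a Ha).
  assert (K : (fst a = fst b /\ @arity_ L qa = length (snd b) /\
    (forall k u, nth_error (snd a) k = Some u ->
      forall v, nth_error (snd b) k = Some v -> F u = G v)) <-> instn F a = instn G b).
  { rewrite (arity_eq qa a Ha). unfold instn. split.
    - intros (H1 & H2 & H3). f_equal; [exact H1|]. apply map_eq_nth_error; eauto.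
    - intros H. injection H as H1 H2. split; [exact H1|].
      split; [rewrite <- (length_map F), H2; apply length_map|].
      intros k u Hu v Hv. apply (map_nth_error F) in Hu. apply (map_nth_error G) in Hv.
      rewrite H2 in Hu. congruence. }
  rewrite <- K.
  split; intros (H1 & H2 & H3); (split; [exact H1|]); (split; [exact H2|]).
  - intros k u Hu v Hv. rewrite (T_all w Hn) in H3.
    assert (Hk : k < @arity_ L qa) by (rewrite (arity_eq qa a Ha); apply nth_error_Some; congruence).
    specialize (H3 k Hk). apply (T_eqb w Hn) in H3.
    rewrite <- (Hf (@arg_ L qa k) u), <- (Hg (@arg_ L qb k) v); eauto using nth_error_In, arg_At.
  - rewrite (T_all w Hn). intros k Hk. apply (T_eqb w Hn).
    rewrite H2 in Hk. destruct (nth_error (snd b) k) as [v|] eqn:Hv;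
      [|apply nth_error_None in Hv; lia].
    rewrite <- H2, (arity_eq qa a Ha) in Hk. destruct (nth_error (snd a) k) as [u|] eqn:Hu;
      [|apply nth_error_None in Hu; lia].
    rewrite (Hf (@arg_ L qa k) u), (Hg (@arg_ L qb k) v); eauto using nth_error_In, arg_At.
Qed.

Lemma nth_error_eq {A : Type} (l l' : list A) :
  length l = length l' ->
  (forall k u v, nth_error l k = Some u -> nth_error l' k = Some v -> u = v) -> l = l'.
Proof.
  intros Hl H. rewrite <- (map_id l), <- (map_id l'). now apply map_eq_nth_error.
Qed.

(** Unique readability: the parser computes the places of all parts from the starting position
    alone, and numbers are determined by their place. *)
Lemma At_atom_unique (p : nat) a b : At p (enc_atom a) -> At p (enc_atom b) -> a = b.
Proof.
  intros Ha Hb. destruct (atom_facts x y z p a Ha) as (A1 & A2 & A3 & _).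
  destruct (atom_facts x y z p b Hb) as (B1 & B2 & B3 & _).
  destruct a as [r l], b as [r' l']. cbn in *. f_equal.
  - exact (At_nat_unique x p _ _ A1 B1).
  - apply nth_error_eq; [congruence|]. intros k u v Hu Hv.
    exact (At_nat_unique x _ _ _ (A3 _ _ Hu) (B3 _ _ Hv)).
Qed.

Lemma At_atoms_unique (p : nat) l l' :
  At p (enc_list enc_atom l) -> At p (enc_list enc_atom l') -> l = l'.
Proof.
  intros Ha Hb. destruct (atoms_facts x y z p l Ha) as (A1 & A2 & _).
  destruct (atoms_facts x y z p l' Hb) as (B1 & B2 & _).
  apply nth_error_eq; [congruence|]. intros k u v Hu Hv.
  exact (At_atom_unique _ _ _ (A2 _ _ Hu) (B2 _ _ Hv)).
Qed.

Lemma At_tgd_unique (p : nat) xi xi' : At p (enc_tgd xi) -> At p (enc_tgd xi') -> xi = xi'.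
Proof.
  intros Ha Hb. destruct (tgd_facts x y z p xi Ha) as (A1 & A2 & _).
  destruct (tgd_facts x y z p xi' Hb) as (B1 & B2 & _).
  destruct xi, xi'. cbn in *. f_equal; eapply At_atoms_unique; eauto.
Qed.

Lemma eqtgd_iff (p q : nat) xi xi' :
  At p (enc_tgd xi) -> At q (enc_tgd xi') -> (T (@eqtgd_ L p q) <-> xi = xi').
Proof.
  intros Hp Hq. pose proof (s_lt_n x y z) as Hs.
  destruct (tgd_facts x y z p xi Hp) as (_ & _ & Ep).
  destruct (tgd_facts x y z q xi' Hq) as (_ & _ & Eq).
  pose proof (proj1 Hp) as Lp. pose proof (proj1 Hq) as Lq.
  (* End positions lie within [x], below the cap, so comparing a saturated sum with them is
     exact. *)
  assert (Hpl : forall p (u : list bool) l, p + length u <= s -> l < n ->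
    (@plus_ L p l = p + length u <-> l = length u)).
  { intros p0 u l Hl Hln. assert (C : cong w (@plus_ L p0 l) (p0 + l))
      by (apply (plus_cong w Hn); reflexivity).
    unfold cong in C. split; intros E; [rewrite E in C; lia|]. subst l.
    apply (plus_exact w Hn). lia. }
  unfold eqtgd_. rewrite (T_ex w Hn). cbn [len NL nat_lang]. rewrite Ep, Eq. split.
  - intros (l & Hl & H). rewrite !(T_and w Hn), !(T_eqb w Hn), (T_all w Hn) in H.
    destruct H as (H1 & H2 & H3). rewrite Hpl in H1, H2 by assumption.
    apply (At_tgd_unique p); [exact Hp|]. split; [lia|]. intros i Hi.
    destruct Hq as [_ Hq]. rewrite <- Hq by exact Hi.
    specialize (H3 i ltac:(lia)). rewrite (T_eqb w Hn) in H3.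
    rewrite !xb_plus in H3. now apply b2n_inj in H3.
  - intros <-. exists (length (enc_tgd xi)). split; [lia|].
    rewrite !(T_and w Hn), !(T_eqb w Hn), (T_all w Hn), !Hpl by (assumption || lia).
    split; [reflexivity|]. split; [reflexivity|]. intros i Hi. rewrite (T_eqb w Hn).
    rewrite !xb_plus. f_equal. destruct Hp as [_ Hp], Hq as [_ Hq].
    now rewrite Hp, Hq.
Qed.

Variable Sigma : list tgd.
Hypothesis HS : x = enc_tgds Sigma.

Lemma ntgds_eq : @ntgds_ L = length Sigma.
Proof. apply (tgds_facts x y z Sigma HS). Qed.

Lemma tgd_At i xi : nth_error Sigma i = Some xi -> At (@tgd_ L i) (enc_tgd xi).
Proof. apply (tgds_facts x y z Sigma HS). Qed.

Lemma tgd_body (p : nat) xi : At p (enc_tgd xi) -> At p (enc_list enc_atom (body xi)).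
Proof. intros H. apply (tgd_facts x y z p xi H). Qed.

Lemma tgd_head (p : nat) xi :
  At p (enc_tgd xi) -> At (@head_ L p) (enc_list enc_atom (head xi)).
Proof. intros H. apply (tgd_facts x y z p xi H). Qed.

Lemma all_tgds_iff (f : nat -> nat) (F : tgd -> Prop) :
  (forall q xi, At q (enc_tgd xi) -> forall i, q = @tgd_ L i -> (T (f i) <-> F xi)) ->
  (T (@all_ L (@ntgds_ L) f) <-> forall xi, In xi Sigma -> F xi).
Proof.
  intros Hf. rewrite (T_all w Hn), ntgds_eq. split.
  - intros H xi Hxi. apply In_nth_error in Hxi. destruct Hxi as [i Ei].
    apply (Hf _ _ (tgd_At _ _ Ei) i eq_refl), H, nth_error_Some. congruence.
  - intros H i Hi. destruct (nth_error Sigma i) as [xi|] eqn:Ei.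
    + apply (Hf _ _ (tgd_At _ _ Ei) i eq_refl), H. eapply nth_error_In, Ei.
    + apply nth_error_None in Ei. lia.
Qed.

Lemma allA_iff (p : nat) xi (f : nat -> nat) (F : vatom -> Prop) :
  At p (enc_tgd xi) -> (forall q a, At q (enc_atom a) -> (T (f q) <-> F a)) ->
  (T (@allA_ L p f) <-> forall a, In a (body xi ++ head xi) -> F a).
Proof.
  intros Hp Hf. unfold allA_. rewrite (T_and w Hn).
  rewrite (allL_iff _ _ f F (tgd_body p xi Hp)) by (intros; now apply Hf).
  rewrite (allL_iff _ _ f F (tgd_head p xi Hp)) by (intros; now apply Hf).
  split.
  - intros [H1 H2] a Ha. apply in_app_or in Ha. destruct Ha; auto.
  - intros H. split; intros a Ha; apply H, in_or_app; auto.
Qed.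

Lemma wfx_iff : T (@wfx_ L) <-> well_formed Sigma.
Proof.
  unfold wfx_.
  rewrite (all_tgds_iff _ (fun xi => forall xi', In xi' Sigma ->
    forall a, In a (body xi ++ head xi) -> forall b, In b (body xi' ++ head xi') ->
    fst a = fst b -> length (snd a) = length (snd b))).
  - unfold well_formed. split; intros H; intros; eauto.
  - intros q xi Hq i ->. rewrite (all_tgds_iff _ (fun xi' =>
      forall a, In a (body xi ++ head xi) -> forall b, In b (body xi' ++ head xi') ->
      fst a = fst b -> length (snd a) = length (snd b))); [reflexivity|].
    intros q' xi' Hq' j ->. apply (allA_iff _ xi); [exact Hq|]. intros p a Ha.
    apply (allA_iff _ xi'); [exact Hq'|]. intros p' b Hb.
    rewrite (T_imp w Hn), (T_eqb w Hn), (arity_eq p a Ha), (arity_eq p' b Hb).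
    destruct (atom_facts x y z p a Ha) as (A1 & _).
    destruct (atom_facts x y z p' b Hb) as (B1 & _).
    rewrite (eqname_eq _ _ _ _ A1 B1). reflexivity.
Qed.

End Verifier.

Section Certificate.

(* Rows of the array in [y]: 0 the length of the cycle, 1 its tgds, 2 to 6 an
   existential edge (index in the cycle, body atom and argument, head atom and
   argument), [7 + 2 * e] and [8 + 2 * e] the maps [h1] and [h2] of edge [e]. In
   [z], rows 0 and 1 describe the extension of [h2]: the value of an existential
   variable is that of the variable of [xi1] or [xi2] (depending on row 0) whose
   name starts at the position given in row 1. Row [3 + r] is the set of
   positions of the relation with identifier [r]. *)
Variables x y : list bool.
Variable Sigma : list tgd.

Notation Yt := (y_entry x y).
Notation REP := (REP x).

Definition cyc_len : nat := Yt 0 0.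
Definition cyc_tgd (e : nat) : tgd := nth (Yt 1 e) Sigma (mkTgd [] []).
Definition cyc_next (e : nat) : nat := if S e =? cyc_len then 0 else S e.
Definition cyc_v1 (e : nat) : nat -> nat := code1 REP (fun v => Yt (7 + 2 * e) (REP v)) (cyc_tgd e).
Definition cyc_v2 (e : nat) : nat -> nat := code2 (fun v => Yt (8 + 2 * e) (REP v)).

Definition cyc_exist (A B : vatom) (v u : nat) : Prop :=
  let xi := cyc_tgd (Yt 2 0) in
  nth_error (body xi) (Yt 3 0) = Some A /\ nth_error (snd A) (Yt 4 0) = Some v /\
  In v (hvars xi) /\
  nth_error (head xi) (Yt 5 0) = Some B /\ nth_error (snd B) (Yt 6 0) = Some u /\
  ~ In u (uvars xi).

Definition cyc_range : Prop := 0 < cyc_len /\ forall e, e < cyc_len -> Yt 1 e < length Sigma.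

Definition cyc_valid : Prop :=
  cyc_range /\
  (forall e f, e < cyc_len -> f < cyc_len -> cyc_tgd e = cyc_tgd f -> e = f) /\
  (forall e, e < cyc_len ->
     trigger (cyc_v1 e) (cyc_v2 e) (cyc_tgd e) (cyc_tgd (cyc_next e))) /\
  Yt 2 0 < cyc_len /\ exists A B v u, cyc_exist A B v u.

Lemma nxt_lt : cyc_range -> forall e, e < cyc_len -> cyc_next e < cyc_len.
Proof.
  intros [H _] e He. unfold cyc_next. destruct (Nat.eqb_spec (S e) cyc_len); lia.
Qed.

End Certificate.

Section VerifierMeaning.

Variables x y z : list bool.
Variable Sigma : list tgd.
Hypothesis HS : x = enc_tgds Sigma.
Notation w := (enc_triple x y z).
Notation s := (length x).
Notation n := (length w).
Let Hn : 1 <= n := triple_pos x y z.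

Notation L := (NL w).
Notation At := (At x).
Notation REP := (REP x).
Notation Yt := (y_entry x y).
Notation Zt := (z_entry x z).
Notation m := (cyc_len x y).
Notation tg := (cyc_tgd x y Sigma).
Notation nxt := (cyc_next x y).
Notation v1 := (cyc_v1 x y Sigma).
Notation v2 := (cyc_v2 x y).

(** An entry is at most the length of [y], which occurs doubled in the triple. Hence the even codes
    formed from entries of [y] do not saturate. *)
Lemma Yt_bound i j : 2 * Yt i j + 4 <= n.
Proof.
  unfold y_entry. pose proof (array_le y (i * length x + j)). rewrite triple_length. lia.
Qed.

Lemma Y_lit k (e : nat) : @Y_ L (@lit_ L k) e = Yt k e.
Proof. apply Y_eq; [apply (lit_cong w Hn)|reflexivity]. Qed.

Lemma Y_row k (e j : nat) : @Y_ L (@plus_ L (@lit_ L k) (@twice_ L e)) j = Yt (k + 2 * e) j.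
Proof.
  apply Y_eq; [|reflexivity]. apply (plus_cong w Hn); [apply (lit_cong w Hn)|].
  now apply (twice_cong w Hn).
Qed.

Lemma m_eq : @m_ L = m.
Proof. apply Y_eq; reflexivity. Qed.

Lemma tau_eq (e : nat) : @tau_ L e = @tgd_ L (Yt 1 e).
Proof. unfold tau_. now rewrite Y_lit. Qed.

Lemma succ_cyc_eq (e : nat) : e < m -> @succ_cyc_ L e = nxt e.
Proof.
  intros He. pose proof (Yt_bound 0 0). unfold cyc_len in *. unfold succ_cyc_.
  rewrite (succ_exact w Hn) by lia. rewrite m_eq. reflexivity.
Qed.

Lemma rep_eq' (p v : nat) : At p (enc_nat v) -> @rep_ L p = REP v.
Proof. apply rep_eq. Qed.

Lemma REP_bound (p v : nat) : At p (enc_nat v) -> S (2 * REP v) < n.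
Proof.
  intros H. destruct (REP_spec x p v H) as (_ & _ & H3 & _). pose proof (s_lt_n x y z). lia.
Qed.

Lemma code2_eq (e p v : nat) : At p (enc_nat v) -> @code2_ L e p = v2 e v.
Proof.
  intros H. unfold code2_. rewrite Y_row, (rep_eq' _ _ H), (twice_exact w Hn); [reflexivity|].
  pose proof (Yt_bound (8 + 2 * e) (REP v)). lia.
Qed.

Section Range.

Hypothesis Hrange : cyc_range x y Sigma.

Lemma tau_At (e : nat) : e < m -> At (@tau_ L e) (enc_tgd (tg e)).
Proof.
  intros He. rewrite tau_eq. apply (tgd_At x y z Sigma HS). unfold cyc_tgd.
  apply nth_error_nth'. now apply Hrange.
Qed.

Lemma inU_iff (e p v : nat) : e < m -> At p (enc_nat v) ->
  (T (@inL_ L (@tau_ L e) p) <-> In v (uvars (tg e))).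
Proof.
  intros He Hp. apply inL_iff; [|exact Hp]. now apply (tgd_body x y z), tau_At.
Qed.

Lemma inH_iff (e p v : nat) : e < m -> At p (enc_nat v) ->
  (T (@inL_ L (@head_ L (@tau_ L e)) p) <-> In v (hvars (tg e))).
Proof.
  intros He Hp. apply inL_iff; [|exact Hp]. now apply (tgd_head x y z), tau_At.
Qed.

(** Comparison with [zero] selects its first branch when the truth value is false, hence the
    exchanged order. *)
Lemma ife_dec (c a b : nat) (P : Prop) (d : {P} + {~ P}) :
  (T c <-> P) -> @ife L c (@zero L) a b = if d then b else a.
Proof.
  intros H. unfold T in H. cbn [ife zero NL nat_lang].
  destruct (Nat.eqb_spec c 0), d; try reflexivity; tauto.
Qed.

Lemma code1_eq (e p v : nat) : e < m -> At p (enc_nat v) -> @code1_ L e p = v1 e v.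
Proof.
  intros He Hp. unfold code1_.
  rewrite (ife_dec _ _ _ _ (in_dec Nat.eq_dec v (uvars (tg e))) (inU_iff e p v He Hp)).
  rewrite Y_row, (rep_eq' _ _ Hp). pose proof (REP_bound p v Hp).
  rewrite !(twice_exact w Hn); [|lia|pose proof (Yt_bound (7 + 2 * e) (REP v)); lia].
  rewrite (succ_exact w Hn) by lia. reflexivity.
Qed.

Lemma eqfact_21 (e q q' : nat) a b : e < m -> At q (enc_atom a) -> At q' (enc_atom b) ->
  (T (@eqfact_ L (@code2_ L e) (@code1_ L e) q q') <-> instn (v2 e) a = instn (v1 e) b).
Proof.
  intros He Ha Hb. apply eqfact_iff; auto; intros p v _ Hp; [now apply code2_eq|now apply code1_eq].
Qed.

Lemma edgeok_iff (e : nat) : e < m ->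
  (T (@edgeok_ L e) <-> trigger (v1 e) (v2 e) (tg e) (tg (nxt e))).
Proof.
  intros He. unfold edgeok_. rewrite (succ_cyc_eq e He). pose proof (nxt_lt x y Sigma Hrange e He) as He'.
  apply (exL_iff x y z _ _ _ _ (tgd_body x y z _ _ (tau_At _ He'))). intros q a Ha Hq.
  rewrite (T_and w Hn), (T_neg w Hn).
  rewrite (exL_iff x y z _ _ _ (fun b => instn (v2 e) a = instn (v1 e) b)
    (tgd_body x y z _ _ (tau_At _ He))) by (intros; now apply eqfact_21).
  rewrite (exL_iff x y z _ _ _ (fun b => instn (v2 e) a = instn (v1 e) b)
    (tgd_head x y z _ _ (tau_At _ He))) by (intros; now apply eqfact_21).
  split; intros [H1 H2]; (split; [|exact H2]).
  - intros b Hb E. apply H1. eauto.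
  - intros (b & Hb & E). exact (H1 b Hb E).
Qed.

Lemma distinct_iff :
  T (@distinct_ L) <-> forall e f, e < m -> f < m -> tg e = tg f -> e = f.
Proof.
  unfold distinct_. rewrite m_eq, (T_all w Hn). split.
  - intros H e f He Hf E. specialize (H e He). rewrite (T_all w Hn) in H. specialize (H f Hf).
    rewrite (T_or w Hn), (T_eqb w Hn), (T_neg w Hn) in H.
    rewrite (eqtgd_iff x y z _ _ _ _ (tau_At e He) (tau_At f Hf)) in H. tauto.
  - intros H e He. rewrite (T_all w Hn). intros f Hf.
    rewrite (T_or w Hn), (T_eqb w Hn), (T_neg w Hn).
    rewrite (eqtgd_iff x y z _ _ _ _ (tau_At e He) (tau_At f Hf)).
    destruct (Nat.eq_dec e f); [now left|]. right. auto.
Qed.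

Lemma lt_nth_error {A : Type} (l : list A) i : i < length l -> exists a, nth_error l i = Some a.
Proof.
  intros H. destruct (nth_error l i) eqn:E; [eauto|]. apply nth_error_None in E. lia.
Qed.

Lemma exist_pointers A B v u : Yt 2 0 < m -> cyc_exist x y Sigma A B v u ->
  At (@batom_ L) (enc_atom A) /\ At (@hatom_ L) (enc_atom B) /\
  @bpos_ L = Yt 4 0 /\ @hpos_ L = Yt 6 0.
Proof.
  intros He (H1 & H2 & H3 & H4 & H5 & H6). unfold batom_, hatom_, bpos_, hpos_, tau0_.
  rewrite !Y_lit. change (@zero L) with 0. pose proof (tau_At _ He) as Ht.
  split; [|split; [|split; reflexivity]].
  - apply (atoms_facts x y z _ _ (tgd_body x y z _ _ Ht)). exact H1.
  - apply (atoms_facts x y z _ _ (tgd_head x y z _ _ Ht)). exact H4.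
Qed.

Lemma exedge_iff :
  T (@exedge_ L) <-> Yt 2 0 < m /\ exists A B v u, cyc_exist x y Sigma A B v u.
Proof.
  unfold exedge_. rewrite !(T_and w Hn), !(T_lt w Hn), m_eq, (T_neg w Hn), !Y_lit.
  change (@zero L) with 0.
  assert (K : Yt 2 0 < m -> At (@tau0_ L) (enc_tgd (tg (Yt 2 0)))).
  { intros He. unfold tau0_. rewrite Y_lit. now apply tau_At. }
  split.
  - intros (He & [H1 H2] & H3 & [H4 H5] & H6). split; [exact He|]. specialize (K He).
    destruct (atoms_facts x y z _ _ (tgd_body x y z _ _ K)) as (B1 & B2 & _).
    destruct (atoms_facts x y z _ _ (tgd_head x y z _ _ K)) as (C1 & C2 & _).
    rewrite B1 in H1. rewrite C1 in H4.
    destruct (lt_nth_error _ _ H1) as [A EA]. destruct (lt_nth_error _ _ H4) as [B EB].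
    assert (PA : At (@batom_ L) (enc_atom A)) by (unfold batom_; rewrite Y_lit; now apply B2).
    assert (PB : At (@hatom_ L) (enc_atom B)) by (unfold hatom_; rewrite Y_lit; now apply C2).
    rewrite (arity_eq x y z _ _ PA) in H2. rewrite (arity_eq x y z _ _ PB) in H5.
    destruct (lt_nth_error _ _ H2) as [v Ev]. destruct (lt_nth_error _ _ H5) as [u Eu].
    rewrite (inL_iff x y z _ _ v _ (tgd_head x y z _ _ K)) in H3
      by now apply (arg_At x y z _ A).
    rewrite (inL_iff x y z _ _ u _ (tgd_body x y z _ _ K)) in H6
      by now apply (arg_At x y z _ B).
    unfold bpos_ in Ev. unfold hpos_ in Eu. rewrite Y_lit in Ev, Eu.
    exists A, B, v, u. repeat split; assumption.
  - intros (He & A & B & v & u & Hc). split; [exact He|]. specialize (K He).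
    destruct (exist_pointers A B v u He Hc) as (PA & PB & Eb & Eh).
    destruct Hc as (H1 & H2 & H3 & H4 & H5 & H6).
    destruct (atoms_facts x y z _ _ (tgd_body x y z _ _ K)) as (B1 & _).
    destruct (atoms_facts x y z _ _ (tgd_head x y z _ _ K)) as (C1 & _).
    rewrite B1, C1, (arity_eq x y z _ _ PA), (arity_eq x y z _ _ PB), Eb, Eh.
    rewrite (inL_iff x y z _ _ v _ (tgd_head x y z _ _ K)) by now apply (arg_At x y z _ A).
    rewrite (inL_iff x y z _ _ u _ (tgd_body x y z _ _ K)) by now apply (arg_At x y z _ B).
    repeat split; try assumption; apply nth_error_Some; congruence.
Qed.

(* the assignment of the variables of the head that [z] proposes for edge [e] *)
Definition cert_g (e v : nat) : nat :=
  if in_dec Nat.eq_dec v (uvars (tg (nxt e))) then v2 e v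
  else if Zt 0 (REP v) =? 0 then @code1_ L e (Zt 1 (REP v)) else @code2_ L e (Zt 1 (REP v)).

Lemma codeg_eq (e p v : nat) : e < m -> At p (enc_nat v) -> @codeg_ L e p = cert_g e v.
Proof.
  intros He Hp. unfold codeg_. rewrite (succ_cyc_eq e He). pose proof (nxt_lt x y Sigma Hrange e He) as He'.
  rewrite (ife_dec _ _ _ _ (in_dec Nat.eq_dec v (uvars (tg (nxt e)))) (inU_iff _ p v He' Hp)).
  unfold cert_g. rewrite (code2_eq e p v Hp), (rep_eq' _ _ Hp).
  rewrite (Z_eq x y z (@zero L) (REP v) 0 (REP v)) by reflexivity.
  rewrite (Z_eq x y z (@lit_ L 1) (REP v) 1 (REP v)) by (apply (lit_cong w Hn) || reflexivity).
  reflexivity.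
Qed.

Lemma zhom_iff :
  T (@zhom_ L) <-> exists e, e < m /\ hom (v1 e) (v2 e) (tg e) (tg (nxt e)) (cert_g e).
Proof.
  unfold zhom_. rewrite (T_ex w Hn), m_eq.
  assert (K : forall e, e < m -> forall q q' a b, At q (enc_atom b) -> At q' (enc_atom a) ->
    (T (@eqfact_ L (@codeg_ L e) (@code1_ L e) q q') <-> instn (cert_g e) b = instn (v1 e) a)).
  { intros e He q q' a b Hb Ha. apply eqfact_iff; auto; intros p v _ Hp;
      [now apply codeg_eq|now apply code1_eq]. }
  assert (K' : forall e, e < m -> forall q q' a b, At q (enc_atom b) -> At q' (enc_atom a) ->
    (T (@eqfact_ L (@codeg_ L e) (@code2_ L e) q q') <-> instn (cert_g e) b = instn (v2 e) a)).
  { intros e He q q' a b Hb Ha. apply eqfact_iff; auto; intros p v _ Hp;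
      [now apply codeg_eq|now apply code2_eq]. }
  assert (E : forall e, e < m -> (T (@allL_ L (@head_ L (@tau_ L (@succ_cyc_ L e))) (fun b =>
    @or_ L (@exL_ L (@tau_ L e) (fun a => @eqfact_ L (@codeg_ L e) (@code1_ L e) b a))
    (@or_ L (@exL_ L (@head_ L (@tau_ L e)) (fun a => @eqfact_ L (@codeg_ L e) (@code1_ L e) b a))
         (@exL_ L (@tau_ L (@succ_cyc_ L e)) (fun a => @eqfact_ L (@codeg_ L e) (@code2_ L e) b a)))))
    <-> hom (v1 e) (v2 e) (tg e) (tg (nxt e)) (cert_g e))).
  { intros e He. rewrite (succ_cyc_eq e He). pose proof (nxt_lt x y Sigma Hrange e He) as He'.
    rewrite (allL_iff x y z _ _ _ (fun b =>
      (exists a, In a (body (tg e)) /\ instn (cert_g e) b = instn (v1 e) a) \/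
      (exists a, In a (head (tg e)) /\ instn (cert_g e) b = instn (v1 e) a) \/
      (exists a, In a (body (tg (nxt e))) /\ instn (cert_g e) b = instn (v2 e) a))
      (tgd_head x y z _ _ (tau_At _ He'))).
    - unfold hom. split; [|tauto]. intros H. split; [|exact H]. intros v Hv. unfold cert_g.
      now destruct (in_dec _ _ _).
    - intros q b Hb Hq. rewrite !(T_or w Hn).
      rewrite (exL_iff x y z _ _ _ (fun a => instn (cert_g e) b = instn (v1 e) a)
        (tgd_body x y z _ _ (tau_At _ He))) by (intros; now apply K).
      rewrite (exL_iff x y z _ _ _ (fun a => instn (cert_g e) b = instn (v1 e) a)
        (tgd_head x y z _ _ (tau_At _ He))) by (intros; now apply K).
      rewrite (exL_iff x y z _ _ _ (fun a => instn (cert_g e) b = instn (v2 e) a)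
        (tgd_body x y z _ _ (tau_At _ He'))) by (intros; now apply K').
      reflexivity. }
  split; intros (e & He & H); exists e; (split; [exact He|]); now apply (E e He).
Qed.

Definition cert_S (p : position) : Prop := Zt (3 + REP (fst p)) (snd p) <> 0.

Lemma inS_iff (q k : nat) a :
  At q (enc_atom a) -> (T (@inS_ L q k) <-> cert_S (fst a, k)).
Proof.
  intros H. destruct (atom_facts x y z q a H) as (A1 & _). unfold inS_, cert_S, T.
  rewrite (rep_eq' _ _ A1). rewrite (Z_eq x y z _ k (3 + REP (fst a)) k); [reflexivity| |reflexivity].
  apply (plus_cong w Hn); [apply (lit_cong w Hn)|reflexivity].
Qed.

(** Closure under the dependency edges contributed by one tgd: the case [u = v] gives the universal
    edges, the other case the existential ones. *)
Definition closed_in (xi : tgd) (P : position -> Prop) : Prop :=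
  forall a, In a (body xi) -> forall k v, nth_error (snd a) k = Some v ->
    In v (hvars xi) /\ P (fst a, k) ->
    forall b, In b (head xi) -> forall l u, nth_error (snd b) l = Some u ->
      u = v \/ ~ In u (uvars xi) -> P (fst b, l).

Lemma zset_iff A B v u : Yt 2 0 < m -> cyc_exist x y Sigma A B v u ->
  (T (@zset_ L) <-> cert_S (fst B, Yt 6 0) /\ ~ cert_S (fst A, Yt 4 0) /\
     forall e, e < m -> closed_in (tg e) cert_S).
Proof.
  intros He Hc. destruct (exist_pointers A B v u He Hc) as (PA & PB & Eb & Eh).
  unfold zset_. rewrite !(T_and w Hn), (T_neg w Hn), Eb, Eh.
  rewrite (inS_iff _ _ _ PA), (inS_iff _ _ _ PB), m_eq, (T_all w Hn).
  apply and_iff_compat_l, and_iff_compat_l.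
  assert (E : forall e, e < m ->
    (T (@allL_ L (@tau_ L e) (fun a => @all_ L (@arity_ L a) (fun k =>
      @imp_ L (@and_ L (@inL_ L (@head_ L (@tau_ L e)) (@arg_ L a k)) (@inS_ L a k))
        (@allL_ L (@head_ L (@tau_ L e)) (fun b => @all_ L (@arity_ L b) (fun l =>
          @imp_ L (@or_ L (@eqname_ L (@arg_ L b l) (@arg_ L a k))
                     (@neg_ L (@inL_ L (@tau_ L e) (@arg_ L b l))))
            (@inS_ L b l))))))) <-> closed_in (tg e) cert_S)).
  { intros e Hlt. pose proof (tau_At e Hlt) as Ht.
    apply (allL_iff x y z _ _ _ _ (tgd_body x y z _ _ Ht)). intros q a Ha Hq.
    apply (allArg_iff x y z _ _ _ (fun k v' => In v' (hvars (tg e)) /\ cert_S (fst a, k) ->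
      forall b, In b (head (tg e)) -> forall l u, nth_error (snd b) l = Some u ->
      u = v' \/ ~ In u (uvars (tg e)) -> cert_S (fst b, l)) Hq).
    intros k v' Ev. pose proof (arg_At x y z q a k v' Hq Ev) as Hv.
    rewrite (T_imp w Hn), (T_and w Hn), (inH_iff e _ v' Hlt Hv), (inS_iff _ _ _ Hq).
    rewrite (allL_iff x y z _ _ _ (fun b => forall l u, nth_error (snd b) l = Some u ->
      u = v' \/ ~ In u (uvars (tg e)) -> cert_S (fst b, l)) (tgd_head x y z _ _ Ht));
      [reflexivity|].
    intros q' b Hb Hq'.
    apply (allArg_iff x y z _ _ _ (fun l u => u = v' \/ ~ In u (uvars (tg e)) ->
      cert_S (fst b, l)) Hq').
    intros l u' Eu. pose proof (arg_At x y z q' b l u' Hq' Eu) as Hu.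
    rewrite (T_imp w Hn), (T_or w Hn), (T_neg w Hn), (inU_iff e _ u' Hlt Hu).
    rewrite (eqname_eq x y z _ _ _ _ Hu Hv), (inS_iff _ _ _ Hq'). reflexivity. }
  split; intros H e Hlt; apply (E e Hlt); auto.
Qed.

End Range.

Lemma ycond_iff : T (@ycond_ L) <-> cyc_valid x y Sigma.
Proof.
  unfold ycond_, cyc_valid, cyc_range. rewrite !(T_and w Hn), (T_lt w Hn), !(T_all w Hn), m_eq.
  change (@zero L) with 0.
  assert (K : (forall e, e < m -> T (@lt_ L (@Y_ L (@lit_ L 1) e) (@ntgds_ L))) <->
    forall e, e < m -> Yt 1 e < length Sigma).
  { split; intros H e He; specialize (H e He);
      rewrite (T_lt w Hn), Y_lit, (ntgds_eq x y z Sigma HS) in *; exact H. }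
  assert (K2 : cyc_range x y Sigma ->
    (forall e, e < m -> T (@edgeok_ L e)) <->
    (forall e, e < m -> trigger (v1 e) (v2 e) (tg e) (tg (nxt e)))).
  { intros Hr. split; intros H e He; apply (edgeok_iff Hr e He); auto. }
  split.
  - intros (H1 & H2 & H3 & H4 & H5).
    assert (Hr : cyc_range x y Sigma) by (split; [exact H1|now apply K]).
    rewrite (distinct_iff Hr) in H3. rewrite (K2 Hr) in H4. rewrite (exedge_iff Hr) in H5.
    repeat split; auto; try apply Hr; tauto.
  - intros (Hr & H3 & H4 & H5). rewrite (distinct_iff Hr), (K2 Hr), (exedge_iff Hr).
    split; [apply Hr|]. split; [now apply K, Hr|]. tauto.
Qed.

Lemma verifier_iff : T (@verifier_ L) <->
  well_formed Sigma /\ (cyc_valid x y Sigma -> T (@zhom_ L) \/ T (@zset_ L)).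
Proof.
  unfold verifier_. rewrite !(T_and w Hn), !(T_or w Hn), (T_neg w Hn), ycond_iff.
  rewrite (wfx_iff x y z Sigma HS), (okx_iff x y z).
  destruct (classic (cyc_valid x y Sigma)); split; try tauto.
  - intros [H1 H2]. split; [eauto|tauto].
  - intros [H1 H2]. split; [eauto|tauto].
Qed.

End VerifierMeaning.

(** * From semantic objects to certificates *)

(** Unary entries are affordable because all entries of the certificates built below are linear in
    the length of [x]. *)
Definition enc_array (l : list nat) : list bool :=
  flat_map (fun v => repeat true v ++ [false]) l.

Lemma array_ones v l i :
  array (repeat true v ++ l) i = (if i =? 0 then v else 0) + array l i.
Proof.
  induction v as [|v IH]; cbn; [now destruct (i =? 0)|]. rewrite IH. destruct (i =? 0); lia.
Qed.

Lemma array_enc l : forall i, array (enc_array l) i = nth i l 0.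
Proof.
  induction l as [|v l IH]; intros i; [now destruct i|].
  cbn [enc_array flat_map]. rewrite <- app_assoc, array_ones. destruct i; cbn; [lia|apply IH].
Qed.

Lemma enc_array_length l M : (forall v, In v l -> v <= M) -> length (enc_array l) <= length l * S M.
Proof.
  induction l as [|v l IH]; intros H; cbn; [lia|].
  rewrite !length_app, repeat_length. cbn.
  pose proof (H v (or_introl eq_refl)). specialize (IH (fun u Hu => H u (or_intror Hu))).
  unfold enc_array in IH. lia.
Qed.

Definition table (s rows : nat) (F : nat -> nat -> nat) : list bool :=
  enc_array (map (fun k => F (k / s) (k mod s)) (seq 0 (rows * s))).

Lemma table_get s rows F i j : i < rows -> j < s -> array (table s rows F) (i * s + j) = F i j.
Proof.
  intros Hi Hj. unfold table. rewrite array_enc.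
  assert (Hlt : i * s + j < rows * s) by nia.
  rewrite (nth_indep _ 0 ((fun k => F (k / s) (k mod s)) 0))
    by (rewrite length_map, length_seq; exact Hlt).
  rewrite (map_nth (fun k => F (k / s) (k mod s))), seq_nth by exact Hlt. cbn [Nat.add].
  rewrite Nat.add_comm, Nat.div_add, Nat.Div0.mod_add by lia.
  now rewrite Nat.div_small, Nat.mod_small.
Qed.

Lemma table_length s rows F M :
  (forall i j, i < rows -> j < s -> F i j <= M) -> length (table s rows F) <= rows * s * S M.
Proof.
  intros H. unfold table.
  pose proof (enc_array_length (map (fun k => F (k / s) (k mod s)) (seq 0 (rows * s))) M) as K.
  rewrite length_map, length_seq in K. apply K. intros v Hv. apply in_map_iff in Hv. destruct Hv as (k & <- & Hk).
  apply in_seq in Hk. destruct s; [lia|]. apply H.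
  - apply Nat.Div0.div_lt_upper_bound. lia.
  - apply Nat.mod_upper_bound. lia.
Qed.

Lemma finite_choice {A : Type} (d : A) (P : nat -> A -> Prop) k :
  (forall i, i < k -> exists a, P i a) -> exists f, forall i, i < k -> P i (f i).
Proof.
  induction k as [|k IH]; intros H; [exists (fun _ => d); intros; lia|].
  destruct IH as [f Hf]; [intros; apply H; lia|]. destruct (H k ltac:(lia)) as [a Ha].
  exists (fun i => if i =? k then a else f i). intros i Hi.
  destruct (Nat.eqb_spec i k); [now subst|]. apply Hf. lia.
Qed.

Lemma first_true_le c : forall f, first_true f c <= c.
Proof. induction c; intros f; cbn; [lia|]. destruct (f 0); [lia|]. specialize (IHc (fun i => f (S i))). lia. Qed.

Lemma REP_le x v : REP x v <= length x.
Proof. apply first_true_le. Qed.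

Lemma hom_g_ext v1 v2 xi1 xi2 g g' :
  (forall x, In x (uvars xi2) \/ In x (hvars xi2) -> g x = g' x) ->
  hom v1 v2 xi1 xi2 g -> hom v1 v2 xi1 xi2 g'.
Proof.
  intros E [H1 H2]. split.
  - intros x Hx. rewrite <- E by auto. now apply H1.
  - intros b Hb. rewrite <- (instn_ext g g' b); [now apply H2|].
    intros x Hx. apply E. right. eapply in_hvars; eauto.
Qed.

(** Every value an extension takes on the head is already the code of some variable of [xi1] or
    [xi2]. So [z] can describe it by naming that variable instead of storing a number. *)
Lemma hom_values v1 v2 xi1 xi2 g u :
  hom v1 v2 xi1 xi2 g -> In u (hvars xi2) ->
  (exists x, (In x (uvars xi1) \/ In x (hvars xi1)) /\ g u = v1 x) \/
  (exists x, In x (uvars xi2) /\ g u = v2 x).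
Proof.
  intros [_ H] Hu. apply in_flat_map in Hu. destruct Hu as (b & Hb & Hu).
  assert (K : forall v a, instn g b = instn v a -> exists x, In x (snd a) /\ g u = v x).
  { intros v a E. injection E as _ E. apply (in_map g) in Hu. rewrite E in Hu.
    apply in_map_iff in Hu. destruct Hu as (x & Ex & Hx). eauto. }
  destruct (H b Hb) as [(a & Ha & E)|[(a & Ha & E)|(a & Ha & E)]];
    destruct (K _ _ E) as (x & Hx & Ex); [left|left|right]; exists x; (split; [|exact Ex]).
  - left. eapply in_uvars; eauto.
  - right. eapply in_hvars; eauto.
  - eapply in_uvars; eauto.
Qed.

Lemma enc_atom_args a : length (snd a) <= length (enc_atom a).
Proof.
  unfold enc_atom, enc_list. rewrite !length_app.
  pose proof (flat_map_length_ge enc_nat (snd a) enc_nat_ge). lia.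
Qed.

Lemma flat_map_snd_length l : length (flat_map snd l) <= length (flat_map enc_atom l).
Proof.
  induction l as [|a l IH]; cbn; [lia|]. rewrite !length_app.
  pose proof (enc_atom_args a). lia.
Qed.

Section Encoded.

Variable Sigma : list tgd.
Notation x := (enc_tgds Sigma).
Notation s := (length x).
Notation At := (At x).
Notation REP := (REP x).

Definition named (v : nat) : Prop := exists p, At p (enc_nat v).

(** Where a code stands in [x] does not depend on the certificates; the empty ones merely supply a
    triple on which the parsing functions are defined. *)
Lemma tgd_located xi : In xi Sigma -> exists p, At p (enc_tgd xi).
Proof.
  intros H. apply In_nth_error in H. destruct H as [i Ei].
  exists (@tgd_ (NL (enc_triple x [] [])) i). now apply (tgd_At x [] [] Sigma eq_refl).
Qed.

Lemma atom_located xi a : In xi Sigma -> In a (body xi) \/ In a (head xi) ->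
  exists p, At p (enc_atom a).
Proof.
  intros H Ha. destruct (tgd_located xi H) as [p Hp].
  assert (K : forall q l, At q (enc_list enc_atom l) -> In a l -> exists p, At p (enc_atom a)).
  { intros q l Hq Hin. apply In_nth_error in Hin. destruct Hin as [j Ej].
    exists (@atom_ (NL (enc_triple x [] [])) q j).
    now apply (atoms_facts x [] [] q l Hq). }
  destruct Ha as [Ha|Ha].
  - exact (K _ _ (tgd_body x [] [] p xi Hp) Ha).
  - exact (K _ _ (tgd_head x [] [] p xi Hp) Ha).
Qed.

Lemma var_named xi v : In xi Sigma -> In v (uvars xi) \/ In v (hvars xi) -> named v.
Proof.
  intros H Hv.
  assert (K : exists a, (In a (body xi) \/ In a (head xi)) /\ In v (snd a)).
  { destruct Hv as [Hv|Hv]; apply in_flat_map in Hv; destruct Hv as (a & Ha & Hv); eauto. }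
  destruct K as (a & Ha & Hin). destruct (atom_located xi a H Ha) as [p Hp].
  apply In_nth_error in Hin. destruct Hin as [k Ek].
  exists (@arg_ (NL (enc_triple x [] [])) p k). now apply (arg_At x [] [] p a).
Qed.

Lemma rel_named xi a : In xi Sigma -> In a (body xi) \/ In a (head xi) -> named (fst a).
Proof.
  intros H Ha. destruct (atom_located xi a H Ha) as [p Hp]. exists p.
  apply (atom_facts x [] [] p a Hp).
Qed.

Lemma arity_bound xi a : In xi Sigma -> In a (body xi) \/ In a (head xi) -> length (snd a) <= s.
Proof.
  intros H Ha. destruct (atom_located xi a H Ha) as [p [Hp _]].
  pose proof (enc_atom_args a). lia.
Qed.

Lemma tgd_bounds xi : In xi Sigma ->
  length (uvars xi) <= s /\ length (body xi) <= s /\ length (head xi) <= s.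
Proof.
  intros H. destruct (tgd_located xi H) as [p [Hp _]].
  unfold enc_tgd, enc_list in Hp. rewrite !length_app in Hp.
  pose proof (flat_map_snd_length (body xi)). unfold uvars.
  pose proof (flat_map_length_ge enc_atom (body xi) enc_atom_ge).
  pose proof (flat_map_length_ge enc_atom (head xi) enc_atom_ge). lia.
Qed.

Lemma Sigma_bound : length Sigma <= s.
Proof.
  unfold enc_tgds, enc_list. rewrite length_app.
  pose proof (flat_map_length_ge enc_tgd Sigma enc_tgd_ge). lia.
Qed.

Lemma REP_named_inj u v : named u -> named v -> REP u = REP v -> u = v.
Proof. intros [p Hp] [q Hq]. now apply (REP_inj x p q). Qed.

Lemma REP_named v : named v -> At (REP v) (enc_nat v) /\ REP v < s.
Proof. intros [p Hp]. destruct (REP_spec x p v Hp) as (H1 & _ & H2 & _). now split. Qed.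

Lemma REP_inj_hvars xi : In xi Sigma ->
  forall u v, In u (hvars xi) -> In v (hvars xi) -> REP u = REP v -> u = v.
Proof. intros H u v Hu Hv. apply REP_named_inj; eapply var_named; eauto. Qed.

(** * Answers to a valid certificate [y] *)

Section Sound.

Variable y : list bool.
Hypothesis Hv : cyc_valid x y Sigma.

Notation m := (cyc_len x y).
Notation tg := (cyc_tgd x y Sigma).
Notation nxt := (cyc_next x y).
Notation v1 := (cyc_v1 x y Sigma).
Notation v2 := (cyc_v2 x y).
Notation Yt := (y_entry x y).

Let Hr : cyc_range x y Sigma := proj1 Hv.

Lemma tg_in e : e < m -> In (tg e) Sigma.
Proof. intros He. unfold cyc_tgd. apply nth_In. now apply Hr. Qed.

Lemma nxt_mod e : e < m -> nxt e = S e mod m.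
Proof.
  intros He. unfold cyc_next. destruct (Nat.eqb_spec (S e) m) as [->|].
  - now rewrite Nat.Div0.mod_same.
  - rewrite Nat.mod_small; lia.
Qed.

(** Identifiers are injective on the head variables of a tgd, so each column of the table concerns
    at most one of them. Two rows of [s] unary entries, each at most [s], give the length. *)
Lemma hom_certificate e g : e < m -> hom (v1 e) (v2 e) (tg e) (tg (nxt e)) g ->
  exists z, length z <= 2 * s * S s /\ T (@zhom_ (NL (enc_triple x y z))).
Proof.
  intros He Hg. pose proof (nxt_lt x y Sigma Hr e He) as He'.
  pose (xi2 := tg (nxt e)).
  destruct (finite_choice (0, 0) (fun r tu =>
    fst tu <= 1 /\ forall v, In v (hvars xi2) -> REP v = r -> named (snd tu) /\
      (if fst tu =? 0 then named (snd tu) /\ g v = v1 e (snd tu) else g v = v2 e (snd tu))) s)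
    as [f Hf].
  { intros r _. destruct (classic (exists v, In v (hvars xi2) /\ REP v = r)) as [(v & Hvv & Er)|Hn].
    - assert (U : forall v', In v' (hvars xi2) -> REP v' = r -> v' = v).
      { intros v' Hv' Er'. apply (REP_inj_hvars xi2 (tg_in _ He')); congruence. }
      destruct (hom_values _ _ _ _ _ v Hg Hvv) as [(u & Hu & Eu)|(u & Hu & Eu)].
      + exists (0, u). split; [cbn; lia|]. intros v' Hv' Er'. rewrite (U v' Hv' Er'). cbn.
        assert (named u) by (apply (var_named (tg e)); [now apply tg_in|exact Hu]). auto.
      + exists (1, u). split; [cbn; lia|]. intros v' Hv' Er'. rewrite (U v' Hv' Er'). cbn.
        split; [|exact Eu]. apply (var_named xi2); [now apply tg_in|now left].
    - exists (0, 0). split; [cbn; lia|]. intros v Hvv Er. exfalso. eauto. }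
  pose (z := table s 2 (fun i r => if i =? 0 then fst (f r) else REP (snd (f r)))).
  exists z. split.
  - apply table_length. intros i j Hi Hj. destruct (i =? 0); [|apply REP_le].
    destruct (Hf j Hj) as [H _]. lia.
  - apply (zhom_iff x y z Sigma eq_refl Hr). exists e. split; [exact He|].
    apply (hom_g_ext _ _ _ _ g); [|exact Hg]. intros v Hvv. unfold cert_g.
    destruct (in_dec Nat.eq_dec v (uvars (tg (nxt e)))) as [Hin|Hin]; [now apply Hg|].
    destruct Hvv as [|Hvv]; [contradiction|].
    destruct (REP_named v) as [_ Hlt].
    { apply (var_named xi2); [now apply tg_in|now right]. }
    destruct (Hf (REP v) Hlt) as [_ Hf']. destruct (Hf' v Hvv eq_refl) as [Hna Hval].
    unfold z_entry, z. rewrite !table_get by lia. cbn [Nat.eqb].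
    destruct (REP_named _ Hna) as [Hat _].
    destruct (fst (f (REP v)) =? 0).
    + rewrite (code1_eq x y _ Sigma eq_refl Hr e _ _ He Hat). apply Hval.
    + now rewrite (code2_eq x y _ e _ _ Hat).
Qed.

Lemma cycle_simple :
  (forall e, e < m -> ~ exists g, hom (v1 e) (v2 e) (tg e) (tg (nxt e)) g) ->
  simple_cycle Sigma (map tg (seq 0 m)).
Proof.
  intros Hno. pose proof Hv as (_ & Hinj & Htr & _). split; [|split; [|split]].
  - intros E. apply (f_equal (@length tgd)) in E. rewrite length_map, length_seq in E.
    pose proof (proj1 Hr). cbn in E. lia.
  - apply NoDup_map_NoDup_ForallPairs; [|apply seq_NoDup].
    intros a b Ha Hb. apply in_seq in Ha, Hb. apply Hinj; lia.
  - intros xi Hxi. apply in_map_iff in Hxi. destruct Hxi as (e & <- & He).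
    apply in_seq in He. apply tg_in. lia.
  - intros i xi xi' Hi Hi'. rewrite length_map, length_seq in Hi'.
    assert (Hlt : i < m).
    { rewrite <- (length_seq m 0), <- (length_map tg). apply nth_error_Some. congruence. }
    assert (K : forall j, j < m -> nth_error (map tg (seq 0 m)) j = Some (tg j)).
    { intros j Hj. rewrite nth_error_map, (nth_error_nth' _ 0) by now rewrite length_seq.
      rewrite seq_nth by exact Hj. reflexivity. }
    rewrite K in Hi by exact Hlt. rewrite <- nxt_mod in Hi' by exact Hlt.
    rewrite K in Hi' by now apply (nxt_lt x y Sigma Hr). injection Hi as <-. injection Hi' as <-.
    apply (prec_of_codes REP _ _ (fun v => Yt (7 + 2 * i) (REP v)) (fun v => Yt (8 + 2 * i) (REP v))).
    + apply REP_inj_hvars, tg_in, Hlt.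
    + now apply Htr.
    + now apply Hno.
Qed.

Lemma set_certificate : weakly_acyclic (map tg (seq 0 m)) ->
  exists z, length z <= (3 + s) * s * 2 /\ T (@zset_ (NL (enc_triple x y z))).
Proof.
  intros Hwa. set (c := map tg (seq 0 m)) in *.
  pose proof Hv as (_ & _ & _ & He0 & A & B & v & u & Hex).
  pose proof Hex as (H1 & H2 & H3 & H4 & H5 & H6).
  pose (p := (fst A, Yt 4 0) : position). pose (q := (fst B, Yt 6 0) : position).
  assert (Hc : forall e, e < m -> In (tg e) c).
  { intros e He. apply in_map, in_seq. lia. }
  assert (Hpq : exist_edge c p q).
  { exists (tg (Yt 2 0)). split; [now apply Hc|]. exists v.
    split; [split; [|exact H3]; eapply in_uvars; eapply nth_error_In; eassumption|].
    split; [exists (snd A)|exists u; split; [split; [|exact H6]|exists (snd B)]].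
    - destruct A. split; [now apply nth_error_In in H1|exact H2].
    - eapply in_hvars; eapply nth_error_In; eassumption.
    - destruct B. split; [now apply nth_error_In in H4|exact H5]. }
  (* The set is everything reachable from [q]: it is closed by construction, and weak acyclicity
     keeps [p] out of it. *)
  pose (P := clos_refl_trans position (dep_edge c) q).
  assert (HnP : ~ P p) by exact (Hwa p q Hpq).
  assert (HPc : forall a b, dep_edge c a b -> P a -> P b).
  { intros a b Hab Ha. eapply rt_trans; [exact Ha|]. now apply rt_step. }
  (* A flat index [k] stands for row [k / s] and column [k mod s]. Rows of relations start at 3,
     clear of the rows 0 and 1 used by the other kind of answer. *)
  destruct (finite_choice 0 (fun k b => b <= 1 /\
    (b <> 0 <-> exists R, named R /\ 3 + REP R = k / s /\ P (R, k mod s))) ((3 + s) * s)) as [f Hf].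
  { intros k _. destruct (classic (exists R, named R /\ 3 + REP R = k / s /\ P (R, k mod s))).
    - exists 1. split; [lia|]. split; auto.
    - exists 0. split; [lia|]. split; [lia|tauto]. }
  pose (z := table s (3 + s) (fun i j => f (i * s + j))).
  assert (HS : forall R j, named R -> j < s -> (cert_S x z (R, j) <-> P (R, j))).
  { intros R j HR Hj. destruct (REP_named R HR) as [_ Hlt]. unfold cert_S, z_entry, z. cbn [fst snd].
    rewrite table_get by lia. destruct (Hf ((3 + REP R) * s + j) ltac:(nia)) as [_ ->].
    assert (E1 : ((3 + REP R) * s + j) / s = 3 + REP R).
    { rewrite Nat.div_add_l, (Nat.div_small j s) by lia. lia. }
    assert (E2 : ((3 + REP R) * s + j) mod s = j).
    { rewrite Nat.add_comm, Nat.Div0.mod_add. now apply Nat.mod_small. }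
    rewrite E1, E2. split.
    - intros (R' & HR' & E & HP). assert (R' = R) by (apply REP_named_inj; auto; lia). now subst.
    - intros HP. exists R. auto. }
  exists z. split.
  - apply table_length. intros i j Hi Hj. apply Hf. nia.
  - apply (zset_iff x y z Sigma eq_refl Hr A B v u He0 Hex).
    assert (HA : In A (body (tg (Yt 2 0)))) by now apply nth_error_In in H1.
    assert (HB : In B (head (tg (Yt 2 0)))) by now apply nth_error_In in H4.
    assert (HtA : In (tg (Yt 2 0)) Sigma) by now apply tg_in.
    assert (Hk : forall xi a k w, In xi Sigma -> In a (body xi) \/ In a (head xi) ->
      nth_error (snd a) k = Some w -> k < s).
    { intros xi a k w Hxi Ha Hw. pose proof (arity_bound xi a Hxi Ha).
      assert (k < length (snd a)) by (apply nth_error_Some; congruence). lia. }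
    split; [|split].
    + apply HS; [apply (rel_named (tg (Yt 2 0))); auto|apply (Hk (tg (Yt 2 0)) B _ u); auto|].
      apply rt_refl.
    + rewrite HS; [exact HnP|apply (rel_named (tg (Yt 2 0))); auto|
        apply (Hk (tg (Yt 2 0)) A _ v); auto].
    + intros e He a Ha k v' Hv' [Hfr Hin] b Hb l u' Hu' Hor.
      pose proof (tg_in e He) as Hte.
      rewrite HS in Hin by (apply (rel_named (tg e)) || apply (Hk (tg e) a k v'); auto).
      rewrite HS by (apply (rel_named (tg e)) || apply (Hk (tg e) b l u'); auto).
      apply (HPc (fst a, k)); [|exact Hin].
      assert (Hf1 : is_frontier (tg e) v').
      { split; [|exact Hfr]. eapply in_uvars; eauto using nth_error_In. }
      assert (Ho1 : occurs_at (body (tg e)) v' (fst a, k)).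
      { exists (snd a). destruct a. now split. }
      assert (Ho2 : occurs_at (head (tg e)) u' (fst b, l)).
      { exists (snd b). destruct b. now split. }
      destruct Hor as [->|Hne].
      * left. exists (tg e). split; [now apply Hc|]. exists v'. auto.
      * right. exists (tg e). split; [now apply Hc|]. exists v'.
        split; [exact Hf1|]. split; [exact Ho1|]. exists u'. split; [|exact Ho2].
        split; [|exact Hne]. eapply in_hvars; eauto using nth_error_In.
Qed.

End Sound.
End Encoded.

(** * Certificates for simple cycles with an existential edge *)

Section Complete.

Variable Sigma : list tgd.
Notation x := (enc_tgds Sigma).
Notation s := (length x).
Notation REP := (REP x).

(** Inverse of [REP] on the variables of [Sigma]: certificates store mappings by identifier, and 0
    is an arbitrary value for the remaining identifiers. *)
Definition name_of (r : nat) : nat :=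
  match find (fun v => REP v =? r) (flat_map (fun xi => uvars xi ++ hvars xi) Sigma) with
  | Some v => v
  | None => 0
  end.

Lemma name_of_REP xi v :
  In xi Sigma -> In v (uvars xi) \/ In v (hvars xi) -> name_of (REP v) = v.
Proof.
  intros Hxi Hv. unfold name_of. destruct (find _ _) as [u|] eqn:E.
  - apply find_some in E. destruct E as [Hu E]. apply Nat.eqb_eq in E.
    apply in_flat_map in Hu. destruct Hu as (xi' & Hxi' & Hu). apply in_app_or in Hu.
    apply (REP_named_inj Sigma); [exact (var_named Sigma xi' u Hxi' Hu)|exact (var_named Sigma xi v Hxi Hv)|exact E].
  - exfalso. assert (Hin : In v (flat_map (fun xi => uvars xi ++ hvars xi) Sigma)).
    { apply in_flat_map. exists xi. split; [exact Hxi|]. apply in_or_app. exact Hv. }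
    apply (find_none _ _ E) in Hin. now rewrite Nat.eqb_refl in Hin.
Qed.

Section Cycle.

Variable c : list tgd.
Hypothesis Hc : simple_cycle Sigma c.
Variables (A B : vatom) (v u : nat) (xi0 : tgd) (ka kb : nat).
Hypothesis Hxi0 : In xi0 c.
Hypothesis HA : In A (body xi0).
Hypothesis Hv : nth_error (snd A) ka = Some v.
Hypothesis Hvh : In v (hvars xi0).
Hypothesis HB : In B (head xi0).
Hypothesis Hu : nth_error (snd B) kb = Some u.
Hypothesis Hun : ~ In u (uvars xi0).

Notation m := (length c).
Let d : tgd := mkTgd [] [].
Let cn (e : nat) : tgd := nth (S e mod m) c d.

Lemma cycle_in e : e < m -> In (nth e c d) Sigma.
Proof. intros He. apply Hc. now apply nth_In. Qed.

Lemma cycle_pos : 0 < m.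
Proof. destruct Hc as [Hne _]. destruct c; [congruence|cbn; lia]. Qed.

Lemma cycle_next_lt e : S e mod m < m.
Proof. apply Nat.mod_upper_bound. pose proof cycle_pos. lia. Qed.

(** The rows in use go up to [8 + 2 * e] with [e < m <= s], so [9 + 2 * s] rows suffice. Entries are
    at most [2 * s], because the mappings of an edge are bounded by the universal occurrences in two
    tgds, each having at most [s]. *)
Lemma cycle_certificate : exists y,
  length y <= (9 + 2 * s) * s * S (2 * s) /\
  cyc_valid x y Sigma /\
  cyc_len x y = m /\
  (forall e, e < m -> cyc_tgd x y Sigma e = nth e c d) /\
  (forall e, e < m -> ~ exists g,
     hom (cyc_v1 x y Sigma e) (cyc_v2 x y e) (cyc_tgd x y Sigma e)
       (cyc_tgd x y Sigma (cyc_next x y e)) g) /\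
  cyc_exist x y Sigma A B v u /\ y_entry x y 4 0 = ka /\ y_entry x y 6 0 = kb.
Proof.
  pose proof Hc as (Hne & Hnd & Hincl & Hprec). pose proof cycle_pos as Hm.
  assert (Hms : m <= s).
  (* A cycle without repetitions is no longer than [Sigma], which in turn is no longer than its
     code. *)
  { pose proof (NoDup_incl_length Hnd Hincl). pose proof (Sigma_bound Sigma). lia. }
  destruct (finite_choice 0 (fun e i => nth_error Sigma i = Some (nth e c d)) m) as [ci Hci].
  { intros e He. apply In_nth_error, cycle_in, He. }
  destruct (finite_choice ((fun _ => 0), (fun _ => 0))
    (fun e (hh : (nat -> nat) * (nat -> nat)) =>
      (forall a, fst hh a <= 2 * s) /\ (forall a, snd hh a <= 2 * s) /\
      trigger (code1 REP (fst hh) (nth e c d)) (code2 (snd hh)) (nth e c d) (cn e) /\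
      ~ (exists g, hom (code1 REP (fst hh) (nth e c d)) (code2 (snd hh)) (nth e c d) (cn e) g)) m)
    as [h Hh].
  { intros e He. destruct (codes_of_prec REP (nth e c d) (cn e)) as (h1 & h2 & B1 & B2 & Ht & Hno).
    - apply REP_inj_hvars. now apply cycle_in.
    - apply (Hprec e); apply nth_error_nth'; [exact He|apply cycle_next_lt].
    - destruct (tgd_bounds Sigma _ (cycle_in e He)) as (L1 & _).
      destruct (tgd_bounds Sigma _ (cycle_in _ (cycle_next_lt e))) as (L2 & _).
      fold (cn e) in L2. exists (h1, h2). cbn.
      split; [intros a; specialize (B1 a); lia|].
      split; [intros a; specialize (B2 a); lia|]. now split. }
  pose proof Hxi0 as He0. apply In_nth_error in He0. destruct He0 as [e0 He0].
  assert (Hlt0 : e0 < m) by (apply nth_error_Some; congruence).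
  pose proof HA as Hja. apply In_nth_error in Hja. destruct Hja as [ja Hja].
  pose proof HB as Hjb. apply In_nth_error in Hjb. destruct Hjb as [jb Hjb].
  assert (Hin0 : In xi0 Sigma) by now apply Hincl.
  destruct (tgd_bounds Sigma xi0 Hin0) as (_ & Lb & Lh).
  pose proof (arity_bound Sigma xi0 A Hin0 (or_introl HA)) as LA.
  pose proof (arity_bound Sigma xi0 B Hin0 (or_intror HB)) as LB.
  assert (ja < length (body xi0)) by (apply nth_error_Some; congruence).
  assert (jb < length (head xi0)) by (apply nth_error_Some; congruence).
  assert (ka < length (snd A)) by (apply nth_error_Some; congruence).
  assert (kb < length (snd B)) by (apply nth_error_Some; congruence).
  (* From row 7 on, the offset [i] has half [e]; an even offset is the row of [h1] for edge [e], an
     odd one that of [h2]. *)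
  pose (F := fun i j => match i with
    | 0 => m
    | 1 => if j <? m then ci j else 0
    | 2 => e0 | 3 => ja | 4 => ka | 5 => jb | 6 => kb
    | S (S (S (S (S (S (S i)))))) =>
        if Nat.div2 i <? m then
          if Nat.even i then fst (h (Nat.div2 i)) (name_of j) else snd (h (Nat.div2 i)) (name_of j)
        else 0
    end).
  pose (y := table s (9 + 2 * s) F).
  assert (HY : forall i j, i < 9 + 2 * s -> j < s -> y_entry x y i j = F i j).
  { intros i j Hi Hj. unfold y_entry, y. now apply table_get. }
  assert (Em : cyc_len x y = m) by (unfold cyc_len; rewrite HY by lia; reflexivity).
  assert (Eci : forall e, e < m -> y_entry x y 1 e = ci e).
  { intros e He. rewrite HY by lia. cbv beta iota delta [F].
    apply Nat.ltb_lt in He. now rewrite He. }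
  assert (Etg : forall e, e < m -> cyc_tgd x y Sigma e = nth e c d).
  { intros e He. unfold cyc_tgd. rewrite Eci by exact He. apply nth_error_nth. now apply Hci. }
  assert (Hr : cyc_range x y Sigma).
  { split; [lia|]. rewrite Em. intros e He. rewrite Eci by exact He.
    apply nth_error_Some. rewrite Hci by exact He. discriminate. }
  assert (Enx : forall e, e < m -> cyc_next x y e = S e mod m).
  { intros e He. unfold cyc_next. rewrite Em. destruct (Nat.eqb_spec (S e) m) as [->|].
    - now rewrite Nat.Div0.mod_same.
    - rewrite Nat.mod_small; lia. }
  assert (Ecn : forall e, e < m -> cyc_tgd x y Sigma (cyc_next x y e) = cn e).
  { intros e He. rewrite Enx by exact He. apply Etg, cycle_next_lt. }
  (* The mappings stored in [y] are correct on the variables of the tgds concerned, and [trigger]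
     and [hom] look at no others. *)
  assert (E1 : forall e, e < m -> forall a, In a (uvars (nth e c d)) \/ In a (hvars (nth e c d)) ->
    code1 REP (fst (h e)) (nth e c d) a = cyc_v1 x y Sigma e a).
  { intros e He a Ha. unfold cyc_v1. rewrite Etg by exact He. unfold code1.
    destruct (in_dec _ _ _); [|reflexivity]. f_equal.
    destruct (REP_named Sigma a) as [_ Hlt]; [exact (var_named Sigma _ a (cycle_in e He) Ha)|].
    rewrite HY by lia. change (7 + 2 * e) with (S (S (S (S (S (S (S (2 * e)))))))).
    cbv beta iota delta [F]. rewrite Nat.div2_double, Nat.even_even.
    apply Nat.ltb_lt in He as Hb. rewrite Hb.
    now rewrite (name_of_REP (nth e c d)) by auto using cycle_in. }
  assert (E2 : forall e, e < m -> forall a, In a (uvars (cn e)) ->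
    code2 (snd (h e)) a = cyc_v2 x y e a).
  { intros e He a Ha. unfold cyc_v2, code2. f_equal.
    assert (Hcn : In (cn e) Sigma) by apply cycle_in, cycle_next_lt.
    destruct (REP_named Sigma a) as [_ Hlt]; [exact (var_named Sigma _ a Hcn (or_introl Ha))|].
    rewrite HY by lia. change (8 + 2 * e) with (S (S (S (S (S (S (S (S (2 * e))))))))).
    cbv beta iota delta [F]. rewrite Nat.div2_succ_double, Nat.even_succ, Nat.odd_even.
    apply Nat.ltb_lt in He as Hb. rewrite Hb.
    now rewrite (name_of_REP (cn e)) by auto. }
  assert (Hex : cyc_exist x y Sigma A B v u).
  { unfold cyc_exist. rewrite !HY by lia. cbv beta iota zeta delta [F]. rewrite Etg by exact Hlt0.
    rewrite (nth_error_nth c e0 d He0). repeat split; assumption. }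
  exists y. split; [|split; [|split; [exact Em|split; [exact Etg|split; [|split; [exact Hex|]]]]]].
  - apply table_length. intros i j Hi Hj. unfold F.
    assert (Hcj : forall e, e < m -> ci e <= 2 * s).
    { intros e He. pose proof (Sigma_bound Sigma).
      assert (ci e < length Sigma) by (apply nth_error_Some; rewrite Hci by exact He; discriminate).
      lia. }
    do 7 (destruct i as [|i]; [first [lia|destruct (Nat.ltb_spec j m); [now apply Hcj|lia]]|]).
    destruct (Nat.ltb_spec (Nat.div2 i) m) as [Hd|]; [|lia].
    destruct (Hh _ Hd) as (B1 & B2 & _). destruct (Nat.even i); auto.
  - split; [exact Hr|]. split; [|split; [|split]].
    + rewrite Em. intros e f He Hf E. rewrite !Etg in E by assumption.
      apply (NoDup_nth c d); assumption.
    + rewrite Em. intros e He. destruct (Hh e He) as (_ & _ & Ht & _).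
      rewrite Ecn by exact He. rewrite Etg by exact He.
      apply (trigger_ext _ _ _ _ _ _ (E1 e He) (E2 e He) Ht).
    + rewrite Em, HY by lia. exact Hlt0.
    + eauto.
  - intros e He [g Hg]. destruct (Hh e He) as (_ & _ & _ & Hno). apply Hno. exists g.
    rewrite Ecn in Hg by exact He. rewrite Etg in Hg by exact He.
    refine (hom_ext _ _ _ _ _ _ g _ _ Hg); intros a Ha; symmetry;
      [now apply (E1 e He)|now apply (E2 e He)].
  - split; rewrite HY by lia; reflexivity.
Qed.

End Cycle.

(** No edge admits an extension, so the answer must be a set. It is closed under [dep_edge c] and
    contains the head position, hence everything reachable from there, but not the body position. *)
Lemma cycle_refuted c y z A B v u ka kb :
  simple_cycle Sigma c ->
  cyc_valid x y Sigma -> cyc_len x y = length c ->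
  (forall e, e < length c -> cyc_tgd x y Sigma e = nth e c (mkTgd [] [])) ->
  (forall e, e < length c -> ~ exists g,
     hom (cyc_v1 x y Sigma e) (cyc_v2 x y e) (cyc_tgd x y Sigma e)
       (cyc_tgd x y Sigma (cyc_next x y e)) g) ->
  cyc_exist x y Sigma A B v u -> y_entry x y 4 0 = ka -> y_entry x y 6 0 = kb ->
  T (@zhom_ (NL (enc_triple x y z))) \/ T (@zset_ (NL (enc_triple x y z))) ->
  ~ clos_refl_trans position (dep_edge c) (fst B, kb) (fst A, ka).
Proof.
  intros Hc Hv Em Etg Hno Hex Ea Eb [H|H] Hrt.
  - apply (zhom_iff x y z Sigma eq_refl (proj1 Hv)) in H. destruct H as (e & He & H).
    rewrite Em in He. apply (Hno e He). eauto.
  - pose proof Hv as (Hr & _ & _ & He0 & _).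
    apply (zset_iff x y z Sigma eq_refl Hr A B v u He0 Hex) in H.
    rewrite Ea, Eb in H. destruct H as (H1 & H2 & H3). apply H2.
    refine (clos_rt_invariant (dep_edge c) (cert_S x z) _ _ _ Hrt H1).
    intros [R i] [R' j] Hedge Hin.
    assert (K : exists xi a b, In xi c /\ is_frontier xi a /\ occurs_at (body xi) a (R, i) /\
      occurs_at (head xi) b (R', j) /\ (b = a \/ ~ In b (uvars xi))).
    { destruct Hedge as [(xi & Hxi & a & Hf & Ho1 & Ho2)|(xi & Hxi & a & Hf & Ho1 & b & [_ Hb] & Ho2)].
      - exists xi, a, a. auto 10.
      - exists xi, a, b. auto 10. }
    destruct K as (xi & a & b & Hxi & [_ Hf] & (l1 & Hl1 & Hn1) & (l2 & Hl2 & Hn2) & Hor).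
    cbn [fst snd] in *. apply (In_nth _ _ (mkTgd [] [])) in Hxi. destruct Hxi as (e & He & <-).
    rewrite <- Etg in * by exact He. rewrite <- Em in He.
    exact (H3 e He (R, l1) Hl1 i a Hn1 (conj Hf Hin) (R', l2) Hl2 j b Hn2 Hor).
Qed.

End Complete.

(** The three left-hand sides are the lengths of the certificates constructed above: the table for a
    cycle, an extension, and a set of positions. The largest is cubic, and 100 is a generous
    coefficient. *)
Lemma size_bounds n :
  (9 + 2 * n) * n * S (2 * n) <= poly 100 3 n /\ 2 * n * S n <= poly 100 3 n /\
  (3 + n) * n * 2 <= poly 100 3 n.
Proof. unfold poly. cbn [Nat.pow]. destruct n; [cbn; lia|]. nia. Qed.

Lemma accepted_T x y z : accepted (enc_triple x y z) <-> T (@verifier_ (NL (enc_triple x y z))).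
Proof. reflexivity. Qed.

Theorem theorem17 : in_Pi2P CStr_problem.
Proof.
  exists accepted, 100, 3. split; [exact accepted_in_P|]. intros x. split.
  - intros (Sigma & Hwf & -> & Hcs) y _.
    pose proof (size_bounds (length (enc_tgds Sigma))) as (_ & S2 & S3).
    assert (K : forall z, (cyc_valid (enc_tgds Sigma) y Sigma ->
        T (@zhom_ (NL (enc_triple (enc_tgds Sigma) y z))) \/
        T (@zset_ (NL (enc_triple (enc_tgds Sigma) y z)))) ->
      accepted (enc_triple (enc_tgds Sigma) y z)).
    { intros z Hz. apply accepted_T, (verifier_iff _ y z Sigma eq_refl). now split. }
    destruct (classic (cyc_valid (enc_tgds Sigma) y Sigma)) as [Hv|Hv]; cycle 1.
    (* An invalid [y] claims nothing, so any [z] is accepted. *)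
    { exists []. split; [cbn; lia|]. apply K. tauto. }
    (* If some listed edge admits an extension, that is the answer. Otherwise all edges are genuine
       edges of the chase graph, and weak acyclicity of the cycle supplies the set. *)
    destruct (classic (exists e g, e < cyc_len (enc_tgds Sigma) y /\
      hom (cyc_v1 (enc_tgds Sigma) y Sigma e) (cyc_v2 (enc_tgds Sigma) y e)
        (cyc_tgd (enc_tgds Sigma) y Sigma e)
        (cyc_tgd (enc_tgds Sigma) y Sigma (cyc_next (enc_tgds Sigma) y e)) g)) as [(e & g & He & Hg)|Hno].
    + destruct (hom_certificate Sigma y Hv e g He Hg) as (z & Hlz & Hz).
      exists z. split; [lia|]. apply K. auto.
    + destruct (set_certificate Sigma y Hv) as (z & Hlz & Hz).
      { apply Hcs. apply cycle_simple; [exact Hv|]. intros e He [g Hg]. apply Hno. eauto. }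
      exists z. split; [lia|]. apply K. auto.
  (* Acceptance for a single [y], here the empty one, already shows that [x] encodes a well-formed
     set of tgds, because the verifier checks this independently of the certificates. *)
  - intros H. destruct (H [] ltac:(cbn; lia)) as (z0 & _ & Hz0). apply accepted_T in Hz0.
    assert (Hok : exists Sigma, x = enc_tgds Sigma).
    { apply (okx_iff x [] z0).
      exact (proj1 (proj1 (T_and (enc_triple x [] z0) (triple_pos x [] z0) _ _) Hz0)). }
    destruct Hok as [Sigma Hx]. exists Sigma.
    apply (verifier_iff x [] z0 Sigma Hx) in Hz0. split; [apply Hz0|]. split; [exact Hx|].
    clear z0 Hz0. subst x. intros c Hc p q Hpq Hrt.
    destruct Hpq as (xi & Hxi & v & [_ Hvh] & (l1 & Hl1 & Hn1) & u & [_ Hun] & (l2 & Hl2 & Hn2)).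
    (* The certificate records the cycle and the existential edge from [p] to [q], but not the
       assumed path back; the answer to it rules that path out. *)
    destruct (cycle_certificate Sigma c Hc (fst p, l1) (fst q, l2) v u xi (snd p) (snd q)
      Hxi Hl1 Hn1 Hvh Hl2 Hn2 Hun) as (y & Hly & Hv & Em & Etg & Hno & Hex & Ea & Eb).
    destruct (H y) as (z & _ & Hz).
    { pose proof (size_bounds (length (enc_tgds Sigma))) as (S1 & _). lia. }
    apply accepted_T, (verifier_iff _ y z Sigma eq_refl) in Hz. destruct Hz as [_ Hz].
    apply (cycle_refuted Sigma c y z (fst p, l1) (fst q, l2) v u (snd p) (snd q)); auto.
    cbn [fst]. now rewrite <- !surjective_pairing.
Qed.
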